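(* Let $q\geq 3$, $0\leq B<1$ and $\Delta\geq 3$, and consider the antiferromagnetic $q$-state Potts model with parameter $B$ on a random $\Delta$-regular bipartite graph (the case $B=0$ being the $q$-colorings model). Then: (1) If $B\geq\frac{\Delta-q}{\Delta}$, there is a unique dominant phase $(\boldsymbol{\alpha},\boldsymbol{\beta})$, and it satisfies $\boldsymbol{\alpha}=\boldsymbol{\beta}$. (2) If $q\geq 4$ is even and $0\leq B<\frac{\Delta-q}{\Delta}$, the dominant phases are in one-to-one correspondence with the subsets $T\subseteq[q]$ with $|T|=q/2$; moreover there exist $a=a(q,\Delta,B)$ and $b=b(q,\Delta,B)$ with $a\neq b$ such that the dominant phase $(\boldsymbol{\alpha},\boldsymbol{\beta})$ corresponding to $T$ satisfies $\alpha_i=a,\ \beta_i=b$ for $i\in T$ and $\alpha_i=b,\ \beta_i=a$ for $i\notin T$. Moreover, these dominant phases are Hessian dominant.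
   Context: The Potts model with parameter $B$ is the $q$-spin system with interaction matrix $\mathbf{B}$ having diagonal entries $B$ and off-diagonal entries $1$. Let $\mathcal{G}_n$ be the distribution on bipartite multigraphs with parts $V_1,V_2$ of size $n$ whose edge multiset is the union of $\Delta$ independent uniformly random perfect matchings. For $\boldsymbol{\alpha},\boldsymbol{\beta}$ in the probability simplex $\triangle_q$, let $Z_G^{\boldsymbol{\alpha},\boldsymbol{\beta}}$ be the total weight $\sum_\sigma\prod_{\{u,v\}\in E}B_{\sigma(u)\sigma(v)}$ of configurations $\sigma:V_1\cup V_2\to[q]$ having (canonically rounded) $\alpha_in$ vertices of $V_1$ and $\beta_in$ vertices of $V_2$ with spin $i$ for each $i$, and $\Psi_1(\boldsymbol{\alpha},\boldsymbol{\beta})=\lim_n\frac1n\log\mathbf{E}_{\mathcal{G}_n}[Z_G^{\boldsymbol{\alpha},\boldsymbol{\beta}}]=\max_{\mathbf{x}}[(\Delta-1)(\sum_i\alpha_i\ln\alpha_i+\sum_j\beta_j\ln\beta_j)+\Delta\sum_{i,j}x_{ij}(\ln B_{ij}-\ln x_{ij})]$, the maximum over nonnegative $\mathbf{x}\in\mathbb{R}^{q\times q}$ with row sums $\alpha_i$ and column sums $\beta_j$ (conventions $\ln0=-\infty$, $0\ln0=0$). A dominant phase is a maximizer of $\Psi_1$ over $\triangle_q\times\triangle_q$; it is Hessian dominant if the Hessian of $\Psi_1$ there, restricted to directions preserving $\sum_i\alpha_i=\sum_j\beta_j=1$, is negative definite. *)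

(* Defs.v *)
From HB Require Import structures.
From mathcomp Require Import all_boot all_order all_algebra.
From mathcomp Require Import all_classical all_reals all_analysis.
Set Implicit Arguments. Unset Strict Implicit. Unset Printing Implicit Defensive.
Import Order.TTheory GRing.Theory Num.Theory.
Import numFieldNormedType.Exports.
Local Open Scope classical_set_scope.
Local Open Scope ring_scope.

Section Potts.
Variables (R : realType) (q Delta : nat) (B : R).

Definition potts_mx : 'M[R]_q := \matrix_(i, j) (if i == j then B else 1).

Definition xlnx (x : R) : R := if x == 0 then 0 else x * ln x.

(* x (ln b - ln x), with ln 0 = -oo and 0 ln 0 = 0 (so the term is 0 when x = 0) *)
Definition edge_term (x b : R) : \bar R :=
  if x == 0 then 0%E else if b == 0 then -oo%E else (x * (ln b - ln x))%:E.

Definition psi_obj (alpha beta : 'rV[R]_q) (x : 'M[R]_q) : \bar R :=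
  (((Delta%:R - 1) * (\sum_i xlnx (alpha ord0 i) + \sum_j xlnx (beta ord0 j)))%:E
   + (Delta%:R)%:E * \sum_i \sum_j edge_term (x i j) (potts_mx i j))%E.

Definition feasible (alpha beta : 'rV[R]_q) (x : 'M[R]_q) : Prop :=
  [/\ forall i j, 0 <= x i j,
      forall i, \sum_j x i j = alpha ord0 i &
      forall j, \sum_i x i j = beta ord0 j].

(* Psi_1(alpha,beta) = max over feasible x (written as a sup; -oo if no x) *)
Definition Psi1 (alpha beta : 'rV[R]_q) : \bar R :=
  ereal_sup [set psi_obj alpha beta x | x in feasible alpha beta].

Definition in_simplex (alpha : 'rV[R]_q) : Prop :=
  (forall i, 0 <= alpha ord0 i) /\ \sum_i alpha ord0 i = 1.

Definition dominant_phase (alpha beta : 'rV[R]_q) : Prop :=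
  [/\ in_simplex alpha, in_simplex beta &
      forall alpha' beta', in_simplex alpha' -> in_simplex beta' ->
        (Psi1 alpha' beta' <= Psi1 alpha beta)%E].

Definition tangent_dir (w : 'rV[R]_q * 'rV[R]_q) : Prop :=
  \sum_i w.1 ord0 i = 0 /\ \sum_i w.2 ord0 i = 0.

Definition zsum_proj (u : 'rV[R]_q) : 'rV[R]_q :=
  \row_i (u ord0 i - (\sum_k u ord0 k) / q%:R).

(* Psi_1 restricted to the affine space through (alpha,beta) of pairs with
   sums preserved, extended to the whole space by composing with the
   projection onto the tangent directions (so that it is a real function on
   a normed space); it agrees with Psi_1 (alpha + u, beta + v) on tangent
   directions (u,v). *)
Definition Psi1_restr (alpha beta : 'rV[R]_q) (w : 'rV[R]_q * 'rV[R]_q) : R :=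
  fine (Psi1 (alpha + zsum_proj w.1) (beta + zsum_proj w.2)).

Definition hessian_dominant (alpha beta : 'rV[R]_q) : Prop :=
  let G := Psi1_restr alpha beta in
  [/\ dominant_phase alpha beta,
      (\forall w \near (0 : 'rV[R]_q * 'rV[R]_q),
         Psi1 (alpha + zsum_proj w.1) (beta + zsum_proj w.2) \is a fin_num),
      (\forall w \near (0 : 'rV[R]_q * 'rV[R]_q), differentiable G w),
      (forall v, differentiable ('D_v G) 0) &
      forall w, tangent_dir w -> w != 0 -> 'D_w ('D_w G) 0 < 0].

End Potts.

Arguments dominant_phase {R} q Delta B alpha beta.
Arguments hessian_dominant {R} q Delta B alpha beta.
Arguments Psi1 {R} q Delta B alpha beta.

(* Main.v *)
Require Import Defs.
From HB Require Import structures.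
From mathcomp Require Import all_boot all_order all_algebra.
From mathcomp Require Import all_classical all_reals all_analysis.
From mathcomp Require Import ring lra.
Set Implicit Arguments. Unset Strict Implicit. Unset Printing Implicit Defensive.
Import Order.TTheory GRing.Theory Num.Theory.
Import numFieldNormedType.Exports.
Local Open Scope ring_scope.

(** Write d = Delta - 1 (n + 1 below), alpha_i = r_i^Delta, beta_j = c_j^Delta.
Gibbs' inequality with the product weights r_i^d c_j^d gives
Psi_1 <= Delta ln (sum_ij B_ij r_i^d c_j^d), with equality at the fixed points
of the tree recursion.  Hoelder's inequality eliminates r, and a tangent line to
X |-> X^d turns the remaining inequality in c into a sum over the sites of
  H(x) = d x^(d+1) - (d+1) x^d - f(x)^(d+1),   f(x) = 1 - k x^d,
subject to a linear constraint on the x_i^d.  The critical points of H are the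
fixed points of f o f: above the threshold H has a unique minimizer (a fixed
point of f), below it k can be chosen so that the two points of a two-cycle of f
are the minimizers and are used equally often.

For the Hessian, Psi_1 is near the phase an explicit function minus Delta times
the Legendre transform of a sum of exponentials, so its gradient is an inverse gradient map,
which is Lipschitz and differentiable at the phase.  Negative definiteness
amounts to a contraction by a factor less than 1/d of the linearized tree
recursion on centered vectors; it follows from (d k)^2 (p r)^(d-1) < 1 at the
two-cycle (p, r), which is the AM-GM inequality. *)

(** * The single-site function *)

(** [Psi_1] adds a convex vertex term to a concave edge term, so criticality says little about
    maximality. Hence a chain of global inequalities, each kept together with its equality cases,
    which in the end identify all maximizers. The chain ends in single sites because of homogeneity:
    the scale of c is free and is fixed by [sum_i k x_i^d = 1 - B], under which the Potts matrix
    sends the vector [x_i^d] to [((1 - B) / k) f(x_i)]. On this constraint the term [- (d+1) x^d] of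
    H sums to a constant; its coefficient is chosen so that H' is a positive multiple of
    [x - f(f(x))]. With [s = (1 - B) / q] the symmetric fixed point is [1 - s], and the threshold
    [Delta s <= 1] says that the slope of f there is at most 1 in modulus. For the Hessian the
    obstacle is that Psi_1 is only a supremum: the weights realizing given marginals are implicit.
    They are found by minimizing a strongly convex function. An envelope argument differentiates the
    value on a whole ball, so the inverse gradient map has to be differentiable at the phase
    only. *)

(** Multiplying the inequality for one exponent by [y] gives the next one with the surplus
    [(n+2) x^(n+1) (y-x)^2], the source of strictness; it vanishes at [x = 0], treated apart. The
    inequality serves below as Young's inequality, as AM-GM and as the tangent to a power. *)
Lemma pow_tangent_lt (R : realDomainType) (n : nat) (x y : R) :
  0 <= x -> 0 <= y -> y != x ->
  x ^+ n.+2 + n.+2%:R * x ^+ n.+1 * (y - x) < y ^+ n.+2.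
Proof.
move=> x0 y0 yx; elim: n => [|n IH].
  have : 0 < (y - x) ^+ 2 by rewrite exprn_even_gt0//= subr_eq0.
  rewrite expr1; lra.
have := ler_wpM2l y0 (ltW IH); rewrite -exprS.
have x1 : 0 <= x ^+ n.+1 by rewrite exprn_ge0.
have [x_0|xn0] := eqVneq x 0.
  move: yx; rewrite x_0 => yx.
  rewrite !expr0n/= !mulr0 mul0r addr0 => _.
  by rewrite exprn_gt0// lt_neqAle y0 andbT eq_sym.
have xp : 0 < x ^+ n.+1 by rewrite exprn_gt0// lt_neqAle x0 eq_sym xn0.
apply: lt_le_trans.
have -> : x ^+ n.+3 + n.+3%:R * x ^+ n.+2 * (y - x) =
  y * (x ^+ n.+2 + n.+2%:R * x ^+ n.+1 * (y - x)) - n.+2%:R * x ^+ n.+1 * (y - x) ^+ 2.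
  by rewrite -!natr1 (exprS x n.+2) (exprS x n.+1); ring.
rewrite ltrBlDr ltrDl; apply: mulr_gt0; first by rewrite mulr_gt0// ltr0n.
by rewrite exprn_even_gt0//= subr_eq0.
Qed.

Lemma pow_tangent_le (R : realDomainType) (n : nat) (x y : R) :
  0 <= x -> 0 <= y -> x ^+ n.+1 + n.+1%:R * x ^+ n * (y - x) <= y ^+ n.+1.
Proof.
move=> x0 y0; have [->|yx] := eqVneq y x; first by rewrite subrr mulr0 addr0.
case: n => [|n]; last exact/ltW/pow_tangent_lt.
by rewrite !expr1 expr0 mulr1 mul1r addrC subrK.
Qed.

Lemma poly_mvt_lt (R : realType) (p : {poly R}) (a b : R) : a < b ->
  exists2 c, a < c < b & p.[b] - p.[a] = p^`().[c] * (b - a).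
Proof.
move=> ab.
have dp x : x \in `]a, b[ -> is_derive x 1 (horner p) (p^`().[x]).
  by move=> _; exact: is_derive_poly.
have cp : {within `[a, b], continuous (horner p)}%classic.
  by apply: continuous_subspaceT; exact: continuous_horner.
by have [c cab ->] := MVT ab dp cp; exists c => //; move: cab; rewrite in_itv.
Qed.

Section Site.
Variables (R : realType) (n : nat) (k : R).
Hypothesis k0 : 0 < k.
Local Notation d := n.+1.

(** The tree recursion decoupled over the spins: if [sum_j k x_j^d = 1 - B], the Potts matrix
    applied to the vector of [x_j^d] has entries [((1 - B) / k) * site (x_i)]. *)
Definition site (x : R) : R := 1 - k * x ^+ d.
Definition siteH (x : R) : R := d%:R * x ^+ d.+1 - d.+1%:R * x ^+ d - site x ^+ d.+1.
Definition siteG (x : R) : R := x - site (site x).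

Let fp : {poly R} := 1 - k *: 'X^d.

Let hE := (hornerD, hornerN, hornerZ, hornerM, hornerX, hornerXn, hornerC, horner_exp, hornerMn).

(** The coefficient [d+1] in [siteH] makes its derivative factor as
    [d (d+1) x^n (x - site (site x))]. *)
Lemma siteH_mvt a b : a < b ->
  exists2 c, a < c < b &
    siteH b - siteH a = d%:R * d.+1%:R * c ^+ n * siteG c * (b - a).
Proof.
move=> ab.
pose p : {poly R} := d%:R *: ('X^d * 'X) - d.+1%:R *: 'X^d - fp ^+ d * fp.
have pE x : p.[x] = siteH x.
  by rewrite /p /fp /siteH /siteG /site !hE ?(exprSr _ d) ?mulrA.
have [c cab e] := poly_mvt_lt p ab; exists c => //.
rewrite -!pE e; congr (_ * _); rewrite /p !(poly.derivE, deriv_exp).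
rewrite !hE /= /siteG /site.
rewrite -(mulr_natr (c ^+ n)) -(mulr_natr (_ * _ ^+ n)).
move: (1 - k * c ^+ d : R) => u; rewrite (exprS u n) (exprS c n) -(natr1 d); ring.
Qed.

(** By the chain rule [site (site c)] has derivative [(d k)^2 (c site c)^n], so stability is a
    condition on the product [c * site c] alone. *)
Lemma siteG_mvt a b : a < b ->
  exists2 c, a < c < b &
    siteG b - siteG a = (1 - (d%:R * k) ^+ 2 * (c * site c) ^+ n) * (b - a).
Proof.
move=> ab.
pose p : {poly R} := 'X - (1 - k *: fp ^+ d).
have pE x : p.[x] = siteG x.
  by rewrite /p /fp /siteH /siteG /site !hE ?(exprSr _ d) ?mulrA.
have [c cab e] := poly_mvt_lt p ab; exists c => //.
rewrite -!pE e; congr (_ * _); rewrite /p !(poly.derivE, deriv_exp).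
rewrite !hE /= /site exprMn -(mulr_natr (c ^+ n)) -(mulr_natr (_ * _ ^+ n)).
move: (1 - k * c ^+ d : R) => u; rewrite ?exprMn; ring.
Qed.


Lemma site_le x y : 0 <= x -> x <= y -> site y <= site x.
Proof.
move=> x0 xy; rewrite lerB// ler_pM2l//.
by rewrite lerXn2r// ?nnegrE// (le_trans x0).
Qed.

(** This lemma and the next three turn an unwanted comparison of values into a point where the
    derivative has the wrong sign. The minimality proofs chain them from [siteH] to [siteG], and
    from there to the stability product. *)
Lemma siteH_le_mvt a b : 0 <= a -> a < b -> siteH b <= siteH a ->
  exists2 c, a < c < b & siteG c <= 0.
Proof.
move=> a0 ab hle; have [c /andP[ac cb] e] := siteH_mvt ab.
exists c; first by rewrite ac.
rewrite leNgt; apply/negP => Gc.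
have : 0 < siteH b - siteH a.
  by rewrite e !mulr_gt0// ?ltr0n ?exprn_gt0 ?subr_gt0// (le_lt_trans a0).
by rewrite subr_gt0 ltNge hle.
Qed.

Lemma siteH_ge_mvt a b : 0 <= a -> a < b -> siteH a <= siteH b ->
  exists2 c, a < c < b & 0 <= siteG c.
Proof.
move=> a0 ab hle; have [c /andP[ac cb] e] := siteH_mvt ab.
exists c; first by rewrite ac.
rewrite leNgt; apply/negP => Gc.
have : siteH b - siteH a < 0.
  rewrite e pmulr_llt0 ?subr_gt0// pmulr_rlt0//.
  by rewrite !mulr_gt0// ?ltr0n ?exprn_gt0 ?subr_gt0// (le_lt_trans a0).
by rewrite subr_lt0 ltNge hle.
Qed.

Lemma siteG_le_mvt a b : a < b -> siteG b <= siteG a ->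
  exists2 c, a < c < b & 1 <= (d%:R * k) ^+ 2 * (c * site c) ^+ n.
Proof.
move=> ab hle; have [c cab e] := siteG_mvt ab.
exists c => //; rewrite leNgt; apply/negP => Gc.
have : 0 < siteG b - siteG a by rewrite e mulr_gt0// subr_gt0.
by rewrite subr_gt0 ltNge hle.
Qed.

Lemma siteG_ge_mvt a b : a < b -> siteG a <= siteG b ->
  exists2 c, a < c < b & (d%:R * k) ^+ 2 * (c * site c) ^+ n <= 1.
Proof.
move=> ab hle; have [c cab e] := siteG_mvt ab.
exists c => //; rewrite leNgt; apply/negP => Gc.
have : siteG b - siteG a < 0 by rewrite e pmulr_llt0 ?subr_gt0// subr_lt0.
by rewrite subr_lt0 ltNge hle.
Qed.

(** [x * site x = x - k x^(d+1)] is strictly concave, so away from [b] it lies strictly below its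
    tangent at [b]; the sign of the slope selects the side. *)
Lemma mul_site_quasiconcave a b c : 0 <= a -> a < b -> b < c ->
  a * site a < b * site b \/ c * site c < b * site b.
Proof.
move=> a0 ab bc.
have b0 : 0 <= b by rewrite (le_trans a0)// ltW.
have c0 : 0 <= c by rewrite (le_trans b0)// ltW.
have tangent x : 0 <= x -> x != b ->
    x * site x < b * site b + (1 - d.+1%:R * k * b ^+ d) * (x - b).
  move=> x0 xb; have h := pow_tangent_lt n b0 x0 xb.
  rewrite -(ltr_pM2l k0) !(exprS _ d) in h; rewrite /site.
  rewrite -subr_gt0; rewrite -subr_gt0 in h.
  by congr (0 < _): h; ring.
have [s0|s0] := leP 0 (1 - d.+1%:R * k * b ^+ d).
- left; apply: lt_le_trans (tangent a a0 _) _; first by rewrite lt_eqF.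
  by rewrite gerDl mulr_ge0_le0// subr_le0 ltW.
- right; apply: lt_le_trans (tangent c c0 _) _; first by rewrite gt_eqF.
  by rewrite gerDl nmulr_rle0// subr_ge0 ltW.
Qed.

Section TwoCycle.
Variables (p r : R).
Hypotheses (n0 : (0 < n)%N) (p0 : 0 <= p) (pr : p < r).
Hypotheses (fp_ : site p = r) (fr_ : site r = p).
Hypothesis stable : (d%:R * k) ^+ 2 * (p * r) ^+ n < 1.

Let r0 : 0 < r. Proof. exact: le_lt_trans pr. Qed.
Let Gp : siteG p = 0. Proof. by rewrite /siteG fp_ fr_ subrr. Qed.
Let Gr : siteG r = 0. Proof. by rewrite /siteG fr_ fp_ subrr. Qed.

(** Writing one factor [p] of [p^(d+1)] as [1 - k r^d], and likewise for [r], brings both values to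
    the symmetric form [- p^d - r^d - n k p^d r^d]. *)
Lemma siteH_cycle : siteH p = siteH r.
Proof.
have ep : p ^+ d.+1 = p ^+ d - k * p ^+ d * r ^+ d.
  by rewrite (exprS _ d) -{1}fr_ /site; ring.
have er : r ^+ d.+1 = r ^+ d - k * p ^+ d * r ^+ d.
  by rewrite (exprS _ d) -{1}fp_ /site; ring.
by rewrite /siteH fp_ fr_ ep er -natr1; ring.
Qed.

Let unstable c : 0 <= c -> 0 <= site c ->
  1 <= (d%:R * k) ^+ 2 * (c * site c) ^+ n -> p * r < c * site c.
Proof.
move=> c0 fc0 h; rewrite ltNge; apply/negP => cle.
have := lt_le_trans stable h; rewrite ltr_pM2l; last first.
  by rewrite exprn_gt0// mulr_gt0// ltr0n.
by rewrite ltNge lerXn2r// nnegrE mulr_ge0// ltW.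
Qed.

(* On ]p, r[ a value [siteH x <= siteH p] would make [1 - (d k)^2 (c site c)^n],
   the derivative of [siteG], change sign as -, +, - along some c1 < c2 < c3,
   against the strict concavity of [c site c]. *)
Lemma siteH_cycle_lt x : 0 <= x -> 0 <= site x -> x != p -> x != r ->
  siteH p < siteH x.
Proof.
move=> x0 fx0 xp xr; rewrite ltNge; apply/negP => Hx.
have [{xp}xp|{xp}px|e] := ltgtP x p; last by rewrite e eqxx in xp.
(* Outside [[p, r]] the assumption yields an unstable [e] whose product exceeds [p * r]. This is the
   common value of the product at [p] and at [r], so concavity forbids it there. *)
- have [c /andP[xc cp] Gc] := siteH_ge_mvt x0 xp Hx.
  have [|e /andP[ce ep] hu] := siteG_le_mvt cp; first by rewrite Gp.
  have e0 : 0 <= e by rewrite (le_trans x0)// ltW// (lt_trans xc).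
  have he : p * r < e * site e.
    apply: unstable => //.
    by rewrite (le_trans (ltW r0))// -fp_ site_le// ltW.
  have [] := mul_site_quasiconcave e0 ep pr; rewrite fp_ ?fr_.
    by rewrite ltNge ltW.
  by rewrite mulrC ltxx.
- have [{xr}xr|{xr}rx|e] := ltgtP x r; last by rewrite e eqxx in xr.
  + have [c1 /andP[pc1 c1x] Gc1] := siteH_le_mvt p0 px Hx.
    have [|c2 /andP[xc2 c2r] Gc2] := siteH_ge_mvt x0 xr.
      by rewrite -siteH_cycle.
    have c12 : c1 < c2 by exact: lt_trans xc2.
    have [|e1 /andP[pe1 e1c1] h1] := siteG_le_mvt pc1; first by rewrite Gp.
    have [|e2 /andP[c1e2 e2c2] h2] := siteG_ge_mvt c12; first exact: le_trans Gc2.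
    have [|e3 /andP[c2e3 e3r] h3] := siteG_le_mvt c2r; first by rewrite Gr.
    have e10 : 0 <= e1 by rewrite (le_trans p0)// ltW.
    have small (e : R) : 1 <= (d%:R * k) ^+ 2 * (e * site e) ^+ n ->
        p <= e -> e <= r -> e * site e < e2 * site e2 -> False.
      move=> he pe er elt; have := le_trans h2 he.
      rewrite leNgt ltr_pM2l ?exprn_gt0 ?mulr_gt0 ?ltr0n//.
      have e0 := le_trans p0 pe.
      have fe0 : 0 <= site e by apply: le_trans p0 _; rewrite -{1}fr_ site_le.
      have efe0 : 0 <= e * site e by rewrite mulr_ge0.
      by rewrite ltrXn2r// -lt0n n0.
    have [] := mul_site_quasiconcave e10 (lt_trans e1c1 c1e2) (lt_trans e2c2 c2e3).
      apply: small h1 (ltW pe1) _; rewrite ltW// (lt_trans e1c1)//.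
      by rewrite (lt_trans c1x).
    apply: small h3 _ (ltW e3r); rewrite ltW// (lt_trans _ c2e3)//.
    by rewrite (lt_trans px).
  + rewrite siteH_cycle in Hx.
    have [c /andP[rc cx] Gc] := siteH_le_mvt (ltW r0) rx Hx.
    have [|e /andP[re ec] hu] := siteG_le_mvt rc; first by rewrite Gr.
    have e0 : 0 <= e by rewrite ltW// (lt_trans r0).
    have he : p * r < e * site e.
      apply: unstable => //.
      by rewrite (le_trans fx0)// site_le// ltW// (lt_trans ec).
    have [] := mul_site_quasiconcave p0 pr re; rewrite ?fp_ fr_.
      by rewrite mulrC ltxx.
    by rewrite ltNge mulrC ltW.
Qed.
End TwoCycle.

Section FixedPoint.
Variables (w : R).
Hypotheses (n0 : (0 < n)%N) (w0 : 0 < w) (fw : site w = w).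
Hypothesis kw : d.+1%:R * k * w ^+ d <= 1.

(** Raised to the power [d], the left side is [(d k)^(d+1) (a site(c)^d)^n] with [a = d k c^d],
    which AM-GM bounds by [(d k t^n)^(d+1)] for [t = d / (d+1)]. The threshold [kw] gives [t <= w]
    and [d k w^n <= 1]. Equality throughout would force [c = w]. *)
Lemma fixed_point_stable (c : R) : 0 <= c -> 0 <= site c -> c != w ->
  (d%:R * k) ^+ 2 * (c * site c) ^+ n < 1.
Proof.
move=> c0 fc0 cw; rewrite ltNge; apply/negP => h.
set t : R := d%:R / d.+1%:R.
have t0 : 0 < t by rewrite divr_gt0 ?ltr0n.
have kc0 : 0 <= k * c ^+ d by rewrite mulr_ge0 ?exprn_ge0// ltW.
have tE : d.+1%:R * t = d%:R by rewrite mulrC divfK// pnatr_eq0.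
have tw : t <= w.
  rewrite -(ler_pM2l (ltr0Sn _ d)) tE -fw /site mulrBr mulr1 mulrA.
  move: kw; rewrite -[in X in _ -> X](natr1 d); lra.
(* AM-GM of [d k c^d] and [d] copies of [site c], whose sum is [d] *)
set a := d%:R * (k * c ^+ d).
have afE : d.+1%:R * (t - site c) = a - site c.
  by rewrite mulrBr tE /a /site; ring.
have amgm_le : a * site c ^+ d <= t ^+ d.+1.
  have := pow_tangent_le d fc0 (ltW t0).
  rewrite (mulrAC d.+1%:R) afE [site c ^+ d.+1]exprSr.
  by congr (_ <= _); ring.
have amgm_lt : a != site c -> a * site c ^+ d < t ^+ d.+1.
  move=> af; have tf : t != site c.
    apply: contra_neq af => tf; apply/eqP; rewrite -subr_eq0 -afE tf.
    by rewrite subrr mulr0.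
  have := pow_tangent_lt n fc0 (ltW t0) tf.
  rewrite (mulrAC d.+1%:R) afE [site c ^+ d.+1]exprSr.
  by congr (_ < _); ring.
(* [d k w^n] is the modulus of the slope of [site] at [w]. The equality case is recorded because
   strictness may have to come from here. *)
have dkw : d%:R * k * w ^+ n <= 1 ?= iff (d.+1%:R * k * w ^+ d == 1).
  have e : (d%:R * k * w ^+ n - 1) * w = d.+1%:R * k * w ^+ d - 1.
    by rewrite mulrBl mul1r -(mulrA _ (w ^+ n)) -exprSr; move: fw; rewrite /site; lra.
  split; last first.
    apply/eqP/eqP => [dk1|dk1].
      by move: e; rewrite dk1 subrr mul0r => /eqP; rewrite eq_sym subr_eq0 => /eqP.
    by move: e; rewrite dk1 subrr => /eqP; rewrite mulf_eq0 subr_eq0 (gt_eqF w0) orbF => /eqP.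
  by rewrite -subr_le0 -(pmulr_lle0 _ w0) e subr_le0.
have dkt0 : 0 <= d%:R * k * t ^+ n by rewrite !mulr_ge0 ?exprn_ge0 ?ler0n// ltW.
have dktw : d%:R * k * t ^+ n <= d%:R * k * w ^+ n.
  by rewrite ler_pM2l ?mulr_gt0 ?ltr0n// lerXn2r// nnegrE ltW.
have dktE : (d%:R * k * t ^+ n) ^+ d.+1 = (d%:R * k) ^+ d.+1 * (t ^+ d.+1) ^+ n.
  by rewrite [LHS]exprMn -!exprM (mulnC n).
have hd : 1 <= (d%:R * k) ^+ d.+1 * (a * site c ^+ d) ^+ n.
  have -> : a * site c ^+ d = d%:R * k * (c * site c) ^+ d.
    by rewrite /a exprMn !mulrA.
  have := exprn_ege1 d h; move: (d%:R * k) (c * site c) => D z.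
  congr (_ <= _); rewrite !exprMn -!exprM (mulnC n d) mulrA.
  rewrite -[in RHS]exprD; congr (_ * _).
  by rewrite -exprD addnS.
(* Equality in AM-GM pins [c^d] to [1 / ((d+1) k)]. Then either [kw] is an equality too, and
   [c = w], or the slope at [w] is strictly below 1. *)
have [af|af] := eqVneq a (site c).
  have kc1 : d.+1%:R * k * c ^+ d = 1 by move: af; rewrite /a /site -natr1; lra.
  have [kw1|kw1] := eqVneq (d.+1%:R * k * w ^+ d) 1.
    have : c ^+ d = w ^+ d.
      by apply: (mulfI (x := d.+1%:R * k)); rewrite ?kc1// gt_eqF ?mulr_gt0 ?ltr0n.
    by move/(pexpIrn _); rewrite ?nnegrE; move=> /(_ isT c0 (ltW w0)) e; rewrite e eqxx in cw.
  have : (d%:R * k * t ^+ n) ^+ d.+1 < 1.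
    rewrite exprn_ilt1//; apply: le_lt_trans dktw _.
    by rewrite (lt_leif dkw).
  rewrite ltNge => /negP; apply; rewrite (le_trans hd)// dktE.
  rewrite ler_pM2l ?exprn_gt0 ?mulr_gt0 ?ltr0n// lerXn2r// nnegrE ?exprn_ge0 ?(ltW t0)//.
  by rewrite mulr_ge0 ?exprn_ge0// /a mulr_ge0.
have : (d%:R * k * t ^+ n) ^+ d.+1 <= 1.
  by rewrite exprn_ile1// (le_trans dktw)// dkw.
rewrite leNgt => /negP; apply; rewrite (le_lt_trans hd)// dktE.
rewrite ltr_pM2l ?exprn_gt0 ?mulr_gt0 ?ltr0n// ltrXn2r ?amgm_lt// -?lt0n//.
by rewrite mulr_ge0 ?exprn_ge0// /a mulr_ge0.
Qed.

Lemma siteH_fixed_lt x : 0 <= x -> 0 <= site x -> x != w -> siteH w < siteH x.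
Proof.
move=> x0 fx0 xw; rewrite ltNge; apply/negP => Hx.
have Gw : siteG w = 0 by rewrite /siteG fw fw subrr.
have unst e : 0 <= e -> 0 <= site e -> e != w ->
    1 <= (d%:R * k) ^+ 2 * (e * site e) ^+ n -> False.
  by move=> e0 fe0 ew; rewrite leNgt fixed_point_stable.
have [{xw}xw|{xw}wx|e] := ltgtP x w; last by rewrite e eqxx in xw.
- have [c /andP[xc cw] Gc] := siteH_ge_mvt x0 xw Hx.
  have [|e /andP[ce ew]] := siteG_le_mvt cw; first by rewrite Gw.
  have e0 : 0 <= e by rewrite (le_trans x0)// ltW// (lt_trans xc).
  apply: unst => //; last by rewrite lt_eqF.
  by rewrite (le_trans (ltW w0))// -{1}fw site_le// ltW.
- have [c /andP[wc cx] Gc] := siteH_le_mvt (ltW w0) wx Hx.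
  have [|e /andP[we ec]] := siteG_le_mvt wc; first by rewrite Gw.
  have e0 : 0 <= e by rewrite ltW// (lt_trans w0).
  apply: unst => //; last by rewrite gt_eqF.
  by rewrite (le_trans fx0)// site_le// ltW// (lt_trans ec).
Qed.
End FixedPoint.
End Site.

(** * Existence of the two-cycle *)

(* AM-GM, pairing the term of index i with that of index n - i. *)
Lemma sum_geom_gt (R : rcfType) (n : nat) (p r : R) : (0 < n)%N -> 0 < p -> p < r ->
  n.+1%:R ^+ 2 * (p * r) ^+ n < (\sum_(i < n.+1) r ^+ (n - i) * p ^+ i) ^+ 2.
Proof.
move=> n0 p0 pr; have r0 := lt_trans p0 pr.
set S := \sum_(i < _) _.
pose a := Num.sqrt p; pose b := Num.sqrt r.
have aE : p = a ^+ 2 by rewrite sqr_sqrtr// ltW.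
have bE : r = b ^+ 2 by rewrite sqr_sqrtr// ltW.
have a0 : 0 < a by rewrite sqrtr_gt0.
have b0 : 0 < b by rewrite sqrtr_gt0.
have ab : a < b by rewrite ltr_sqrt.
have S2 : S + S = \sum_(i < n.+1) (r ^+ (n - i) * p ^+ i + r ^+ i * p ^+ (n - i)).
  rewrite big_split/=; congr (_ + _); rewrite /S [LHS](reindex_inj rev_ord_inj)/=.
  apply: eq_bigr => i _; rewrite subSS subKn// -ltnS; exact: ltn_ord.
have term (i : 'I_n.+1) : r ^+ (n - i) * p ^+ i + r ^+ i * p ^+ (n - i) =
    2 * (a * b) ^+ n + (b ^+ (n - i) * a ^+ i - b ^+ i * a ^+ (n - i)) ^+ 2.
  have ni : (i <= n)%N by rewrite -ltnS ltn_ord.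
  rewrite aE bE -!exprM !(mulnC 2) !exprM sqrrB -!exprMn.
  have -> : (a * b) ^+ n = (b ^+ (n - i) * a ^+ i) * (b ^+ i * a ^+ (n - i)).
    by rewrite -{1}(subnK ni) exprD !exprMn; ring.
  by ring.
have Sgt : n.+1%:R * (a * b) ^+ n < S.
  suff : 2 * (n.+1%:R * (a * b) ^+ n) < S + S by lra.
  rewrite S2.
  rewrite (eq_bigr _ (fun i _ => term i)) big_split/= sumr_const card_ord.
  have -> : 2 * (n.+1%:R * (a * b) ^+ n) = (2 * (a * b) ^+ n) *+ n.+1.
    by rewrite -mulr_natr; ring.
  (* Strictness comes from the index 0, whose square [(b^n - a^n)^2] is positive since [n > 0]. *)
  rewrite ltrDl big_ord_recl/= ltr_wpDr//.
    by apply: sumr_ge0 => i _; exact: sqr_ge0.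
  rewrite exprn_even_gt0//= subn0 !expr0 mulr1 mul1r subr_eq0 gt_eqF//.
  by rewrite ltrXn2r -?lt0n// ltW.
have -> : n.+1%:R ^+ 2 * (p * r) ^+ n = (n.+1%:R * (a * b) ^+ n) ^+ 2.
  have -> : p * r = (a * b) ^+ 2 by rewrite exprMn -aE -bE.
  by rewrite [RHS]exprMn -!exprM (mulnC n).
by rewrite ltrXn2r// mulr_ge0// exprn_ge0// mulr_ge0 ?ltW.
Qed.

Section CycleExists.
Variables (R : realType) (n : nat) (s : R).
Local Notation d := n.+1.
Hypotheses (n0 : (0 < n)%N) (sd : 1 < d.+1%:R * s) (s2 : s < 1 / 2).

(* A two-cycle p < r with [k (p^d + r^d) = 2 s] has [p + r = 2 (1 - s)]; writing
   p, r = 1 - s -+ x and eliminating k leaves one equation in x. *)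
Lemma half_gap_exists : exists2 x : R, 0 < x < 1 - s &
  x * ((1 - s + x) ^+ d + (1 - s - x) ^+ d)
    = s * ((1 - s + x) ^+ d - (1 - s - x) ^+ d).
Proof.
set m := 1 - s.
have s0 : 0 < s by rewrite -(pmulr_rgt0 _ (ltr0Sn R n.+1)) (lt_trans _ sd).
have m0 : 0 < m by rewrite /m; move: s2; lra.
pose u : {poly R} := m%:P + 'X; pose v : {poly R} := m%:P - 'X.
pose D : {poly R} := 'X * (u ^+ d + v ^+ d) - s *: (u ^+ d - v ^+ d).
have DE x : D.[x] = x * ((m + x) ^+ d + (m - x) ^+ d)
    - s * ((m + x) ^+ d - (m - x) ^+ d).
  by rewrite /D /u /v !(hornerD, hornerN, hornerZ, hornerM, hornerX, horner_exp, hornerC).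
(* The root 0 belongs to the fixed point [1 - s] and is divided out. The quotient changes sign: at 0
   it is [D'(0) = 2 m^n (1 - (d+1) s)], negative below the threshold, and at [m] it has the sign of
   [1 - 2 s]. *)
have /factor_theorem[E DXE] : root D 0.
  by rewrite /root DE mul0r addr0 subr0 subrr mulr0 subr0.
have E0 : E.[0] < 0.
  have -> : E.[0] = D^`().[0].
    by rewrite DXE !poly.derivE !(hornerD, hornerN, hornerZ, hornerM, hornerX, hornerC) subrr; ring.
  rewrite /D /u /v !(poly.derivE, deriv_exp).
  rewrite !(hornerD, hornerN, hornerZ, hornerM, hornerX, horner_exp, hornerC, hornerMn) /=.
  rewrite -!(mulr_natr (_ * _ ^+ n)) addr0 subr0.
  rewrite [ltLHS](_ : _ = 2 * m ^+ n * (1 - d.+1%:R * s)).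
    by rewrite pmulr_rlt0 ?subr_lt0// mulr_gt0// exprn_gt0.
  have sE : s = 1 - m by rewrite /m; ring.
  by rewrite sE exprS; ring.
have Em : 0 < E.[m].
  have : D.[m] = E.[m] * m.
    by rewrite DXE !(hornerM, hornerD, hornerN, hornerX, hornerC) subr0.
  rewrite DE subrr expr0n/= addr0 subr0 -mulrBl => e.
  rewrite -(pmulr_lgt0 _ m0) -e; apply: mulr_gt0; last by rewrite exprn_gt0// addr_gt0.
  by rewrite /m; move: s2; lra.
have E0m : E.[0] <= 0 <= E.[m] by rewrite !ltW.
have [x] := @poly_ivt _ E 0 m (ltW m0) E0m.
move=> /andP[x0 xm] /eqP Ex.
exists x.
  rewrite !lt_neqAle x0 xm !andbT; apply/andP; split; apply/eqP => xe.
    by move: E0; rewrite [X in E.[X]]xe Ex ltxx.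
  by move: Em; rewrite -xe Ex ltxx.
by apply/eqP; rewrite -subr_eq0 -DE DXE hornerM Ex mul0r.
Qed.

(** Subtracting the two cycle equations forces [k = (r - p) / (r^d - p^d)], that is [k S = 1] for
    the geometric sum [S]. The bound [d^2 (p r)^n < S^2] of [sum_geom_gt] is then the stability
    condition. *)
Lemma two_cycle_exists : exists p r k : R,
  [/\ [/\ 0 < p, p < r & 0 < k], site n k p = r, site n k r = p,
      k * (p ^+ d + r ^+ d) = 2 * s & (d%:R * k) ^+ 2 * (p * r) ^+ n < 1].
Proof.
have [x /andP[x0 xm] xE] := half_gap_exists.
set p := 1 - s - x in xE; set r := 1 - s + x in xE.
have p0 : 0 < p by rewrite subr_gt0.
have pr : p < r by rewrite /p /r; lra.
have r0 := lt_trans p0 pr.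
have rpd : 0 < r ^+ d - p ^+ d by rewrite subr_gt0 ltrXn2r// ltW.
pose k := (r - p) / (r ^+ d - p ^+ d).
have k0 : 0 < k by rewrite divr_gt0// subr_gt0.
have kE : k * (r ^+ d - p ^+ d) = r - p by rewrite divfK// gt_eqF.
have ksum : k * (p ^+ d + r ^+ d) = 2 * s.
  apply: (mulIf (x := x)); first by rewrite gt_eqF.
  have : k * (x * (r ^+ d + p ^+ d)) = k * (s * (r ^+ d - p ^+ d)) by rewrite xE.
  rewrite [RHS]mulrCA kE => h.
  rewrite [LHS](_ : _ = k * (x * (r ^+ d + p ^+ d))); last by ring.
  by rewrite h /r /p; ring.
exists p, r, k; split => //.
- by move: kE ksum; rewrite /site /p /r; lra.
- by move: kE ksum; rewrite /site /p /r; lra.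
- have := sum_geom_gt n0 p0 pr; set S := \sum_(i < _) _ => h.
  have kS : k * S = 1.
    apply: (mulfI (x := r - p)); first by rewrite gt_eqF// subr_gt0.
    by rewrite mulr1 -[RHS]kE subrXX /S /=; ring.
  move: h; rewrite -(ltr_pM2l (exprn_gt0 2 k0)) -[ltRHS]exprMn kS expr1n.
  by rewrite mulrA -exprMn (mulrC k).
Qed.
End CycleExists.

(** * Entropy duality *)

Section Gibbs.
Variables (R : realType) (q Delta : nat) (B : R).
Hypothesis B0 : 0 <= B.
Local Notation Bm := (potts_mx q B).

Lemma potts_ge0 i j : 0 <= Bm i j.
Proof. by rewrite mxE; case: ifP. Qed.

(** One entry of Gibbs' inequality: [ln z <= z - 1] at [z = b rho gam / x]. The weights must be
    positive only where [x > 0], so that phases with zero coordinates are covered; the logarithm of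
    a vanishing weight is multiplied by 0. *)
Lemma edge_term_le (x b rho gam : R) : 0 <= x -> 0 <= b -> 0 <= rho -> 0 <= gam ->
  (0 < x -> 0 < rho /\ 0 < gam) ->
  (edge_term x b <= (b * rho * gam - x - x * ln rho - x * ln gam)%:E)%E.
Proof.
move=> x0 b0 r0 g0 xrg; rewrite /edge_term; case: eqVneq => [->|xn].
  by rewrite !mul0r !subr0 lee_fin !mulr_ge0.
have {}x0 : 0 < x by rewrite lt_neqAle eq_sym xn.
have [{}r0 {}g0] := xrg x0.
case: eqVneq => [_|bn]; first exact: leNye.
have {}b0 : 0 < b by rewrite lt_neqAle eq_sym bn.
rewrite lee_fin; set y := b * rho * gam.
have y0 : 0 < y by rewrite !mulr_gt0.
have lny : ln y = ln b + ln rho + ln gam by rewrite !lnM ?posrE ?mulr_gt0.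
have : x * ln (y / x) <= x * (y / x - 1).
  rewrite ler_pM2l//; have := @le_ln1Dx R (y / x - 1).
  by rewrite addrCA subrr addr0; apply; rewrite ltrBrDr addNr divr_gt0.
have yx : x * (y / x) = y by rewrite mulrCA divff// mulr1.
by rewrite ln_div ?posrE// lny (mulrBr x (y / x)) yx; lra.
Qed.

Lemma edge_term_eq (b rho gam : R) : 0 <= b -> 0 < rho -> 0 < gam ->
  edge_term (b * rho * gam) b =
  (- (b * rho * gam * ln rho) - b * rho * gam * ln gam)%:E.
Proof.
move=> b0 r0 g0; rewrite /edge_term; have [->|bn] := eqVneq b 0.
  by rewrite !mul0r eqxx oppr0 addr0.
rewrite !mulf_eq0 (negbTE bn) !gt_eqF//=.
have {}b0 : 0 < b by rewrite lt_neqAle eq_sym bn.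
by congr EFin; rewrite !lnM ?posrE ?mulr_gt0//; ring.
Qed.

(** The Lagrangian dual of the maximization over [x]: up to sign, [ln rho] and [ln gam] are
    multipliers of the row and column constraints. *)
Definition dual_value (alpha beta : 'rV[R]_q) (rho gam : 'I_q -> R) : R :=
  (Delta%:R - 1) * (\sum_i xlnx (alpha ord0 i) + \sum_j xlnx (beta ord0 j))
  + Delta%:R * (\sum_i \sum_j Bm i j * rho i * gam j - \sum_i alpha ord0 i
     - \sum_i alpha ord0 i * ln (rho i) - \sum_j beta ord0 j * ln (gam j)).

Lemma feasible_weighted_sums (alpha beta : 'rV[R]_q) x (f g : 'I_q -> R) :
  feasible alpha beta x ->
  (\sum_i \sum_j x i j * f i = \sum_i alpha ord0 i * f i) *
  (\sum_i \sum_j x i j * g j = \sum_j beta ord0 j * g j).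
Proof.
move=> [_ xa xb]; split.
  by apply: eq_bigr => i _; rewrite -mulr_suml xa.
by rewrite exchange_big; apply: eq_bigr => j _; rewrite -mulr_suml xb.
Qed.

Lemma Psi1_le_dual (alpha beta : 'rV[R]_q) (rho gam : 'I_q -> R) :
  (forall i, 0 <= rho i) -> (forall i, 0 <= gam i) ->
  (forall i, 0 < alpha ord0 i -> 0 < rho i) ->
  (forall i, 0 < beta ord0 i -> 0 < gam i) ->
  (Psi1 q Delta B alpha beta <= (dual_value alpha beta rho gam)%:E)%E.
Proof.
move=> rho0 gam0 ar bg; apply: ge_ereal_sup => _ [x xf <-].
have [x0 xa xb] := xf.
rewrite /psi_obj /dual_value EFinD leeD2l// EFinM lee_wpmul2l ?lee_fin//.
apply: (@le_trans _ _ (\sum_i \sum_j (Bm i j * rho i * gam j - x i j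
          - x i j * ln (rho i) - x i j * ln (gam j))%:E)%E).
  apply: lee_sum => i _; apply: lee_sum => j _.
  apply: edge_term_le => //; first exact: potts_ge0.
  move=> xij; split; [apply: ar|apply: bg].
    by rewrite -xa (bigD1 j)//= ltr_pwDl// sumr_ge0.
  by rewrite -xb (bigD1 i)//= ltr_pwDl// sumr_ge0.
under eq_bigr do rewrite sumEFin; rewrite sumEFin lee_fin.
have /= [e1 e2] := feasible_weighted_sums (fun i => ln (rho i)) (fun j => ln (gam j)) xf.
rewrite -e1 -e2 -(eq_bigr _ (fun i _ => xa i)).
rewrite -!sumrB; apply: ler_sum => i _.
by rewrite -!sumrB.
Qed.

(** The coupling [B_ij rho_i gam_j] is feasible and gives equality in Gibbs' inequality entry by
    entry. *)
Lemma Psi1_eq_dual (alpha beta : 'rV[R]_q) (rho gam : 'I_q -> R) :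
  (forall i, 0 < rho i) -> (forall i, 0 < gam i) ->
  (forall i, \sum_j Bm i j * rho i * gam j = alpha ord0 i) ->
  (forall j, \sum_i Bm i j * rho i * gam j = beta ord0 j) ->
  Psi1 q Delta B alpha beta = (dual_value alpha beta rho gam)%:E.
Proof.
move=> rho0 gam0 ar bg.
have xf : feasible alpha beta (\matrix_(i, j) (Bm i j * rho i * gam j)).
  split => [i j|i|j].
  - by rewrite mxE !mulr_ge0 ?potts_ge0 ?ltW.
  - by rewrite -ar; apply: eq_bigr => j _; rewrite mxE.
  - by rewrite -bg; apply: eq_bigr => i _; rewrite mxE.
apply/eqP; rewrite eq_le Psi1_le_dual//=;
  [|by move=> i; exact: ltW..].
apply: ereal_sup_ubound; exists (\matrix_(i, j) (Bm i j * rho i * gam j)) => //.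
rewrite /psi_obj /dual_value EFinD; congr (_ + _)%E.
rewrite EFinM; congr (_ * _)%E.
transitivity (\sum_i \sum_j (- (Bm i j * rho i * gam j * ln (rho i))
    - Bm i j * rho i * gam j * ln (gam j))%:E)%E.
  apply: eq_bigr => i _; apply: eq_bigr => j _.
  by rewrite mxE edge_term_eq ?potts_ge0.
under eq_bigr do rewrite sumEFin; rewrite sumEFin; congr EFin.
rewrite (eq_bigr _ (fun i _ => ar i)) subrr sub0r.
have /= [e1 e2] := feasible_weighted_sums (fun i => ln (rho i)) (fun j => ln (gam j)) xf.
rewrite -e1 -e2 -sumrN -sumrB; apply: eq_bigr => i _.
by rewrite -sumrN -sumrB; apply: eq_bigr => j _; rewrite mxE.
Qed.
End Gibbs.

(** * The norm inequality *)

Lemma nonneg_root_exists (R : realType) (n : nat) (a : R) : 0 <= a ->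
  exists2 g : R, 0 <= g & g ^+ n.+1 = a.
Proof.
move=> a0; exists (a `^ n.+1%:R^-1); first exact: powR_ge0.
by rewrite -powR_mulrn ?powR_ge0// -powRrM mulVf ?pnatr_eq0// powRr1.
Qed.

Lemma pos_root_exists (R : realType) (n : nat) (a : R) : 0 < a ->
  exists2 g : R, 0 < g & g ^+ n.+1 = a.
Proof.
move=> a0; have [g g0 ga] := nonneg_root_exists n (ltW a0); exists g => //.
by rewrite lt_neqAle g0 andbT; apply: contraTneq a0 => g00; rewrite -ga -g00 expr0n ltxx.
Qed.

Lemma potts_sum (R : realType) (q : nat) (B : R) (z : 'I_q -> R) i :
  \sum_j potts_mx q B i j * z j = \sum_j z j - (1 - B) * z i.
Proof.
rewrite (bigD1 i)//= [in RHS](bigD1 i)//= mxE eqxx.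
rewrite (eq_bigr z) => [|j ji]; first by ring.
by rewrite mxE eq_sym (negbTE ji) mul1r.
Qed.

Section Optimum.
Variables (R : realType) (n q : nat) (B k G : R) (xs : 'I_q -> R).
Local Notation d := n.+1.
Local Notation kap := (1 - B).
Local Notation f := (site n k).
Local Notation H := (siteH n k).
Hypotheses (n0 : (0 < n)%N) (k0 : 0 < k) (B0 : 0 <= B) (B1 : B < 1).
Hypothesis ffxs : forall i, f (f (xs i)) = xs i.
Hypothesis sum_xs : \sum_i k * xs i ^+ d = kap.
Hypothesis sum_fxs : \sum_i k * f (xs i) ^+ d = kap.
Hypothesis Hmin : forall i x, 0 <= x -> 0 <= f x -> H (xs i) <= H x.
Hypotheses (G0 : 0 < G) (GE : G ^+ d.+1 = \sum_i xs i ^+ d.+1).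

Let kap0 : 0 < kap. Proof. by rewrite subr_gt0. Qed.

(** On an orbit of period two, [k x^(d+1) - k x^d] is symmetric in [x] and [f(x)], and the two
    constraints have the same total. Hence one [G] normalizes both sides of the graph. *)
Lemma sum_fxs_pow : \sum_i f (xs i) ^+ d.+1 = G ^+ d.+1.
Proof.
have e1 i : k * xs i ^+ d.+1 = k * xs i ^+ d - (k * f (xs i) ^+ d) * (k * xs i ^+ d).
  by rewrite exprSr -{2}ffxs /(f (f _)); ring.
have e2 i : k * f (xs i) ^+ d.+1 = k * f (xs i) ^+ d - (k * f (xs i) ^+ d) * (k * xs i ^+ d).
  by rewrite exprSr {2}/f; ring.
apply: (mulfI (lt0r_neq0 k0)); rewrite GE !mulr_sumr.
rewrite (eq_bigr _ (fun i _ => e1 i)) (eq_bigr _ (fun i _ => e2 i)) !sumrB.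
by rewrite sum_xs sum_fxs.
Qed.

Lemma sum_siteH (x : 'I_q -> R) : \sum_i k * x i ^+ d = kap ->
  \sum_i H (x i) = d%:R * (\sum_i x i ^+ d.+1) - d.+1%:R * (kap / k) - \sum_i f (x i) ^+ d.+1.
Proof.
move=> xk; rewrite /siteH !sumrB -!mulr_sumr; congr (_ - _ * _ - _).
by rewrite -xk -mulr_sumr mulrC mulKf// gt_eqF.
Qed.

Section Competitor.
Variable x : 'I_q -> R.
Hypotheses (x0 : forall i, 0 <= x i) (fx0 : forall i, 0 <= f (x i)).
Hypothesis xk : \sum_i k * x i ^+ d = kap.
Local Notation X := (\sum_i x i ^+ d.+1).

Let X0 : 0 <= X. Proof. by apply: sumr_ge0 => i _; rewrite exprn_ge0. Qed.
Let Gn0 : 0 < (G ^+ d.+1) ^+ n. Proof. by rewrite !exprn_gt0. Qed.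

(** The target inequality splits into two nonnegative defects: the gap between [X^d] and its tangent
    at [G^(d+1)], and the excess of [siteH] over its minimum. The constraint on [x] cancels the
    terms [(d+1) x^d]. *)
Lemma sum_f_deficit : X ^+ d - (G ^+ d.+1) ^+ n * \sum_i f (x i) ^+ d.+1 =
  (X ^+ d - (G ^+ d.+1) ^+ d - d%:R * (G ^+ d.+1) ^+ n * (X - G ^+ d.+1))
  + (G ^+ d.+1) ^+ n * \sum_i (H (x i) - H (xs i)).
Proof.
rewrite sumrB (sum_siteH xk) (sum_siteH sum_xs) sum_fxs_pow -GE.
by rewrite (exprS (G ^+ d.+1) n); ring.
Qed.

Let deficit1 : 0 <= X ^+ d - (G ^+ d.+1) ^+ d - d%:R * (G ^+ d.+1) ^+ n * (X - G ^+ d.+1).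
Proof. by rewrite -addrA -opprD subr_ge0 pow_tangent_le// exprn_ge0// ltW. Qed.

Let deficit2 i : 0 <= H (x i) - H (xs i). Proof. by rewrite subr_ge0 Hmin. Qed.

Lemma sum_f_le : (G ^+ d.+1) ^+ n * \sum_i f (x i) ^+ d.+1 <= X ^+ d.
Proof.
rewrite -subr_ge0 sum_f_deficit addr_ge0// mulr_ge0 ?sumr_ge0// ltW//.
Qed.

Lemma sum_f_eq : (G ^+ d.+1) ^+ n * \sum_i f (x i) ^+ d.+1 = X ^+ d ->
  X = G ^+ d.+1 /\ forall i, H (x i) = H (xs i).
Proof.
move=> e; have := sum_f_deficit; rewrite e subrr => /esym/eqP.
have D2 : 0 <= \sum_i (H (x i) - H (xs i)) by rewrite sumr_ge0.
rewrite paddr_eq0 ?deficit1 ?mulr_ge0 ?(ltW Gn0)// => /andP[/eqP e1].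
rewrite mulf_eq0 gt_eqF//= psumr_eq0 => [/allP e2|i _]; last exact: deficit2.
split=> [|i]; last first.
  by apply/eqP; rewrite -subr_eq0; exact: (e2 i (mem_index_enum i)).
apply/eqP; apply: contraPT e1 => XG; apply/eqP; rewrite gt_eqF//.
(* Since [n > 0], the exponent [d] is at least 2 and the tangent inequality is strict. *)
case: (n) n0 XG => // m _ XG.
rewrite -addrA -opprD subr_gt0; apply: pow_tangent_lt XG => //.
  by rewrite exprn_ge0// ltW.
by apply: sumr_ge0 => i _; rewrite exprn_ge0.
Qed.
End Competitor.

(** The value of the bilinear form at [r = f(xs) / G], [c = xs / G]. *)
Definition opt_value : R := kap / k / G ^+ n.
Local Notation V := opt_value.

Lemma opt_value_gt0 : 0 < V.
Proof. by rewrite !divr_gt0 ?exprn_gt0. Qed.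

Section Bound.
Variables r c : 'I_q -> R.
Hypotheses (r0 : forall i, 0 <= r i) (c0 : forall i, 0 <= c i).
Hypotheses (r1 : \sum_i r i ^+ d.+1 = 1) (c1 : \sum_i c i ^+ d.+1 = 1).

Local Notation form := (\sum_i \sum_j potts_mx q B i j * r i ^+ d * c j ^+ d).
Let S := \sum_j c j ^+ d.
Let v i := S - kap * c i ^+ d.

Let formE : form = \sum_i r i ^+ d * v i.
Proof.
apply: eq_bigr => i _; rewrite /v -potts_sum mulr_sumr.
by apply: eq_bigr => j _; ring.
Qed.

Let cle i : c i ^+ d <= S.
Proof. by rewrite /S (bigD1 i)//= lerDl sumr_ge0// => j _; rewrite exprn_ge0. Qed.

Let S0 : 0 < S.
Proof.
rewrite lt_neqAle sumr_ge0 => [|j _]; last by rewrite exprn_ge0.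
rewrite andbT; apply: contra_eqN c1 => /eqP Se; rewrite big1 ?(eq_sym 0) ?oner_eq0// => i _.
by rewrite exprS (_ : c i ^+ d = 0) ?mulr0//; apply/eqP; rewrite eq_le {1}Se cle exprn_ge0.
Qed.

Let v0 i : 0 <= v i.
Proof.
rewrite subr_ge0; apply: le_trans (cle i).
by rewrite ler_piMl ?exprn_ge0// gerBl.
Qed.

(** The factor that scales [c] so that [sum_i k (g c_i)^d = 1 - B]; in the equality case it turns
    out to be [G]. *)
Let g_ex : exists2 g : R, 0 < g & g ^+ d = kap / (k * S).
Proof. by apply: pos_root_exists; rewrite divr_gt0// mulr_gt0. Qed.

(** The norm inequality left by Hoelder's. Since [v = S f(g c)], it is [sum_f_le] for [x = g c], up
    to constants. *)
Let sum_v_bound :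
  \sum_i (v i / V) ^+ d.+1 <= 1 /\
  (\sum_i (v i / V) ^+ d.+1 = 1 ->
    [/\ forall i, H (G * c i) = H (xs i), forall i, 0 <= f (G * c i),
        \sum_i k * (G * c i) ^+ d = kap &
        forall i, v i / V = f (G * c i) / G]).
Proof.
have [g g0 gE] := g_ex; pose x i := g * c i.
have kx i : k * x i ^+ d = kap * c i ^+ d / S.
  by rewrite /x exprMn gE; field; rewrite !gt_eqF.
have fx i : v i = S * f (x i).
  by rewrite /site kx /v; field; rewrite gt_eqF.
have x0 i : 0 <= x i by rewrite mulr_ge0// ltW.
have fx0 i : 0 <= f (x i) by rewrite -(pmulr_rge0 _ S0) -fx v0.
have xk : \sum_i k * x i ^+ d = kap.
  under eq_bigr do rewrite kx.
  by rewrite -mulr_suml -mulr_sumr mulfK// gt_eqF.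
have X1 : \sum_i x i ^+ d.+1 = g ^+ d.+1.
  by under eq_bigr do rewrite exprMn; rewrite -mulr_sumr c1 mulr1.
have Sg : S * g ^+ d = kap / k by rewrite gE; field; rewrite !gt_eqF.
(* Both sides are the power [d+1] of [(1 - B) / k = V G^n = S g^d]. *)
have VS : V ^+ d.+1 * (G ^+ d.+1) ^+ n = S ^+ d.+1 * (g ^+ d.+1) ^+ d.
  rewrite -!exprM [(_ * n)%N]mulnC [(_ * d)%N]mulnC !exprM -!exprMn Sg /opt_value.
  by rewrite divfK// gt_eqF// exprn_gt0.
have vE : \sum_i (v i / V) ^+ d.+1 =
    S ^+ d.+1 / V ^+ d.+1 * \sum_i f (x i) ^+ d.+1.
  by rewrite mulr_sumr; apply: eq_bigr => i _; rewrite fx exprMn exprMn exprVn mulrAC.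
have C0 : 0 < S ^+ d.+1 / V ^+ d.+1 by rewrite divr_gt0 ?exprn_gt0 ?opt_value_gt0.
have Gn0 : 0 < (G ^+ d.+1) ^+ n by rewrite !exprn_gt0.
have C1 : S ^+ d.+1 / V ^+ d.+1 * (g ^+ d.+1) ^+ d = (G ^+ d.+1) ^+ n.
  by rewrite mulrAC -VS mulrAC mulfV ?mul1r// gt_eqF// exprn_gt0// opt_value_gt0.
have W0 : 0 < (g ^+ d.+1) ^+ d by rewrite !exprn_gt0.
have CF z : S ^+ d.+1 / V ^+ d.+1 * z * (g ^+ d.+1) ^+ d = (G ^+ d.+1) ^+ n * z.
  by rewrite mulrAC C1.
split.
  by rewrite vE -(ler_pM2r W0) CF mul1r -X1 sum_f_le.
move=> e; have [|Xe He] := sum_f_eq x0 fx0 xk.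
  by rewrite -CF -vE e mul1r X1.
have gG : g = G.
  move: Xe; rewrite X1 => /(pexpIrn (ltn0Sn _)); apply; rewrite nnegrE ltW//.
rewrite /x gG in He fx0 xk fx; split => // i.
rewrite fx /opt_value -Sg gG exprS; field.
by rewrite !gt_eqF ?exprn_gt0.
Qed.

Let v'0 i : 0 <= v i / V.
Proof. by rewrite divr_ge0 ?v0// ltW// opt_value_gt0. Qed.

(** Hoelder's inequality in normalized form, as the tangent of [y^(d+1)] at [r_i]; the gaps are kept
    separate so that equality can be located. *)
Let young i : 0 <= (v i / V) ^+ d.+1 - r i ^+ d.+1 - d.+1%:R * r i ^+ d * (v i / V - r i).
Proof. by rewrite -addrA -opprD subr_ge0 pow_tangent_le. Qed.

Let sum_young :
  \sum_i ((v i / V) ^+ d.+1 - r i ^+ d.+1 - d.+1%:R * r i ^+ d * (v i / V - r i))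
  = (\sum_i (v i / V) ^+ d.+1 - 1) + d.+1%:R * (1 - form / V).
Proof.
have e : \sum_i r i ^+ d * (v i / V - r i) = form / V - 1.
  under eq_bigr do rewrite mulrBr -exprSr mulrA.
  by rewrite sumrB r1 -mulr_suml -formE.
rewrite !sumrB r1; congr (_ + _); under eq_bigr do rewrite -mulrA.
by rewrite -mulr_sumr e -mulrN opprB.
Qed.

Lemma form_le : form <= V.
Proof.
have [v1 _] := sum_v_bound.
have : 0 <= (\sum_i (v i / V) ^+ d.+1 - 1) + d.+1%:R * (1 - form / V).
  by rewrite -sum_young sumr_ge0.
move=> h; have : 0 <= d.+1%:R * (1 - form / V) by lra.
by rewrite pmulr_rge0 ?ltr0n// subr_ge0 ler_pdivrMr ?opt_value_gt0// mul1r.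
Qed.

(** At the optimum [sum_young] bounds the sum of the nonnegative gaps by 0, so each vanishes and
    [r = v / V]. Equality in [sum_v_bound] supplies the rest. *)
Lemma form_eq : form = V ->
  [/\ forall i, H (G * c i) = H (xs i), forall i, 0 <= f (G * c i),
      \sum_i k * (G * c i) ^+ d = kap & forall i, r i = f (G * c i) / G].
Proof.
move=> e; have [v1 veq] := sum_v_bound.
have D := sum_young; rewrite e divff ?gt_eqF ?opt_value_gt0// subrr mulr0 addr0 in D.
have D0 : 0 <= \sum_i (v i / V) ^+ d.+1 - 1 by rewrite -D sumr_ge0.
have ve : \sum_i (v i / V) ^+ d.+1 = 1 by lra.
have [h1 h2 h3 h4] := veq ve; split => // i; rewrite -h4.
move: D; rewrite ve subrr => /eqP; rewrite psumr_eq0 => [/allP|j _]; last exact: young.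
move=> /(_ i (mem_index_enum _))/= => /eqP yi; apply/eqP; apply: contraPT yi => rv.
apply/eqP; rewrite gt_eqF// -addrA -opprD subr_gt0 pow_tangent_lt//.
by rewrite eq_sym.
Qed.
End Bound.
End Optimum.

(** * Dominant phases from minimizing sites *)

(** The reason for parametrizing phases by roots: with [alpha = r^(d+1)] and [rho = r^d / V],
    [Delta ln rho] is [(Delta - 1) ln alpha] up to a constant, and the vertex entropies cancel in
    the dual value. *)
Lemma xlnx_expr (R : realType) (n : nat) (r V : R) : 0 <= r -> 0 < V ->
  n.+2%:R * (r ^+ n.+2 * ln (r ^+ n.+1 / V)) =
  n.+1%:R * xlnx (r ^+ n.+2) - n.+2%:R * r ^+ n.+2 * ln V.
Proof.
move=> r0 V0; rewrite /xlnx expf_eq0/=; case: eqVneq => [->|rn].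
  by rewrite expr0n/= !(mul0r, mulr0) subrr.
have {}r0 : 0 < r by rewrite lt_neqAle eq_sym rn.
rewrite ln_div ?posrE ?exprn_gt0// !lnXn// -!(mulr_natr (ln r)); ring.
Qed.

Section PsiBound.
Variables (R : realType) (n q : nat) (B V : R).
Hypotheses (B0 : 0 <= B) (V0 : 0 < V).
Variables r c : 'I_q -> R.
Hypotheses (r0 : forall i, 0 <= r i) (c0 : forall i, 0 <= c i).
Hypotheses (r1 : \sum_i r i ^+ n.+2 = 1) (c1 : \sum_i c i ^+ n.+2 = 1).
Local Notation alpha := (\row_i r i ^+ n.+2 : 'rV[R]_q).
Local Notation beta := (\row_i c i ^+ n.+2 : 'rV[R]_q).

(** The scale [V] is free. Taken as [opt_value], it turns [form <= V] directly into the bound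
    [Delta ln V]. *)
Lemma dual_value_root :
  dual_value n.+2 B alpha beta (fun i => r i ^+ n.+1 / V) (fun j => c j ^+ n.+1) =
  n.+2%:R * (ln V + (\sum_i \sum_j potts_mx q B i j * r i ^+ n.+1 * c j ^+ n.+1) / V - 1).
Proof.
rewrite /dual_value.
have -> : \sum_i alpha ord0 i = 1.
  by rewrite -r1; apply: eq_bigr => i _; rewrite mxE.
have eF : \sum_i \sum_j potts_mx q B i j * (r i ^+ n.+1 / V) * c j ^+ n.+1 =
    (\sum_i \sum_j potts_mx q B i j * r i ^+ n.+1 * c j ^+ n.+1) / V.
  rewrite mulr_suml; apply: eq_bigr => i _; rewrite mulr_suml.
  by apply: eq_bigr => j _; ring.
have ea : n.+2%:R * (\sum_i alpha ord0 i * ln (r i ^+ n.+1 / V)) =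
    n.+1%:R * (\sum_i xlnx (alpha ord0 i)) - n.+2%:R * ln V.
  transitivity (\sum_i (n.+1%:R * xlnx (r i ^+ n.+2) - n.+2%:R * r i ^+ n.+2 * ln V)).
    by rewrite mulr_sumr; apply: eq_bigr => i _; rewrite mxE xlnx_expr.
  rewrite sumrB -mulr_suml -!mulr_sumr r1 mulr1; congr (_ * _ - _).
  by apply: eq_bigr => i _; rewrite mxE.
have eb : n.+2%:R * (\sum_j beta ord0 j * ln (c j ^+ n.+1)) =
    n.+1%:R * (\sum_i xlnx (beta ord0 i)).
  rewrite !mulr_sumr; apply: eq_bigr => i _; rewrite mxE.
  by have := xlnx_expr n (c0 i) ltr01; rewrite divr1 ln1 mulr0 subr0.
by rewrite eF !mulrBr ea eb -natr1; ring.
Qed.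

Lemma Psi1_le_form : (Psi1 q n.+2 B alpha beta <=
  (n.+2%:R * (ln V + (\sum_i \sum_j potts_mx q B i j * r i ^+ n.+1 * c j ^+ n.+1) / V - 1))%:E)%E.
Proof.
rewrite -dual_value_root; apply: Psi1_le_dual => // i.
- by rewrite divr_ge0 ?exprn_ge0// ltW.
- by rewrite exprn_ge0.
- rewrite mxE => h; rewrite divr_gt0// exprn_gt0// lt_neqAle r0 andbT eq_sym.
  by apply: contraTneq h => ->; rewrite expr0n ltxx.
- rewrite mxE => h; rewrite exprn_gt0// lt_neqAle c0 andbT eq_sym.
  by apply: contraTneq h => ->; rewrite expr0n ltxx.
Qed.
End PsiBound.

Lemma simplex_roots (R : realType) (n q : nat) (alpha : 'rV[R]_q) :
  in_simplex alpha -> exists r : 'I_q -> R, [/\ forall i, 0 <= r i,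
    \sum_i r i ^+ n.+1 = 1 & alpha = \row_i r i ^+ n.+1].
Proof.
move=> [a0 a1]; exists (fun i => s2val (cid2 (nonneg_root_exists n (a0 i)))).
have e i : s2val (cid2 (nonneg_root_exists n (a0 i))) ^+ n.+1 = alpha ord0 i.
  by case: cid2.
split; first by move=> i; case: cid2.
  by rewrite -a1; apply: eq_bigr.
by apply/rowP => i; rewrite mxE e.
Qed.

Section OptimalPhase.
Variables (R : realType) (n q : nat) (B k G : R) (xs : 'I_q -> R).
Local Notation d := n.+1.
Local Notation kap := (1 - B).
Local Notation f := (site n k).
Local Notation H := (siteH n k).
Hypotheses (n0 : (0 < n)%N) (k0 : 0 < k) (B0 : 0 <= B) (B1 : B < 1).
Hypothesis xs0 : forall i, 0 < xs i.
Hypothesis fxs0 : forall i, 0 < f (xs i).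
Hypothesis ffxs : forall i, f (f (xs i)) = xs i.
Hypothesis sum_xs : \sum_i k * xs i ^+ d = kap.
Hypothesis sum_fxs : \sum_i k * f (xs i) ^+ d = kap.
Hypothesis Hmin : forall i x, 0 <= x -> 0 <= f x -> H (xs i) <= H x.
Hypotheses (G0 : 0 < G) (GE : G ^+ d.+1 = \sum_i xs i ^+ d.+1).
Local Notation V := (opt_value n B k G).

Let V0 : 0 < V. Proof. exact: opt_value_gt0. Qed.
Let Gn : G != 0. Proof. by rewrite gt_eqF. Qed.
Let kn : k != 0. Proof. by rewrite gt_eqF. Qed.
Let kapn : kap != 0. Proof. by rewrite gt_eqF// subr_gt0. Qed.

Definition opt_alpha : 'rV[R]_q := \row_i (f (xs i) / G) ^+ d.+1.
Definition opt_beta : 'rV[R]_q := \row_i (xs i / G) ^+ d.+1.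
Definition opt_rho i : R := (f (xs i) / G) ^+ d / V.
Definition opt_gam i : R := (xs i / G) ^+ d.

Lemma opt_rho_gt0 i : 0 < opt_rho i.
Proof. by rewrite divr_gt0// exprn_gt0// divr_gt0. Qed.

Lemma opt_gam_gt0 i : 0 < opt_gam i.
Proof. by rewrite exprn_gt0// divr_gt0. Qed.

Lemma opt_alpha_sum : \sum_i (f (xs i) / G) ^+ d.+1 = 1.
Proof.
under eq_bigr do rewrite exprMn; rewrite -mulr_suml.
by rewrite (sum_fxs_pow k0 ffxs sum_xs sum_fxs GE) -exprMn divff// expr1n.
Qed.

Lemma opt_beta_sum : \sum_i (xs i / G) ^+ d.+1 = 1.
Proof.
under eq_bigr do rewrite exprMn; rewrite -mulr_suml -GE.
by rewrite -exprMn divff// expr1n.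
Qed.

Lemma opt_row i : \sum_j potts_mx q B i j * opt_rho i * opt_gam j = opt_alpha ord0 i.
Proof.
under eq_bigr do rewrite mulrAC mulrC; rewrite -mulr_sumr potts_sum mxE.
have -> : \sum_j opt_gam j = kap / k / G ^+ d.
  rewrite -sum_xs -mulr_sumr [k * _]mulrC mulfK// mulr_suml.
  by apply: eq_bigr => j _; rewrite /opt_gam exprMn exprVn.
have -> : kap / k / G ^+ d - kap * opt_gam i = kap / k / G ^+ d * f (xs i).
  by rewrite /opt_gam /site exprMn exprVn; field; rewrite expf_neq0// Gn kn.
rewrite /opt_rho (exprSr _ d) -!mulrA; congr (_ * _).
rewrite /opt_value (exprS G n); field.
by rewrite ?expf_neq0// Gn kn kapn.
Qed.

(** The second half of the recursion: the Potts matrix sends [f(xs)^d] to [((1 - B) / k) f(f(xs))],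
    and [f] composed with itself fixes [xs]. *)
Lemma opt_col j : \sum_i potts_mx q B i j * opt_rho i * opt_gam j = opt_beta ord0 j.
Proof.
rewrite -mulr_suml.
have -> : \sum_i potts_mx q B i j * opt_rho i = \sum_i opt_rho i - kap * opt_rho j.
  rewrite -potts_sum; apply: eq_bigr => i _; congr (_ * _).
  by rewrite !mxE eq_sym.
have -> : \sum_j opt_rho j = G^-1.
  have sf : \sum_i f (xs i) ^+ d = kap / k.
    by rewrite -sum_fxs -mulr_sumr [k * _]mulrC mulfK.
  rewrite /opt_rho; under eq_bigr do rewrite exprMn -mulrA.
  rewrite -mulr_suml sf exprVn /opt_value (exprS G n); field.
  by rewrite ?expf_neq0// Gn kn kapn.
have -> : G^-1 - kap * opt_rho j = G^-1 * f (f (xs j)).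
  rewrite /opt_rho exprMn exprVn /opt_value (exprS G n) {2}/site; field.
  by rewrite ?expf_neq0// Gn kn kapn.
by rewrite ffxs mxE (exprS _ d) mulrC /opt_gam; ring.
Qed.

Lemma opt_alpha_simplex : in_simplex opt_alpha.
Proof.
split=> [i|]; first by rewrite mxE exprn_ge0// divr_ge0// ltW.
by under eq_bigr do rewrite mxE; exact: opt_alpha_sum.
Qed.

Lemma opt_beta_simplex : in_simplex opt_beta.
Proof.
split=> [i|]; first by rewrite mxE exprn_ge0// divr_ge0// ltW.
by under eq_bigr do rewrite mxE; exact: opt_beta_sum.
Qed.

Lemma Psi1_opt : Psi1 q d.+1 B opt_alpha opt_beta = (d.+1%:R * ln V)%:E.
Proof.
rewrite (Psi1_eq_dual d.+1 B0 opt_rho_gt0 opt_gam_gt0 opt_row opt_col).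
rewrite (dual_value_root B V0 _ _ opt_alpha_sum); last 2 first.
- by move=> i; rewrite divr_ge0// ltW.
- by move=> i; rewrite divr_ge0// ltW.
congr EFin; congr (_ * _).
have -> : \sum_i \sum_j potts_mx q B i j * (f (xs i) / G) ^+ d * (xs j / G) ^+ d = V.
  transitivity (V * \sum_i opt_alpha ord0 i).
    rewrite mulr_sumr; apply: eq_bigr => i _; rewrite -opt_row mulr_sumr.
    apply: eq_bigr => j _; rewrite /opt_rho /opt_gam; field.
    by rewrite gt_eqF.
  by have [_ ->] := opt_alpha_simplex; rewrite mulr1.
by rewrite divff ?gt_eqF// addrK.
Qed.

Lemma Psi1_le_opt (alpha beta : 'rV[R]_q) : in_simplex alpha -> in_simplex beta ->
  (Psi1 q d.+1 B alpha beta <= (d.+1%:R * ln V)%:E)%E.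
Proof.
move=> /(@simplex_roots _ d)[r [r0 r1 ->]] /(@simplex_roots _ d)[c [c0 c1 ->]].
apply: le_trans (Psi1_le_form B0 V0 r0 c0 r1) _.
rewrite lee_fin ler_pM2l ?ltr0n// -addrA gerDl subr_le0 ler_pdivrMr// mul1r.
exact: (form_le n0 k0 B0 B1 ffxs sum_xs sum_fxs Hmin G0 GE).
Qed.

Lemma opt_dominant : dominant_phase q d.+1 B opt_alpha opt_beta.
Proof.
split; [exact: opt_alpha_simplex|exact: opt_beta_simplex|].
by move=> a b sa sb; rewrite Psi1_opt Psi1_le_opt.
Qed.

(** A dominant phase reaches the value [Delta ln V] of the explicit one, which forces [form = V].
    Only minimality of each site is concluded; which minimizer occurs at which spin is settled
    later. *)
Lemma dominant_opt (alpha beta : 'rV[R]_q) : dominant_phase q d.+1 B alpha beta ->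
  exists x : 'I_q -> R, [/\ forall i, 0 <= x i /\ 0 <= f (x i),
    forall i, H (x i) = H (xs i), \sum_i k * x i ^+ d = kap,
    forall i, alpha ord0 i = (f (x i) / G) ^+ d.+1 &
    forall i, beta ord0 i = (x i / G) ^+ d.+1].
Proof.
move=> [sa sb]; move/(_ _ _ opt_alpha_simplex opt_beta_simplex).
have [r [r0 r1 ->]] := @simplex_roots _ d _ _ sa.
have [c [c0 c1 ->]] := @simplex_roots _ d _ _ sb.
rewrite Psi1_opt => /le_trans/(_ (Psi1_le_form B0 V0 r0 c0 r1)).
rewrite lee_fin ler_pM2l ?ltr0n// -addrA lerDl subr_ge0 ler_pdivlMr// mul1r => Vle.
have := form_le n0 k0 B0 B1 ffxs sum_xs sum_fxs Hmin G0 GE r0 c0 r1 c1.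
move=> Vge; have Veq := le_anti (introT andP (conj Vge Vle)).
have [h1 h2 h3 h4] := form_eq n0 k0 B0 B1 ffxs sum_xs sum_fxs Hmin G0 GE r0 c0 r1 c1 Veq.
exists (fun i => G * c i); split => // i.
- by split => //; rewrite mulr_ge0// ltW.
- by rewrite mxE h4.
- by rewrite mxE mulrC mulKf.
Qed.
End OptimalPhase.

(** * Uniform and half-half phases *)

Lemma uniform_phase (R : realType) (q n : nat) (B : R) :
  (1 < q)%N -> (0 < n)%N -> 0 <= B -> B < 1 ->
  n.+2%:R * ((1 - B) / q%:R) <= 1 ->
  exists alpha beta : 'rV[R]_q,
    [/\ dominant_phase q n.+2 B alpha beta,
        (forall alpha' beta', dominant_phase q n.+2 B alpha' beta' ->
           alpha' = alpha /\ beta' = beta) &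
        alpha = beta].
Proof.
move=> q1 n0 B0 B1; set s := (1 - B) / q%:R => sle.
have q0 : 0 < q%:R :> R by rewrite ltr0n ltnW.
have s0 : 0 < s by rewrite divr_gt0// subr_gt0.
have s1 : s < 1.
  rewrite ltr_pdivrMr// mul1r; apply: (@le_lt_trans _ _ 1); first by rewrite gerBl.
  by rewrite ltr1n.
(* For equal sites the constraint reads [k w^d = s], so the fixed point is [1 - s], and the bound
   assumed on [s] is [fixed_point_stable]'s condition on [w]. *)
pose w := 1 - s; have w0 : 0 < w by rewrite subr_gt0.
pose k := s / w ^+ n.+1.
have k0 : 0 < k by rewrite divr_gt0// exprn_gt0.
have kw : k * w ^+ n.+1 = s by rewrite divfK// gt_eqF// exprn_gt0.
have fw : site n k w = w by rewrite /site kw.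
have kwle : n.+2%:R * k * w ^+ n.+1 <= 1 by rewrite -mulrA kw.
pose xs (_ : 'I_q) := w.
have Xgt0 : 0 < \sum_i xs i ^+ n.+2.
  rewrite /xs sumr_const card_ord -(mulr_natr (w ^+ _)).
  by apply: mulr_gt0 => //; exact: exprn_gt0.
have [G G0 GE] := pos_root_exists n.+1 Xgt0.
have Hlt := siteH_fixed_lt k0 n0 w0 fw kwle.
have sum_xs : \sum_i k * xs i ^+ n.+1 = 1 - B.
  rewrite /xs sumr_const card_ord kw -(mulr_natr s) /s divfK// gt_eqF//.
have sum_fxs : \sum_i k * site n k (xs i) ^+ n.+1 = 1 - B.
  by rewrite -sum_xs; apply: eq_bigr => i _; rewrite /xs fw.
have Hmin i x : 0 <= x -> 0 <= site n k x -> siteH n k (xs i) <= siteH n k x.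
  by move=> x0 fx0; have [->//|xw] := eqVneq x w; exact/ltW/Hlt.
have xs0 i : 0 < xs i by [].
have fxs0 i : 0 < site n k (xs i) by rewrite /xs fw.
have ffxs i : site n k (site n k (xs i)) = xs i by rewrite /xs !fw.
exists (opt_alpha n k G xs), (opt_beta n G xs); split.
- exact: (opt_dominant n0 k0 B0 B1 xs0 fxs0 ffxs sum_xs sum_fxs Hmin G0 GE).
- move=> a b /(dominant_opt n0 k0 B0 B1 xs0 fxs0 ffxs sum_xs sum_fxs Hmin G0 GE).
  move=> [x [x0 Hx _ ax bx]].
  have xw i : x i = w.
    apply/eqP; apply: contraT => xw; have [? ?] := x0 i.
    by have := Hlt (x i); rewrite Hx ltxx => ->.
  by split; apply/rowP => i; rewrite mxE ?ax ?bx xw.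
- by apply/rowP => i; rewrite !mxE /xs fw.
Qed.

Lemma sum_if (R : realType) (q : nat) (T : {set 'I_q}) (u v : R) :
  \sum_i (if i \in T then u else v) = #|T|%:R * u + (q%:R - #|T|%:R) * v.
Proof.
rewrite (bigID (mem T))/= (eq_bigr (fun=> u)) => [|i ->//].
rewrite [X in _ + X](eq_bigr (fun=> v)) => [|i /negbTE ->//].
rewrite !sumr_const -(mulr_natl u) -(mulr_natl v); congr (_ + _ * _).
rewrite (eq_card (B := mem (~: T))) => [|i]; last by rewrite !inE.
have Tq : (#|T| <= q)%N by rewrite -[leqRHS](card_ord q) max_card.
by rewrite cardsCs finset.setCK card_ord natrB.
Qed.

Lemma card_half_setC (q : nat) (T : {set 'I_q}) : ~~ odd q ->
  #|T| = (q %/ 2)%N -> #|~: T| = (q %/ 2)%N.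
Proof.
move=> q_even cT; have qE : q = (q %/ 2 + q %/ 2)%N.
  by rewrite addnn -muln2 divnK// dvdn2.
by rewrite cardsCs finset.setCK card_ord cT {1}qE addnK.
Qed.

Section HalfPhases.
Variables (R : realType) (q n : nat) (B p r k : R).
Local Notation d := n.+1.
Local Notation s := ((1 - B) / q%:R).
Hypotheses (q4 : (4 <= q)%N) (q_even : ~~ odd q) (n0 : (0 < n)%N).
Hypotheses (B0 : 0 <= B) (B1 : B < 1).
Hypotheses (p0 : 0 < p) (pr : p < r) (k0 : 0 < k).
Hypotheses (fp : site n k p = r) (fr : site n k r = p).
Hypothesis kpr : k * (p ^+ d + r ^+ d) = 2 * s.
Hypothesis stable : (d%:R * k) ^+ 2 * (p * r) ^+ n < 1.

Definition half_site (T : {set 'I_q}) (i : 'I_q) : R := if i \in T then p else r.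
(** The value of [sum_i xs_i^(d+1)] for every half-set [T]: one [G], hence one pair of densities,
    serves all phases. *)
Definition half_G_pow : R := (q %/ 2)%:R * (p ^+ d.+1 + r ^+ d.+1).

Lemma r_gt0 : 0 < r. Proof. exact: lt_trans pr. Qed.

Lemma half_qE : q%:R = (q %/ 2)%:R + (q %/ 2)%:R :> R.
Proof. by rewrite -natrD addnn -muln2 divnK// dvdn2. Qed.

Lemma sum_half (T : {set 'I_q}) (u v : R) : #|T| = (q %/ 2)%N ->
  \sum_i (if i \in T then u else v) = (q %/ 2)%:R * (u + v).
Proof. by move=> cT; rewrite sum_if cT half_qE; ring. Qed.

Section Fixed.
Variable T : {set 'I_q}.
Hypothesis cT : #|T| = (q %/ 2)%N.
Local Notation xs := (half_site T).

Lemma half_site_gt0 i : 0 < xs i.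
Proof. by rewrite /half_site; case: ifP => _ //; exact: r_gt0. Qed.

Lemma site_half i : site n k (xs i) = if i \in T then r else p.
Proof. by rewrite /half_site; case: ifP. Qed.

Lemma site_half_gt0 i : 0 < site n k (xs i).
Proof. by rewrite site_half; case: ifP => _ //; exact: r_gt0. Qed.

Lemma site_site_half i : site n k (site n k (xs i)) = xs i.
Proof. by rewrite site_half /half_site; case: ifP. Qed.

Lemma half_s : (q %/ 2)%:R * (2 * s) = 1 - B.
Proof.
have q0 : q%:R != 0 :> R by rewrite pnatr_eq0 -lt0n (leq_trans _ q4).
by rewrite mulrA mulrDr mulr1 -half_qE mulrC divfK.
Qed.

Lemma sum_half_site : \sum_i k * xs i ^+ d = 1 - B.
Proof.
rewrite (eq_bigr (fun i => if i \in T then k * p ^+ d else k * r ^+ d)).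
  by rewrite sum_half// -mulrDr kpr half_s.
by move=> i _; rewrite /half_site; case: ifP.
Qed.

Lemma sum_site_half : \sum_i k * site n k (xs i) ^+ d = 1 - B.
Proof.
rewrite (eq_bigr (fun i => if i \in T then k * r ^+ d else k * p ^+ d)).
  by rewrite sum_half// addrC -mulrDr kpr half_s.
by move=> i _; rewrite site_half; case: ifP.
Qed.

Lemma half_site_min i x : 0 <= x -> 0 <= site n k x -> siteH n k (xs i) <= siteH n k x.
Proof.
move=> x0 fx0; have -> : siteH n k (xs i) = siteH n k p.
  by rewrite /half_site; case: ifP => // _; rewrite -(siteH_cycle fp fr).
have [->//|xp] := eqVneq x p.
have [->|xr] := eqVneq x r; first by rewrite -(siteH_cycle fp fr).
exact/ltW/(siteH_cycle_lt k0 n0 (ltW p0) pr fp fr stable).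
Qed.

Lemma half_siteG : half_G_pow = \sum_i xs i ^+ d.+1.
Proof.
rewrite (eq_bigr (fun i => if i \in T then p ^+ d.+1 else r ^+ d.+1)).
  by rewrite sum_half.
by move=> i _; rewrite /half_site; case: ifP.
Qed.
End Fixed.

Lemma half_set_exists : exists T : {set 'I_q}, #|T| = (q %/ 2)%N.
Proof.
exists [set x in take (q %/ 2) (enum 'I_q)].
rewrite cardsE (card_uniqP _) ?take_uniq ?enum_uniq// size_takel// size_enum_ord.
exact: leq_div.
Qed.

(** For the forward direction any half-set serves as reference. Minimality puts each [x_i] in
    [{p, r}], and the linear constraint, as [p^d < r^d], fixes the number of spins with value
    [p]. *)
Lemma half_phases (G : R) : 0 < G -> G ^+ d.+1 = half_G_pow ->
  forall alpha beta : 'rV[R]_q,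
    dominant_phase q d.+1 B alpha beta <->
    exists T : {set 'I_q}, #|T| = (q %/ 2)%N /\
      forall i, alpha ord0 i = (if i \in T then (r / G) ^+ d.+1 else (p / G) ^+ d.+1) /\
                beta ord0 i = (if i \in T then (p / G) ^+ d.+1 else (r / G) ^+ d.+1).
Proof.
move=> G0 GE alpha beta; split; last first.
  move=> [T [cT ab]].
  have := opt_dominant n0 k0 B0 B1 (half_site_gt0 T) (site_half_gt0 T)
    (site_site_half T) (sum_half_site cT) (sum_site_half cT) (half_site_min T) G0.
  rewrite -half_siteG// => /(_ GE); congr dominant_phase; apply/rowP => i.
    by rewrite mxE site_half (ab i).1; case: ifP.
  by rewrite mxE /half_site (ab i).2; case: ifP.
have [T0 cT0] := half_set_exists.
have GE0 := GE; rewrite (half_siteG cT0) in GE0.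
move=> /(dominant_opt n0 k0 B0 B1 (half_site_gt0 T0) (site_half_gt0 T0)
    (site_site_half T0) (sum_half_site cT0) (sum_site_half cT0) (half_site_min T0) G0 GE0).
move=> [x [x0 Hx xk ax bx]].
have xpr i : (x i == p) || (x i == r).
  apply: contraT; rewrite negb_or => /andP[xp xr]; have [? ?] := x0 i.
  have := siteH_cycle_lt k0 n0 (ltW p0) pr fp fr stable (x := x i).
  rewrite Hx /half_site; case: ifP => _; rewrite -?(siteH_cycle fp fr) ltxx; exact.
pose T := [set i | x i == p].
have xT i : x i = if i \in T then p else r.
  by rewrite inE; case: ifP => [/eqP//|xp]; move: (xpr i); rewrite xp => /eqP.
exists T; split; last first.
  by move=> i; rewrite ax bx xT; case: ifP => _; rewrite ?fp ?fr.
have pdr : 0 < r ^+ d - p ^+ d by rewrite subr_gt0 ltrXn2r// ltW.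
have : \sum_i k * x i ^+ d = #|T|%:R * (k * p ^+ d) + (q%:R - #|T|%:R) * (k * r ^+ d).
  rewrite -sum_if; apply: eq_bigr => i _; rewrite xT; case: ifP => //.
rewrite xk -half_s -kpr half_qE => e.
have : ((q %/ 2)%:R - #|T|%:R) * (k * (r ^+ d - p ^+ d)) = 0.
  by apply/eqP; rewrite -subr_eq0; apply/eqP; move: e; lra.
move/eqP; rewrite mulf_eq0 [X in _ || X]gt_eqF ?mulr_gt0// orbF subr_eq0 eqr_nat.
by move/eqP.
Qed.
End HalfPhases.

(** * Differentials and scalar products *)

Local Open Scope classical_set_scope.
Local Open Scope ring_scope.

Section EpsilonDiff.
Context {R : realType} {V W : normedModType R}.

Lemma differentiable_near (f : V -> W) x : differentiable f x ->
  forall e, 0 < e -> \forall y \near x, `|f y - f x - 'd f x (y - x)| <= e * `|y - x|.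
Proof.
move=> /diff_locally/eqaddoP + e e0 => /(_ e e0).
rewrite near_simpl/= => h; apply/nbhs_normP; move/nbhs_normP: h => [r r0 h].
exists r => // y /= yr.
have := h (y - x); rewrite /= sub0r normrN distrC => /(_ yr).
rewrite !fctE /= subrK; congr (`|_| <= _); by rewrite opprD addrA.
Qed.

Lemma differentiable_eps (f : V -> W) x (df : {linear V -> W}) : continuous df ->
  (forall e, 0 < e -> \forall y \near x, `|f y - f x - df (y - x)| <= e * `|y - x|) ->
  differentiable f x /\ 'd f x = df :> (V -> W).
Proof.
move=> dfc h.
have e0 : f \o shift x = cst (f x) + df +o_ 0 id.
  apply/eqaddoP => e e0; move/nbhs_normP: (h e e0) => [r r0 {}h].
  apply/nbhs_normP; exists r => // y /= yr.
  have := h (y + x); rewrite /= opprD addrCA subrr addr0 addrK -(sub0r y) => /(_ yr).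
  by congr (`|_| <= _); rewrite !fctE /= opprD addrA.
have dE := diff_unique dfc e0; split=> //.
by apply/diff_locallyP; rewrite dE.
Qed.
End EpsilonDiff.

Lemma sum_continuous (R : realType) (T : topologicalType) (I : Type) (s : seq I)
    (F : I -> T -> R) (x : T) : (forall i, {for x, continuous (F i)}) ->
  {for x, continuous (fun y => \sum_(i <- s) F i y)}.
Proof.
move=> Fc; elim: s => [|i s IH].
  have -> : (fun y => \sum_(i <- [::]) F i y) = cst 0.
    by apply/funext => y; rewrite big_nil.
  exact: cst_continuous.
have -> : (fun y => \sum_(j <- i :: s) F j y) = (fun y => F i y + \sum_(j <- s) F j y).
  by apply/funext => y; rewrite big_cons.
exact: (continuousD (Fc i) IH).
Qed.

Lemma sum_differentiable (R : realType) (V : normedModType R) (I : Type) (s : seq I)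
    (F : I -> V -> R) (x : V) : (forall i, differentiable (F i) x) ->
  differentiable (fun y => \sum_(i <- s) F i y) x /\
  forall v, 'd (fun y => \sum_(i <- s) F i y) x v = \sum_(i <- s) 'd (F i) x v.
Proof.
move=> Fd; elim: s => [|i s [IH1 IH2]].
  have -> : (fun y => \sum_(i <- [::]) F i y) = cst 0.
    by apply/funext => y; rewrite big_nil.
  by split=> [|v]; [exact: differentiable_cst|rewrite diff_cst big_nil].
have -> : (fun y => \sum_(j <- i :: s) F j y) = F i + (fun y => \sum_(j <- s) F j y).
  by apply/funext => y; rewrite big_cons.
split=> [|v]; first exact: differentiableD.
by rewrite diffD// big_cons -IH2.
Qed.

Lemma coord_le_norm (R : realType) (p q : nat) (M : 'M[R]_(p, q)) i j :
  `|M i j| <= `|M|.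
Proof.
by rewrite [leRHS]/Num.norm /= mx_normrE; apply/bigmax_geP; right => /=; exists (i, j).
Qed.

Lemma lipschitz_linear_continuous (R : realType) (V W : normedModType R)
    (f : {linear V -> W}) (C : R) : (forall x, `|f x| <= C * `|x|) -> continuous f.
Proof.
move=> fC; apply/bounded_linear_continuous/linear_boundedP.
exists C; split; first exact: num_real.
by move=> r Cr x; apply: le_trans (fC x) _; rewrite ler_wpM2r// ltW.
Qed.

Lemma mulmxr_continuous (R : realType) (N : nat) (A : 'M[R]_N) :
  continuous (fun v : 'rV[R]_N => v *m A).
Proof.
apply: (@lipschitz_linear_continuous _ _ _ (mulmxr A) (N%:R * `|A|)) => v /=.
have [->|v0] := eqVneq `|v *m A| 0; first by rewrite !mulr_ge0.
have [[i j] /= e] := mx_norm_neq0 v0.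
rewrite {1}/Num.norm /= e mxE; apply: le_trans (ler_norm_sum _ _ _) _.
apply: (@le_trans _ _ (\sum_(l < N) `|A| * `|v|)).
  by apply: ler_sum => l _; rewrite normrM mulrC ler_pM// coord_le_norm.
by rewrite sumr_const card_ord -(mulr_natl (_ * _)) mulrA.
Qed.

Section Dot.
Variables (R : realType) (N : nat).
Implicit Types u v w : 'rV[R]_N.

Definition dot u v : R := \sum_i u ord0 i * v ord0 i.

Lemma dotC u v : dot u v = dot v u.
Proof. by apply: eq_bigr => i _; rewrite mulrC. Qed.

Lemma dotDr u v w : dot u (v + w) = dot u v + dot u w.
Proof. by rewrite -big_split; apply: eq_bigr => i _; rewrite mxE mulrDr. Qed.

Lemma dotZr u (t : R) v : dot u (t *: v) = t * dot u v.
Proof. by rewrite mulr_sumr; apply: eq_bigr => i _; rewrite mxE mulrCA. Qed.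

Lemma dotNr u v : dot u (- v) = - dot u v.
Proof. by rewrite -scaleN1r dotZr mulN1r. Qed.

Lemma dotBr u v w : dot u (v - w) = dot u v - dot u w.
Proof. by rewrite dotDr dotNr. Qed.

Lemma dotDl u v w : dot (v + w) u = dot v u + dot w u.
Proof. by rewrite !(dotC _ u) dotDr. Qed.

Lemma dotZl u (t : R) v : dot (t *: v) u = t * dot v u.
Proof. by rewrite !(dotC _ u) dotZr. Qed.

Lemma dotBl u v w : dot (v - w) u = dot v u - dot w u.
Proof. by rewrite !(dotC _ u) dotBr. Qed.

Lemma dotNl u v : dot (- v) u = - dot v u.
Proof. by rewrite !(dotC _ u) dotNr. Qed.

Lemma dot_suml (I : finType) (F : I -> 'rV[R]_N) u :
  dot (\sum_e F e) u = \sum_e dot (F e) u.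
Proof.
rewrite /dot exchange_big; apply: eq_bigr => i _.
by rewrite summxE mulr_suml.
Qed.

Lemma dot_delta k u : dot (delta_mx ord0 k) u = u ord0 k.
Proof.
rewrite /dot (bigD1 k)//= mxE !eqxx mul1r big1 ?addr0// => j jk.
by rewrite mxE (negbTE jk) andbF mul0r.
Qed.

Lemma norm_dot u v : `|dot u v| <= N%:R * `|u| * `|v|.
Proof.
apply: le_trans (ler_norm_sum _ _ _) _.
apply: (@le_trans _ _ (\sum_(i < N) `|u| * `|v|)).
  by apply: ler_sum => i _; rewrite normrM ler_pM// coord_le_norm.
by rewrite sumr_const card_ord -(mulr_natl (_ * _)) mulrA.
Qed.

Lemma dotxx_ge0 u : 0 <= dot u u.
Proof. by apply: sumr_ge0 => i _; rewrite -expr2 sqr_ge0. Qed.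

Lemma dotxx_ge u : `|u| ^+ 2 <= dot u u.
Proof.
have [->|u0] := eqVneq `|u| 0; first by rewrite expr0n dotxx_ge0.
have [[i0 i] /= e] := mx_norm_neq0 u0.
rewrite {1}/Num.norm /= e real_normK ?num_real// (ord1 i0) /dot (bigD1 i)//= -expr2.
by rewrite lerDl sumr_ge0// => j _; rewrite -expr2 sqr_ge0.
Qed.

Lemma dotxx_eq0 u : dot u u = 0 -> u = 0.
Proof.
move=> u0; apply/eqP; rewrite -normr_eq0 -sqrf_eq0 eq_le sqr_ge0 andbT.
by rewrite -u0 dotxx_ge.
Qed.

Lemma dot_continuous u : continuous (dot u).
Proof.
move=> v; apply: sum_continuous => i.
by apply: continuousM; [exact: cst_continuous|exact: coord_continuous].
Qed.
End Dot.

Section ScalarExp.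
Context {R : realType}.
Implicit Types a b L : R.

Lemma expR_tangent a b : expR b * (a - b) <= expR a - expR b.
Proof.
have := expR_ge1Dx (a - b); rewrite -(ler_pM2l (expR_gt0 b)) -expRD.
by rewrite (addrC b) subrK; lra.
Qed.

Lemma expR_strong_monotone L a b : L <= a -> L <= b ->
  expR L * (a - b) ^+ 2 <= (expR a - expR b) * (a - b).
Proof.
wlog ab : a b / b <= a => [h|La Lb].
  by case: (leP b a) => [|/ltW] ab La Lb; [exact: h|have := h b a ab Lb La; lra].
apply: (@le_trans _ _ (expR b * (a - b) ^+ 2)).
  by rewrite ler_wpM2r ?sqr_ge0// ler_expR.
by rewrite expr2 mulrA ler_wpM2r ?subr_ge0// expR_tangent.
Qed.

(* The tangent inequality through the midpoint of a and b. *)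
Lemma expR_strong_convex L a b : L <= a -> L <= b ->
  expR b * (a - b) + expR L * (a - b) ^+ 2 / 4 <= expR a - expR b.
Proof.
move=> La Lb; pose c := (a + b) / 2.
have Lc : L <= c by rewrite /c; lra.
have h1 := expR_tangent a c.
have h2 := expR_tangent c b.
have h3 := expR_strong_monotone Lc Lb.
have ec : a - c = (a - b) / 2 by rewrite /c; field.
have ec' : c - b = (a - b) / 2 by rewrite /c; field.
rewrite ec in h1; rewrite ec' in h2 h3; nra.
Qed.
End ScalarExp.

(** * Gradients of sums of exponentials *)

Section ExpFamily.
Variables (R : realType) (N : nat) (E : finType) (c : E -> R) (m : E -> 'rV[R]_N).
Hypothesis c0 : forall e, 0 <= c e.
Hypothesis coercive : forall h, dot h h <= \sum_e c e * dot (m e) h ^+ 2.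
Implicit Types th h v tau : 'rV[R]_N.

Definition expK th : R := \sum_e c e * expR (dot (m e) th).
Definition gradK th : 'rV[R]_N := \sum_e (c e * expR (dot (m e) th)) *: m e.
Definition hessK th h : 'rV[R]_N :=
  \sum_e (c e * expR (dot (m e) th) * dot (m e) h) *: m e.

Lemma dot_gradK th v : dot (gradK th) v = \sum_e c e * expR (dot (m e) th) * dot (m e) v.
Proof. by rewrite dot_suml; apply: eq_bigr => e _; rewrite dotZl. Qed.

Variable th0 : 'rV[R]_N.
Local Notation tau0 := (gradK th0).

(** Bounds every exponent on the unit ball about [th0]. By [coercive], [eta] is then a modulus of
    strong monotonicity of [gradK] on that ball. *)
Definition exp_radius : R := \sum_e N%:R * `|m e| * (`|th0| + 1).
Local Notation eta := (expR (- exp_radius)).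

Lemma dot_exp_radius e th : `|th - th0| <= 1 -> - exp_radius <= dot (m e) th.
Proof.
move=> h; suff : `|dot (m e) th| <= exp_radius by rewrite ler_norml => /andP[].
apply: le_trans (norm_dot _ _) _; rewrite /exp_radius (bigD1 e)//=.
apply: (@le_trans _ _ (N%:R * `|m e| * (`|th0| + 1))).
  rewrite ler_wpM2l ?mulr_ge0// -[th](subrK th0) (le_trans (ler_normD _ _))//.
  by rewrite addrC lerD2l.
by rewrite lerDl sumr_ge0// => i _; rewrite !mulr_ge0// addr_ge0.
Qed.

Lemma gradK_strong_monotone th th' : `|th - th0| <= 1 -> `|th' - th0| <= 1 ->
  eta * dot (th - th') (th - th') <= dot (gradK th - gradK th') (th - th').
Proof.
move=> h h'; apply: (@le_trans _ _ (\sum_e c e * (eta * dot (m e) (th - th') ^+ 2))).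
  under eq_bigr do rewrite mulrCA.
  by rewrite -mulr_sumr ler_pM2l ?expR_gt0.
rewrite dotBl !dot_gradK -sumrB; apply: ler_sum => e _.
rewrite -!mulrA -mulrBr ler_wpM2l// -mulrBl !dotBr.
by apply: expR_strong_monotone; exact: dot_exp_radius.
Qed.

Lemma expK_strong_convex th : `|th - th0| <= 1 ->
  eta / 4 * dot (th - th0) (th - th0) <= expK th - expK th0 - dot tau0 (th - th0).
Proof.
move=> h; have h0 : `|th0 - th0| <= 1 by rewrite subrr normr0.
apply: (@le_trans _ _ (\sum_e c e * (eta / 4 * dot (m e) (th - th0) ^+ 2))).
  under eq_bigr do rewrite mulrCA.
  by rewrite -mulr_sumr ler_pM2l ?divr_gt0 ?expR_gt0.
rewrite dot_gradK -!sumrB; apply: ler_sum => e _.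
rewrite -!mulrA -!mulrBr ler_wpM2l// !dotBr.
have := expR_strong_convex (dot_exp_radius e h) (dot_exp_radius e h0).
lra.
Qed.

Lemma expK_tangent th v (t : R) : 0 <= t ->
  expK (th + t *: v) - expK th <= t * dot (gradK (th + t *: v)) v.
Proof.
move=> t0; rewrite dot_gradK mulr_sumr -sumrB; apply: ler_sum => e _.
rewrite -mulrBr -mulrA mulrCA ler_wpM2l//.
have := expR_tangent (dot (m e) th) (dot (m e) (th + t *: v)).
rewrite dotDr dotZr; lra.
Qed.

Lemma expK_continuous : continuous expK.
Proof.
move=> th; apply: sum_continuous => e; apply: continuousM; first exact: cst_continuous.
apply: continuous_comp; [exact: dot_continuous|exact: continuous_expR].
Qed.

(** If [g = gradK th - tau] were nonzero, a short step along [- g] would lower the function: by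
    convexity the decrease is at least the slope at the end of the step, still positive by
    continuity. *)
Lemma local_min_gradK th tau (r : R) : 0 < r ->
  (forall th', `|th' - th| < r -> expK th - dot tau th <= expK th' - dot tau th') ->
  gradK th = tau.
Proof.
move=> r0 hmin; apply/eqP; rewrite -subr_eq0; apply/eqP/dotxx_eq0.
set g := gradK th - tau.
pose phi (t : R) := dot (gradK (th - t *: g)) g - dot tau g.
have phic : {for 0, continuous phi}.
  have -> : phi = (fun t => \sum_e c e * expR (dot (m e) (th - t *: g)) * dot (m e) g
      - dot tau g).
    by apply/funext => t; rewrite /phi dot_gradK.
  apply: continuousB; last exact: cst_continuous.
  apply: sum_continuous => e; apply: continuousM; last exact: cst_continuous.
  apply: continuousM; first exact: cst_continuous.
  apply: continuous_comp; last exact: continuous_expR.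
  apply: (@continuous_comp _ _ _ (fun t : R => th - t *: g) (dot (m e))).
    apply: continuousB; first exact: cst_continuous.
    exact: scalel_continuous.
  exact: dot_continuous.
apply/eqP; rewrite eq_le dotxx_ge0 andbT leNgt; apply/negP => gg.
have phi0 : 0 < phi 0 by rewrite /phi scale0r subr0 -dotBl.
have /nbhs_normP[s /= s0 hs] : \forall t \near (0 : R), 0 < phi t.
  exact: (cvgr_gt _ phic).
pose t := Num.min (s / 2) (r / (2 * (`|g| + 1))).
have g1 : 0 < `|g| + 1 by rewrite ltr_wpDl.
have t0 : 0 < t by rewrite lt_min !divr_gt0// mulr_gt0.
have ts : t < s.
  rewrite gt_min; apply/orP; left; lra.
have tr : t * `|g| < r.
  apply: (@le_lt_trans _ _ (r / (2 * (`|g| + 1)) * `|g|)).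
    by rewrite ler_wpM2r// ge_min lexx orbT.
  rewrite mulrAC ltr_pdivrMr ?mulr_gt0// ltr_pM2l//.
  have := normr_ge0 g; lra.
have pt : 0 < phi t by apply: hs; rewrite /= sub0r normrN gtr0_norm.
have := hmin (th + t *: - g); rewrite addrAC subrr add0r scalerN normrN normrZ gtr0_norm//.
move=> /(_ tr); rewrite dotBr dotZr => h1.
have := expK_tangent th (- g) (ltW t0); rewrite scalerN dotNr => h2.
have := mulr_gt0 t0 pt; rewrite /phi mulrBr.
move: h1 h2; rewrite mulrN.
move: (expK th) (expK _) (dot tau th) (t * dot tau g) (t * dot (gradK _) g).
by clear => *; lra.
Qed.

(** Chosen so that [N |tau - tau0| < eta / 4]: the gain from strong convexity on the unit sphere
    then beats the linear perturbation, [N] being the constant of [norm_dot]. *)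
Definition inverse_radius : R := eta / (4 * (N%:R + 1)).
Local Notation rad := inverse_radius.

Lemma inverse_radius_gt0 : 0 < rad.
Proof. by rewrite divr_gt0 ?expR_gt0// mulr_gt0// ltr_wpDl. Qed.

Lemma gradK_lipschitz_inv th th' : `|th - th0| <= 1 -> `|th' - th0| <= 1 ->
  `|th - th'| <= N%:R / eta * `|gradK th - gradK th'|.
Proof.
move=> h h'; have := gradK_strong_monotone h h'.
have := le_trans (ler_norm _) (norm_dot (gradK th - gradK th') (th - th')).
have := dotxx_ge (th - th'); rewrite -(ler_pM2l (expR_gt0 (- exp_radius))).
move=> h1 h2 h3; have {h1 h2 h3} := le_trans h1 (le_trans h3 h2).
have [->|d0] := eqVneq `|th - th'| 0.
  by move=> _; rewrite mulr_ge0// divr_ge0// ltW// expR_gt0.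
have {}d0 : 0 < `|th - th'| by rewrite lt_neqAle eq_sym d0 normr_ge0.
rewrite expr2 mulrA ler_pM2r// => h1.
by rewrite mulrAC ler_pdivlMr ?expR_gt0// mulrC.
Qed.

(** [expK - dot tau] has a minimizer on the closed unit ball, a product of segments in the sup norm.
    On the sphere its value exceeds that at [th0], so the minimizer is interior, hence critical. *)
Lemma gradK_local_surj tau : `|tau - tau0| < rad ->
  exists2 th, `|th - th0| <= 1 & gradK th = tau.
Proof.
move=> htau.
pose I i : set R := `[th0 ord0 i - 1, th0 ord0 i + 1]%classic.
pose A := [set th : 'rV[R]_N | forall i, I i (th ord0 i)].
have AE th : A th <-> `|th - th0| <= 1.
  split=> [Ath|hth i]; last first.
    have := le_trans (coord_le_norm (th - th0) ord0 i) hth.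
    rewrite !mxE /I /= in_itv/= ler_norml => /andP[h1 h2].
    by apply/andP; split; lra.
  have [->//|n0] := eqVneq `|th - th0| 0.
  have [[i0 i] /= e] := mx_norm_neq0 n0.
  rewrite {1}/Num.norm /= e (ord1 i0) !mxE; have := Ath i; rewrite /I /= in_itv/= ler_norml.
  by move=> /andP[h1 h2]; apply/andP; split; lra.
have cA : compact A.
  by apply: (@rV_compact _ _ I) => i; exact: segment_compact.
have A0 : A th0 by apply/AE; rewrite subrr normr0.
have fc : {within A, continuous (fun th => expK th - dot tau th)}.
  apply: continuous_subspaceT => th; apply: continuousB; first exact: expK_continuous.
  exact: dot_continuous.
have [th thA thmin] := EVT_min_rV (ex_intro _ th0 A0) cA fc.
have {thA}hth : `|th - th0| <= 1 by apply/AE; rewrite inE in thA.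
exists th => //.
have hlt : `|th - th0| < 1.
  rewrite lt_neqAle hth andbT; apply/eqP => h1.
  have := thmin th0; rewrite inE => /(_ A0) hm.
  have := expK_strong_convex hth.
  have := dotxx_ge (th - th0); rewrite h1 expr1n => hd.
  have := le_trans (ler_norm _) (norm_dot (tau - tau0) (th - th0)).
  rewrite h1 mulr1 dotBl (dotBr tau) => hn.
  have eta0 := expR_gt0 (- exp_radius).
  have hN : N%:R * `|tau - tau0| < eta / 4.
    apply: (@le_lt_trans _ _ (N%:R * rad)); first by rewrite ler_wpM2l// ltW.
    have N1 : 0 < N%:R + 1 :> R by rewrite ltr_wpDl.
    rewrite /inverse_radius mulrA ltr_pdivrMr ?mulr_gt0//.
    have -> : eta / 4 * (4 * (N%:R + 1)) = N%:R * eta + eta by field.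
    by rewrite ltrDl.
  have : eta / 4 <= eta / 4 * dot (th - th0) (th - th0).
    by rewrite ler_peMr// divr_ge0// ltW.
  move: hm hn hN; move: (dot _ _) (eta / 4) => *; lra.
apply: (@local_min_gradK _ _ (1 - `|th - th0|)); first by rewrite subr_gt0.
move=> th' hth'; apply: thmin; rewrite inE; apply/AE.
rewrite -(subrK th th') -addrA (le_trans (ler_normD _ _))//.
by rewrite -lerBrDr ltW.
Qed.
End ExpFamily.

(** * The local inverse of the gradient map *)

Lemma scalar_near (R : realType) (f : R -> R) (x df : R) : is_derive x 1 f df ->
  forall e, 0 < e -> \forall y \near x, `|f y - f x - df * (y - x)| <= e * `|y - x|.
Proof.
move=> [fx fdf] e e0; have dx : differentiable f x by exact/derivable1_diffP.
have := differentiable_near dx e0.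
have -> : 'd f x = (fun h => h * df) :> (R -> R).
  by rewrite diff1E// derive1E fdf.
by apply: filterS => y; rewrite (mulrC df).
Qed.

Section Inverse.
Variables (R : realType) (N : nat) (E : finType) (c : E -> R) (m : E -> 'rV[R]_N).
Hypothesis c0 : forall e, 0 <= c e.
Hypothesis coercive : forall h, dot h h <= \sum_e c e * dot (m e) h ^+ 2.
Implicit Types th h v tau : 'rV[R]_N.
Local Notation gradK := (gradK c m).
Local Notation hessK := (hessK c m).
Variable th0 : 'rV[R]_N.
Local Notation tau0 := (gradK th0).
Local Notation eta := (expR (- exp_radius m th0)).
Local Notation rad := (inverse_radius m th0).

Lemma gradK_near e : 0 < e ->
  \forall th \near th0, `|gradK th - tau0 - hessK th0 (th - th0)| <= e * `|th - th0|.
Proof.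
move=> e0; pose S := \sum_i c i * `|m i| * (N%:R * `|m i|).
have S0 : 0 <= S by apply: sumr_ge0 => i _; rewrite !mulr_ge0.
have e'0 : 0 < e / (S + 1) by rewrite divr_gt0// ltr_wpDl.
pose P (i : E) th := `|expR (dot (m i) th) - expR (dot (m i) th0)
    - expR (dot (m i) th0) * (dot (m i) th - dot (m i) th0)|
    <= e / (S + 1) * `|dot (m i) th - dot (m i) th0|.
have hP i : \forall th \near th0, P i th.
  exact: (dot_continuous (u := m i) (scalar_near (is_derive_expR (dot (m i) th0)) e'0)).
apply: (filterS _ (@filter_forall _ E P (nbhs th0) _ hP)) => th hth.
have -> : gradK th - tau0 - hessK th0 (th - th0) = \sum_i (c i *
    (expR (dot (m i) th) - expR (dot (m i) th0)
    - expR (dot (m i) th0) * (dot (m i) th - dot (m i) th0))) *: m i.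
  rewrite -!sumrB; apply: eq_bigr => i _.
  by rewrite -!scalerBl dotBr; congr (_ *: _); ring.
apply: le_trans (ler_norm_sum _ _ _) _.
apply: (@le_trans _ _ (\sum_i (c i * `|m i| * (N%:R * `|m i|)) * (e / (S + 1) * `|th - th0|))).
  apply: ler_sum => i _; rewrite normrZ normrM (ger0_norm (c0 i)).
  rewrite mulrAC -(mulrA (c i * `|m i|)) ler_wpM2l ?mulr_ge0//.
  apply: le_trans (hth i) _; rewrite mulrCA ler_wpM2l ?(ltW e'0)//.
  by rewrite -dotBr norm_dot.
rewrite -mulr_suml -/S mulrA ler_wpM2r// mulrA ler_pdivrMr ?ltr_wpDl//.
rewrite mulrDr mulr1 mulrC lerDl ltW//.
Qed.

Definition hess_mx : 'M[R]_N :=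
  \sum_i (c i * expR (dot (m i) th0)) *: ((m i)^T *m m i).

Lemma hess_mxE h : h *m hess_mx = hessK th0 h.
Proof.
rewrite /hess_mx mulmx_sumr; apply: eq_bigr => i _.
rewrite -scalemxAr mulmxA; have -> : h *m (m i)^T = (dot (m i) h)%:M.
  apply/rowP => j; rewrite !mxE (ord1 j) eqxx mulr1n dotC.
  by apply: eq_bigr => l _; rewrite !mxE.
by rewrite mul_scalar_mx scalerA.
Qed.

Lemma hess_mx_unit : hess_mx \in unitmx.
Proof.
rewrite -row_free_unit; apply: inj_row_free => v; rewrite hess_mxE => v0.
apply: dotxx_eq0; apply/eqP; rewrite eq_le dotxx_ge0 andbT.
have h0 : `|th0 - th0| <= 1 by rewrite subrr normr0.
have : eta * dot v v <= \sum_e c e * (expR (dot (m e) th0) * dot (m e) v ^+ 2).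
  apply: (@le_trans _ _ (\sum_e c e * (eta * dot (m e) v ^+ 2))).
    under eq_bigr do rewrite mulrCA.
    by rewrite -mulr_sumr ler_pM2l ?expR_gt0.
  apply: ler_sum => e _; rewrite ler_wpM2l// ler_wpM2r ?sqr_ge0// ler_expR.
  exact: dot_exp_radius.
have -> : \sum_e c e * (expR (dot (m e) th0) * dot (m e) v ^+ 2) = dot (hessK th0 v) v.
  by rewrite dot_suml; apply: eq_bigr => e _; rewrite dotZl; ring.
by rewrite v0 -(scale0r 0) dotZl mul0r pmulr_rle0 ?expR_gt0.
Qed.

Definition local_inv tau : 'rV[R]_N :=
  if pselect (exists2 th, `|th - th0| <= 1 & gradK th = tau) is left h
  then s2val (cid2 h) else th0.

Lemma local_invP tau : `|tau - tau0| < rad ->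
  `|local_inv tau - th0| <= 1 /\ gradK (local_inv tau) = tau.
Proof.
move=> /(gradK_local_surj c0 coercive) ex; rewrite /local_inv.
by case: pselect => // h; case: cid2.
Qed.

Lemma local_inv_lipschitz tau tau' : `|tau - tau0| < rad -> `|tau' - tau0| < rad ->
  `|local_inv tau - local_inv tau'| <= N%:R / eta * `|tau - tau'|.
Proof.
move=> /local_invP[h1 e1] /local_invP[h1' e1'].
by have := gradK_lipschitz_inv c0 coercive h1 h1'; rewrite e1 e1'.
Qed.

Lemma tau0_near : `|tau0 - tau0| < rad.
Proof. by rewrite subrr normr0 inverse_radius_gt0. Qed.

Lemma local_inv0 : local_inv tau0 = th0.
Proof.
have [h1 h2] := local_invP tau0_near.
have h0 : `|th0 - th0| <= 1 by rewrite subrr normr0.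
have := gradK_lipschitz_inv c0 coercive h1 h0.
rewrite h2 subrr normr0 mulr0 normr_le0 subr_eq0; exact/eqP.
Qed.

Let dinv : {linear 'rV[R]_N -> 'rV[R]_N} := mulmxr (invmx hess_mx).

Let dinv_continuous : continuous dinv. Proof. exact: mulmxr_continuous. Qed.

(** Applying the inverse Hessian to the expansion of [gradK] at [th0] leaves a remainder small
    compared with the increment of [local_inv], hence, by its Lipschitz bound, with [tau - tau0]. *)
Lemma local_inv_diff : differentiable local_inv tau0 /\
  forall w, hessK th0 ('d local_inv tau0 w) = w.
Proof.
have [|dl dE] := @differentiable_eps _ _ _ local_inv tau0 dinv dinv_continuous.
  move=> e e0; have [C C0 hC] := linear_lipschitz dinv_continuous.
  set M := N%:R / eta; have M0 : 0 <= M by rewrite divr_ge0// ltW// expR_gt0.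
  have e'0 : 0 < e / (C * (M + 1)) by rewrite divr_gt0// mulr_gt0// ltr_wpDl.
  have /nbhs_normP[s /= s0 hs] := gradK_near e'0.
  apply/nbhs_normP; exists (Num.min rad (s / (M + 1))).
    by rewrite /= lt_min inverse_radius_gt0 divr_gt0// ltr_wpDl.
  move=> tau /=; rewrite distrC lt_min => /andP[tr ts].
  have [h1 h2] := local_invP tr.
  rewrite local_inv0; set z := local_inv tau - th0.
  have hz : `|z| <= M * `|tau - tau0|.
    by have := local_inv_lipschitz tr tau0_near; rewrite local_inv0.
  have zs : `|z| < s.
    apply: (le_lt_trans hz); apply: (@le_lt_trans _ _ ((M + 1) * `|tau - tau0|)).
      by rewrite ler_wpM2r// lerDl.
    by rewrite mulrC -ltr_pdivlMr// ltr_wpDl.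
  have := hs (local_inv tau); rewrite /= distrC => /(_ zs); rewrite h2 -/z => hrem.
  have -> : z - dinv (tau - tau0) = - dinv (tau - tau0 - hessK th0 z).
    rewrite [in RHS]raddfB/= opprB; congr (_ - _).
    by rewrite -hess_mxE -mulmxA mulmxV ?hess_mx_unit// mulmx1.
  rewrite normrN; apply: le_trans (hC _) _.
  apply: (@le_trans _ _ (C * (e / (C * (M + 1)) * (M * `|tau - tau0|)))).
    rewrite ler_pM2l//; apply: le_trans hrem _; rewrite ler_wpM2l// ltW//.
  have -> : C * (e / (C * (M + 1)) * (M * `|tau - tau0|)) = e * (M / (M + 1)) * `|tau - tau0|.
    by field; rewrite !gt_eqF// ltr_wpDl.
  by rewrite ler_wpM2r// ler_piMr ?(ltW e0)// ler_pdivrMr ?ltr_wpDl// mul1r lerDl.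
split=> // w; rewrite dE /= -hess_mxE -mulmxA mulVmx ?hess_mx_unit ?mulmx1//.
Qed.
End Inverse.

(** * The Legendre transform *)

Lemma dot_is_linear (R : realType) (N : nat) (u : 'rV[R]_N) : linear (dot u).
Proof. by move=> t v w; rewrite dotDr dotZr. Qed.

HB.instance Definition _ (R : realType) (N : nat) (u : 'rV[R]_N) :=
  GRing.isLinear.Build R 'rV[R]_N R _ (dot u) (dot_is_linear u).

Lemma near_eq_diff (R : realType) (V W : normedModType R) (f g : V -> W) (x : V) :
  (\forall y \near x, f y = g y) -> differentiable f x ->
  differentiable g x /\ 'd g x = 'd f x :> (V -> W).
Proof.
move=> fg fd; apply: differentiable_eps; first exact: diff_continuous.
move=> e e0; have fgx := nbhs_singleton fg.
apply: filterS2 fg (differentiable_near fd e0) => y <- h.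
by rewrite -fgx.
Qed.

Lemma scalar_comp_diff (R : realType) (V : normedModType R) (f : R -> R) (g : V -> R)
    (x : V) (df : R) : differentiable g x -> is_derive (g x) 1 f df ->
  differentiable (fun y => f (g y)) x /\
  forall v, 'd (fun y => f (g y)) x v = df * 'd g x v.
Proof.
move=> gd [fx fdf]; have fd : differentiable f (g x) by exact/derivable1_diffP.
split; first exact: differentiable_comp.
move=> v; have -> : (fun y => f (g y)) = f \o g by [].
by rewrite diff_comp//= diff1E// derive1E fdf mulrC.
Qed.

Lemma addcst_diff (R : realType) (V : normedModType R) (f : V -> R) (k : R) (x : V) :
  differentiable f x -> differentiable (fun y => f y + k) x /\
  forall v, 'd (fun y => f y + k) x v = 'd f x v.
Proof.
move=> fd; have -> : (fun y => f y + k) = f + cst k by [].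
have cd := differentiable_cst k x.
split=> [|v]; first exact: differentiableD fd cd.
have e1 := congr1 (fun F : V -> R => F v) (diffD fd cd).
have e2 := congr1 (fun F : V -> R => F v) (diff_cst k x : 'd (cst k) x = 0 :> (V -> R)).
by apply: etrans e1 _; apply: etrans (congr1 (+%R _) e2) _; exact: addr0.
Qed.

Lemma lincomb_diff (R : realType) (V : normedModType R) (f g : V -> R) (a b : R) (x : V) :
  differentiable f x -> differentiable g x ->
  differentiable (fun y => a * f y + b * g y) x /\
  forall v, 'd (fun y => a * f y + b * g y) x v = a * 'd f x v + b * 'd g x v.
Proof.
move=> fd gd; have -> : (fun y => a * f y + b * g y) = a *: f + b *: g by [].
have af := differentiableZ a fd; have bg := differentiableZ b gd.
split=> [|v]; first exact: differentiableD af bg.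
have e1 := congr1 (fun F : V -> R => F v) (diffZ a fd).
have e2 := congr1 (fun F : V -> R => F v) (diffZ b gd).
have e3 := congr1 (fun F : V -> R => F v) (diffD af bg).
exact: etrans e3 (congr2 +%R e1 e2).
Qed.

Lemma xlnx_is_derive (R : realType) (x : R) : 0 < x -> is_derive x 1 (@xlnx R) (ln x + 1).
Proof.
move=> x0; have lnx := is_derive1_ln x0.
have dl : is_derive x 1 (fun y : R => y * ln y) (ln x + 1).
  apply: (is_derive_eq (is_deriveM (is_derive_id x 1) lnx)).
  by rewrite /GRing.scale/= mulfV ?gt_eqF// mulr1 addrC.
apply: near_eq_is_derive dl.
have /nbhs_normP[r /= r0 hr] := lt_nbhsr x0.
apply/nbhs_normP; exists r => // y /hr y0.
by rewrite /xlnx gt_eqF.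
Qed.

Section Value.
Variables (R : realType) (N : nat) (E : finType) (c : E -> R) (m : E -> 'rV[R]_N).
Hypothesis c0 : forall e, 0 <= c e.
Hypothesis coercive : forall h, dot h h <= \sum_e c e * dot (m e) h ^+ 2.
Implicit Types th h v tau : 'rV[R]_N.
Local Notation expK := (expK c m).
Local Notation gradK := (gradK c m).
Local Notation hessK := (hessK c m).
Variable th0 : 'rV[R]_N.
Local Notation tau0 := (gradK th0).
Local Notation eta := (expR (- exp_radius m th0)).
Local Notation rad := (inverse_radius m th0).
Local Notation theta := (local_inv c m th0).

Lemma expK_ge_tangent th th' : expK th' + dot (gradK th') (th - th') <= expK th.
Proof.
rewrite -lerBrDl dot_gradK -sumrB; apply: ler_sum => e _.
by rewrite -mulrBr -mulrA ler_wpM2l// dotBr expR_tangent.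
Qed.

(* Minus the Legendre transform of [expK]. *)
Definition dualK tau : R := expK (theta tau) - dot tau (theta tau).

Lemma dualK_le tau tau' : `|tau - tau0| < rad ->
  dualK tau <= expK (theta tau') - dot tau (theta tau').
Proof.
move=> h; have [_ e] := local_invP c0 coercive h.
have := expK_ge_tangent (theta tau') (theta tau); rewrite e dotBr /dualK; lra.
Qed.

Lemma rad_near tau : `|tau - tau0| < rad -> \forall tau' \near tau, `|tau' - tau0| < rad.
Proof.
move=> h; apply/nbhs_normP; exists (rad - `|tau - tau0|); first by rewrite /= subr_gt0.
move=> tau' /=; rewrite ltrBrDr distrC => h'.
by rewrite -(subrK tau tau') -addrA (le_lt_trans (ler_normD _ _)).
Qed.

(** Envelope argument: comparing the minima at [tau] and [tau'] both ways traps the increment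
    between [- dot (theta tau') (tau' - tau)] and [- dot (theta tau) (tau' - tau)]. Their difference
    is quadratic because [theta] is Lipschitz. *)
Lemma dualK_diff tau : `|tau - tau0| < rad ->
  differentiable dualK tau /\ forall h, 'd dualK tau h = - dot (theta tau) h.
Proof.
move=> htau; set M := N%:R * (N%:R / eta).
have M0 : 0 <= M by rewrite mulr_ge0// divr_ge0// ltW// expR_gt0.
have [|e e0|dd dE] := @differentiable_eps _ _ _ dualK tau (dot (- theta tau)).
- exact: dot_continuous.
- have r0 : 0 < e / (M + 1) by rewrite divr_gt0// ltr_wpDl.
  have near_r : \forall tau' \near tau, `|tau' - tau| < e / (M + 1).
    by apply/nbhs_normP; exists (e / (M + 1)) => // y /=; rewrite distrC.
  apply: filterS2 (rad_near htau) near_r => tau' htau' hr.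
  have h1 := dualK_le tau' htau; have h2 := dualK_le tau htau'.
  have h3 := local_inv_lipschitz c0 coercive htau' htau.
  have h4 := norm_dot (theta tau' - theta tau) (tau' - tau).
  have h5 : `|dot (theta tau' - theta tau) (tau' - tau)| <= e * `|tau' - tau|.
    apply: le_trans h4 _; rewrite ler_wpM2r//.
    apply: (@le_trans _ _ (N%:R * (N%:R / eta * `|tau' - tau|))).
      by rewrite ler_wpM2l.
    rewrite mulrA -/M; apply: (@le_trans _ _ (M * (e / (M + 1)))).
      by rewrite ler_wpM2l// ltW.
    have -> : M * (e / (M + 1)) = e * (M / (M + 1)).
      by field; rewrite gt_eqF// ltr_wpDl.
    by rewrite ler_piMr ?(ltW e0)// ler_pdivrMr ?ltr_wpDl// mul1r lerDl.
  apply: le_trans h5; rewrite -[X in `|_ - X|]/(dot (- theta tau) (tau' - tau)).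
  rewrite dotNl opprK.
  have hub : dualK tau' - dualK tau + dot (theta tau) (tau' - tau) <= 0.
    by move: h2; rewrite /dualK dotBr !(dotC (theta tau)); lra.
  rewrite ler0_norm// ler_normr; apply/orP; left.
  move: h1; rewrite /dualK dotBl !dotBr !(dotC (theta _)); lra.
- by split=> // h; rewrite dE /= dotNl.
Qed.

Variables (A0 A1 A2 : R).

(** With [A0 = 3], [A1 = Delta - 1] and [A2 = Delta] this is [Psi1] near the phase. *)
Definition primal tau : R := A1 * \sum_i xlnx (tau ord0 i) + A2 * (dualK tau - A0).
Definition grad_primal v tau : R :=
  A1 * \sum_i (ln (tau ord0 i) + 1) * v ord0 i - A2 * dot (theta tau) v.

Lemma coord_diff tau i : differentiable (fun t : 'rV[R]_N => t ord0 i) tau /\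
  forall h, 'd (fun t : 'rV[R]_N => t ord0 i) tau h = h ord0 i.
Proof.
split; first exact: differentiable_coord.
have dE : (fun t : 'rV[R]_N => t ord0 i) = dot (delta_mx ord0 i).
  by apply/funext => t; rewrite dot_delta.
move=> h; rewrite -[RHS]/((fun t : 'rV[R]_N => t ord0 i) h) dE diff_lin//.
exact: dot_continuous.
Qed.

Lemma primal_diff tau : `|tau - tau0| < rad -> (forall i, 0 < tau ord0 i) ->
  differentiable primal tau /\ forall h, 'd primal tau h = grad_primal h tau.
Proof.
move=> htau t0; have [d1 d1E] := dualK_diff htau.
pose F i (t : 'rV[R]_N) := xlnx (t ord0 i).
have Fd i : differentiable (F i) tau /\
    forall v, 'd (F i) tau v = (ln (tau ord0 i) + 1) * v ord0 i.
  have [cd cE] := coord_diff tau i.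
  have [h1 h2] := scalar_comp_diff cd (xlnx_is_derive (t0 i)).
  by split; [exact: h1|move=> v; rewrite /F h2 cE].
have [d2 d2E] := sum_differentiable (index_enum _) (fun i => (Fd i).1).
have [d3 d3E] := addcst_diff (- A0) d1.
have [d4 d4E] := lincomb_diff A1 A2 d2 d3.
split=> [|h]; first exact: d4.
apply: etrans (d4E h) _; rewrite d3E d1E d2E /grad_primal mulrN; congr (_ * _ - _).
by apply: eq_bigr => i _; rewrite (Fd i).2.
Qed.

Lemma grad_primal_diff v : (forall i, 0 < tau0 ord0 i) ->
  differentiable (grad_primal v) tau0 /\
  forall h, 'd (grad_primal v) tau0 h =
    A1 * (\sum_i h ord0 i / tau0 ord0 i * v ord0 i) - A2 * dot ('d theta tau0 h) v.
Proof.
move=> t0; have [d1 _] := local_inv_diff c0 coercive th0.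
pose F i (t : 'rV[R]_N) := v ord0 i * (ln (t ord0 i) + 1).
have Fd i : differentiable (F i) tau0 /\
    forall h, 'd (F i) tau0 h = h ord0 i / tau0 ord0 i * v ord0 i.
  have [cd cE] := coord_diff tau0 i.
  have [h1 h2] := scalar_comp_diff cd (is_derive1_ln (t0 i)).
  have [h3 h4] := addcst_diff 1 h1.
  have [h5 h6] := lincomb_diff (v ord0 i) 0 h3 (differentiable_cst 0 _).
  have -> : F i = fun t => v ord0 i * (ln (t ord0 i) + 1) + 0 * cst 0 t.
    by apply/funext => t; rewrite /F mul0r addr0.
  split=> [|h]; first exact: h5.
  by apply: etrans (h6 h) _; rewrite h4 h2 cE mul0r addr0 mulrC (mulrC (_^-1)).
have ld : differentiable (dot v) (theta tau0).
  by apply: linear_differentiable; exact: dot_continuous.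
have dv : differentiable (dot v \o theta) tau0 by exact: differentiable_comp.
have dvE h : 'd (dot v \o theta) tau0 h = dot v ('d theta tau0 h).
  by rewrite diff_comp// [LHS]/= diff_lin//; exact: dot_continuous.
have [d2 d2E] := sum_differentiable (index_enum _) (fun i => (Fd i).1).
have [d4 d4E] := lincomb_diff A1 (- A2) d2 dv.
have E1 : grad_primal v = fun t => A1 * (\sum_i F i t) + (- A2) * (dot v \o theta) t.
  apply/funext => t; rewrite /grad_primal mulNr /= dotC; congr (_ * _ - _).
  by apply: eq_bigr => i _; rewrite /F mulrC.
rewrite E1; split=> [|h]; first exact: d4.
apply: etrans (d4E h) _; rewrite dvE d2E mulNr dotC; congr (_ * _ - _).
by apply: eq_bigr => i _; rewrite (Fd i).2.
Qed.
End Value.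

(** * The Potts model as a sum of exponentials *)

Section PottsFamily.
Variables (R : realType) (q : nat) (B : R).
Hypotheses (B0 : 0 <= B) (q3 : (3 <= q)%N).
Implicit Types th h tau : 'rV[R]_(q + q).

Definition pedge : finType := ('I_q * 'I_q + bool)%type.

Definition pweight (e : pedge) : R :=
  match e with inl ij => potts_mx q B ij.1 ij.2 | inr _ => 1 end.

(* The two boolean edges fix the invariance of [u i + v j] under
   [(u + t, v - t)]. *)
Definition pdir (e : pedge) : 'rV[R]_(q + q) :=
  match e with
  | inl ij => delta_mx ord0 (lshift q ij.1) + delta_mx ord0 (rshift q ij.2)
  | inr b => (-1) ^+ b *: row_mx (const_mx 1) (const_mx (-1))
  end.

Definition gauge th : R := \sum_i th ord0 (lshift q i) - \sum_i th ord0 (rshift q i).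

Lemma dot_split th h : dot th h =
  \sum_i th ord0 (lshift q i) * h ord0 (lshift q i) +
  \sum_i th ord0 (rshift q i) * h ord0 (rshift q i).
Proof. exact: big_split_ord. Qed.

Lemma dot_pdir_inl i j th :
  dot (pdir (inl (i, j))) th = th ord0 (lshift q i) + th ord0 (rshift q j).
Proof. by rewrite /= dotDl !dot_delta. Qed.

Lemma dot_pdir_inr b th : dot (pdir (inr b)) th = (-1) ^+ b * gauge th.
Proof.
rewrite /= dotZl dot_split; congr (_ * _); rewrite /gauge -sumrN; congr (_ + _).
  by apply: eq_bigr => i _; rewrite row_mxEl mxE mul1r.
by apply: eq_bigr => i _; rewrite row_mxEr mxE mulN1r.
Qed.

Lemma sum_pedge (V : zmodType) (F : pedge -> V) :
  \sum_e F e = \sum_i \sum_j F (inl (i, j)) + (F (inr true) + F (inr false)).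
Proof.
rewrite big_sumType/= big_bool; congr (_ + _).
by rewrite pair_bigA; apply: eq_bigr => -[].
Qed.

Lemma pweight_ge0 e : 0 <= pweight e.
Proof. by case: e => [ij|b] //=; exact: potts_ge0. Qed.

(** The diagonal is dropped, since [B] may be 0. The other pairs give at least
    [(q-2) (U2 + V2) + 2 U V] and the boolean edges [2 (U - V)^2]. The terms in [U, V] add up to
    [U^2 + V^2 + (U - V)^2], and [q >= 3] leaves the constant 1. *)
Lemma pdir_coercive h : dot h h <= \sum_e pweight e * dot (pdir e) h ^+ 2.
Proof.
rewrite sum_pedge !dot_pdir_inr ![(_ * gauge h) ^+ 2]exprMn !sqrr_sign !mul1r dot_split.
pose u i := h ord0 (lshift q i); pose v i := h ord0 (rshift q i).
pose U := \sum_i u i; pose V := \sum_i v i.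
pose U2 := \sum_i u i * u i; pose V2 := \sum_i v i * v i.
have gE : gauge h = U - V by [].
rewrite gE -/U2 -/V2.
have le1 : \sum_i (\sum_j (u i + v j) ^+ 2 - (u i + v i) ^+ 2) <=
    \sum_i \sum_j potts_mx q B i j * dot (pdir (inl (i, j))) h ^+ 2.
  apply: ler_sum => i _; rewrite (bigD1 i)//= addrAC subrr add0r [leRHS](bigD1 i)//=.
  apply: ler_wpDl; first by rewrite mulr_ge0 ?sqr_ge0 ?potts_ge0.
  apply: ler_sum => j ji; rewrite mxE eq_sym (negbTE ji) mul1r.
  by have /= -> := dot_pdir_inl i j h.
have e1 : \sum_i (\sum_j (u i + v j) ^+ 2 - (u i + v i) ^+ 2) =
    q%:R * U2 + q%:R * V2 + 2 * (U * V) - \sum_i (u i + v i) ^+ 2.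
  rewrite sumrB; congr (_ - _).
  transitivity (\sum_i (q%:R * (u i * u i) + V2 + 2 * (u i * V))).
    apply: eq_bigr => i _.
    transitivity (\sum_j (u i * u i + v j * v j + 2 * (u i * v j))).
      by apply: eq_bigr => j _; ring.
    rewrite !big_split/= -!mulr_sumr sumr_const card_ord -(mulr_natl (u i)).
    by rewrite -/V -/V2; ring.
  rewrite !big_split/= -!mulr_sumr -mulr_suml sumr_const card_ord.
  by rewrite -(mulr_natl V2).
have le2 : \sum_i (u i + v i) ^+ 2 <= 2 * (U2 + V2).
  rewrite /U2 /V2 -big_split mulr_sumr; apply: ler_sum => i _ /=.
  have := sqr_ge0 (u i - v i); rewrite !expr2; lra.
have q3' : 3 <= q%:R :> R by rewrite ler_nat.
have U20 : 0 <= U2 by apply: sumr_ge0 => i _; rewrite -expr2 sqr_ge0.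
have V20 : 0 <= V2 by apply: sumr_ge0 => i _; rewrite -expr2 sqr_ge0.
rewrite e1 in le1; apply: le_trans (lerD le1 (lexx _)).
have m1 : 3 * (U2 + V2) <= q%:R * (U2 + V2) by rewrite ler_wpM2r// addr_ge0.
have p1 := sqr_ge0 U; have p2 := sqr_ge0 V; have p3 := sqr_ge0 (U - V).
have p4 : 0 <= (U - V) ^+ 2 + (U - V) ^+ 2 + 2 * (U * V).
  have -> : (U - V) ^+ 2 + (U - V) ^+ 2 + 2 * (U * V) = U ^+ 2 + V ^+ 2 + (U - V) ^+ 2 by ring.
  by rewrite !addr_ge0.
move: le2 m1 p4; rewrite !mulrDr; move: (\sum_i _) (q%:R * U2) (q%:R * V2) (2 * (U * V)).
by move: ((U - V) ^+ 2) => *; lra.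
Qed.

Definition pvec (a : pedge -> R) : 'rV[R]_(q + q) := \sum_e a e *: pdir e.

Lemma pdir_inr_l b i : pdir (inr b) ord0 (lshift q i) = (-1) ^+ b.
Proof. by rewrite /= mxE row_mxEl mxE mulr1. Qed.

Lemma pdir_inr_r b i : pdir (inr b) ord0 (rshift q i) = - (-1) ^+ b.
Proof. by rewrite /= mxE row_mxEr mxE mulrN1. Qed.

Lemma pvec_l a i : pvec a ord0 (lshift q i) =
  \sum_j a (inl (i, j)) + (a (inr false) - a (inr true)).
Proof.
rewrite /pvec summxE sum_pedge.
have -> : \sum_i0 \sum_j (a (inl (i0, j)) *: pdir (inl (i0, j))) ord0 (lshift q i) =
    \sum_j a (inl (i, j)).
  rewrite (bigD1 i)//= [X in _ + X]big1 ?addr0 => [|i' i'i].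
    by apply: eq_bigr => j _; rewrite !mxE !eqxx eq_lrshift addr0 mulr1.
  rewrite big1// => j _; rewrite !mxE eq_lrshift (inj_eq (@lshift_inj _ _)).
  by rewrite eq_sym (negbTE i'i) andbF addr0 mulr0.
rewrite ![(_ *: pdir (inr _)) _ _]mxE !pdir_inr_l expr1 expr0; ring.
Qed.

Lemma pvec_r a j : pvec a ord0 (rshift q j) =
  \sum_i a (inl (i, j)) - (a (inr false) - a (inr true)).
Proof.
rewrite /pvec summxE sum_pedge.
have -> : \sum_i \sum_j0 (a (inl (i, j0)) *: pdir (inl (i, j0))) ord0 (rshift q j) =
    \sum_i a (inl (i, j)).
  rewrite exchange_big (bigD1 j)//= [X in _ + X]big1 ?addr0 => [|j' j'j].
    by apply: eq_bigr => i _; rewrite !mxE !eqxx eq_rlshift add0r mulr1.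
  rewrite big1// => i _; rewrite !mxE eq_rlshift (inj_eq (@rshift_inj _ _)).
  by rewrite eq_sym (negbTE j'j) andbF add0r mulr0.
rewrite ![(_ *: pdir (inr _)) _ _]mxE !pdir_inr_r expr1 expr0; ring.
Qed.

(** The boolean edges point in opposite directions, so only the difference of their weights moves
    the row and column totals apart. On balanced marginals they cancel and leave the Potts sums. *)
Lemma pvec_balanced a : gauge (pvec a) = 0 -> a (inr false) = a (inr true).
Proof.
rewrite /gauge; under eq_bigr do rewrite pvec_l.
under [X in _ - X]eq_bigr do rewrite pvec_r.
rewrite sumrB big_split/= [X in _ - (X - _)]exchange_big/= sumr_const card_ord.
move=> e; apply/eqP; rewrite -subr_eq0; move: e.
set D := a _ - a _; set S := \sum_i _ => e.
have : D *+ q + D *+ q = 0 by move: e; lra.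
rewrite -mulrnDr => /eqP; rewrite mulrn_eq0 addn_eq0 andbb.
by case/orP => // /eqP q0; move: q3; rewrite q0.
Qed.

Lemma gradK_pvec th : gradK pweight pdir th = pvec (fun e => pweight e * expR (dot (pdir e) th)).
Proof. by []. Qed.

Lemma hessK_pvec th h : hessK pweight pdir th h =
  pvec (fun e => pweight e * expR (dot (pdir e) th) * dot (pdir e) h).
Proof. by []. Qed.

Local Notation rho th := (fun i => expR (th ord0 (lshift q i))).
Local Notation gam th := (fun j => expR (th ord0 (rshift q j))).

Lemma expR_pdir i j th : pweight (inl (i, j)) * expR (dot (pdir (inl (i, j))) th) =
  potts_mx q B i j * rho th i * gam th j.
Proof. by rewrite dot_pdir_inl expRD mulrA. Qed.

Lemma gradK_gauge th : gauge (gradK pweight pdir th) = 0 -> gauge th = 0.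
Proof.
rewrite gradK_pvec => /pvec_balanced; rewrite !dot_pdir_inr /= !mul1r expr1 mulN1r.
by move/expR_inj => e; lra.
Qed.

Lemma gradK_l th i : gauge (gradK pweight pdir th) = 0 ->
  gradK pweight pdir th ord0 (lshift q i) = \sum_j potts_mx q B i j * rho th i * gam th j.
Proof.
rewrite gradK_pvec => /pvec_balanced e; rewrite pvec_l e subrr addr0.
by apply: eq_bigr => j _; rewrite expR_pdir.
Qed.

Lemma gradK_r th j : gauge (gradK pweight pdir th) = 0 ->
  gradK pweight pdir th ord0 (rshift q j) = \sum_i potts_mx q B i j * rho th i * gam th j.
Proof.
rewrite gradK_pvec => /pvec_balanced e; rewrite pvec_r e subrr subr0.
by apply: eq_bigr => i _; rewrite expR_pdir.
Qed.

(* 3 is the value of [expK] at [th]: the total mass 1 of the coupling, plus 1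
   for each boolean edge. *)
Lemma Psi1_expK (n : nat) th tau : gradK pweight pdir th = tau ->
  \sum_i tau ord0 (lshift q i) = 1 -> \sum_i tau ord0 (rshift q i) = 1 ->
  Psi1 q n.+2 B (lsubmx tau) (rsubmx tau) =
  (n.+1%:R * \sum_i xlnx (tau ord0 i) +
   n.+2%:R * (expK pweight pdir th - dot tau th - 3))%:E.
Proof.
move=> gE t1 t2; have g0 : gauge (gradK pweight pdir th) = 0.
  by rewrite gE /gauge t1 t2 subrr.
have row i : \sum_j potts_mx q B i j * rho th i * gam th j = lsubmx tau ord0 i.
  by rewrite -gradK_l// gE mxE.
have col j : \sum_i potts_mx q B i j * rho th i * gam th j = rsubmx tau ord0 j.
  by rewrite -gradK_r// gE mxE.
rewrite (Psi1_eq_dual n.+2 B0 _ _ row col); [|by move=> i; exact: expR_gt0..].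
congr EFin; rewrite /dual_value.
rewrite (eq_bigr _ (fun i _ => row i)) subrr sub0r big_split_ord/= -natr1 addrK.
congr (_ * (_ + _) + _ * _); try by apply: eq_bigr => i _; rewrite mxE.
have eK : \sum_i \sum_j pweight (inl (i, j)) * expR (dot (pdir (inl (i, j))) th) = 1.
  rewrite -t1; apply: eq_bigr => i _; transitivity (lsubmx tau ord0 i); last by rewrite mxE.
  by rewrite -row; apply: eq_bigr => j _; rewrite expR_pdir.
rewrite /expK sum_pedge eK !dot_pdir_inr (gradK_gauge g0) !mulr0 expR0 /= mulr1 dot_split.
under eq_bigr do rewrite expRK mxE; under [X in _ - X = _]eq_bigr do rewrite expRK mxE.
ring.
Qed.
End PottsFamily.

(** * Restriction to directions of zero sum *)

Section TangentProj.
Variables (R : realType) (q : nat).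
Hypothesis q0 : (0 < q)%N.
Local Notation V := ('rV[R]_q * 'rV[R]_q)%type.

Definition tangent_proj (w : V) : 'rV[R]_(q + q) := row_mx (zsum_proj w.1) (zsum_proj w.2).

Lemma zsum_proj_sum (u : 'rV[R]_q) : \sum_i zsum_proj u ord0 i = 0.
Proof.
rewrite /zsum_proj; under eq_bigr do rewrite mxE.
rewrite sumrB sumr_const card_ord -(mulr_natr (_ / _)) divfK ?subrr//.
by rewrite pnatr_eq0 -lt0n.
Qed.

Lemma zsum_proj_id (u : 'rV[R]_q) : \sum_i u ord0 i = 0 -> zsum_proj u = u.
Proof. by move=> u0; apply/rowP => i; rewrite mxE u0 mul0r subr0. Qed.

Lemma zsum_proj_is_linear : linear (@zsum_proj R q).
Proof.
move=> t u v; apply/rowP => i; rewrite !mxE.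
have -> : \sum_k (t *: u + v) ord0 k = t * \sum_k u ord0 k + \sum_k v ord0 k.
  by rewrite mulr_sumr -big_split; apply: eq_bigr => k _; rewrite !mxE.
ring.
Qed.

Lemma tangent_proj_is_linear : linear tangent_proj.
Proof.
move=> t u v; rewrite /tangent_proj /= !zsum_proj_is_linear.
by rewrite scale_row_mx add_row_mx.
Qed.

HB.instance Definition _ := GRing.isLinear.Build R V 'rV[R]_(q + q) _
  tangent_proj tangent_proj_is_linear.

Lemma norm_zsum_proj (u : 'rV[R]_q) i : `|zsum_proj u ord0 i| <= 2 * `|u|.
Proof.
rewrite mxE; apply: le_trans (ler_normB _ _) _.
rewrite mulr_natl mulr2n lerD ?coord_le_norm// normrM normfV normr_nat.
rewrite ler_pdivrMr ?ltr0n//; apply: le_trans (ler_norm_sum _ _ _) _.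
apply: (@le_trans _ _ (\sum_(k < q) `|u|)).
  by apply: ler_sum => k _; exact: coord_le_norm.
by rewrite sumr_const card_ord -(mulr_natr `|u|).
Qed.

Lemma norm_tangent_proj w : `|tangent_proj w| <= 2 * `|w|.
Proof.
have [->|n0] := eqVneq `|tangent_proj w| 0; first by rewrite mulr_ge0.
have [[i0 k] /= e] := mx_norm_neq0 n0.
rewrite {1}/Num.norm /= e (ord1 i0).
have w1 : `|w.1| <= `|w| by rewrite prod_normE le_max lexx.
have w2 : `|w.2| <= `|w| by rewrite prod_normE le_max lexx orbT.
case: (split_ordP k) => j ->; rewrite ?row_mxEl ?row_mxEr.
  by apply: le_trans (norm_zsum_proj _ _) _; rewrite ler_pM2l.
by apply: le_trans (norm_zsum_proj _ _) _; rewrite ler_pM2l.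
Qed.

Lemma tangent_proj_continuous : continuous tangent_proj.
Proof. exact: lipschitz_linear_continuous norm_tangent_proj. Qed.

Lemma tangent_proj_near w (r : R) : `|tangent_proj w| < r ->
  \forall w' \near w, `|tangent_proj w'| < r.
Proof.
by move=> h; apply: (cvgr_lt _ (cvg_norm (tangent_proj_continuous (x := w)))).
Qed.

Lemma shift_tangent_diff (F : 'rV[R]_(q + q) -> R) tau w :
  differentiable F (tau + tangent_proj w) ->
  differentiable (fun w' => F (tau + tangent_proj w')) w /\
  forall v, 'd (fun w' => F (tau + tangent_proj w')) w v =
            'd F (tau + tangent_proj w) (tangent_proj v).
Proof.
move=> Fd; pose S w' := tau + tangent_proj w'.
have ld : differentiable tangent_proj w.
  exact: linear_differentiable tangent_proj_continuous.
have lE := diff_lin w tangent_proj_continuous.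
have Sd : differentiable S w /\ 'd S w = tangent_proj :> (V -> _).
  apply: differentiable_eps; first exact: tangent_proj_continuous.
  move=> e e0; near=> y; rewrite /S opprD addrACA subrr add0r -raddfB/= subrr normr0.
  by rewrite mulr_ge0// ltW.
have [d1 d1E] := Sd.
have -> : (fun w' => F (tau + tangent_proj w')) = F \o S by [].
split; first exact: differentiable_comp.
move=> v; apply: etrans (congr1 (fun f => f v) (diff_comp d1 Fd)) _.
by rewrite /= d1E.
Unshelve. all: by end_near. Qed.
End TangentProj.

(** * The Hessian at a phase *)

Section PhaseHessian.
Variables (R : realType) (q n : nat) (B : R).
Variables (alpha beta : 'rV[R]_q) (rho gam : 'I_q -> R).
Hypotheses (B0 : 0 <= B) (q3 : (3 <= q)%N).
Hypotheses (rho0 : forall i, 0 < rho i) (gam0 : forall j, 0 < gam j).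
Hypothesis row_eq : forall i, \sum_j potts_mx q B i j * rho i * gam j = alpha ord0 i.
Hypothesis col_eq : forall j, \sum_i potts_mx q B i j * rho i * gam j = beta ord0 j.
Hypotheses (alpha0 : forall i, 0 < alpha ord0 i) (beta0 : forall j, 0 < beta ord0 j).
Hypotheses (alpha1 : \sum_i alpha ord0 i = 1) (beta1 : \sum_j beta ord0 j = 1).
Local Notation x i j := (potts_mx q B i j * rho i * gam j).
(** Negativity of the second derivative in dual variables: [(w1, w2)] is the image of [(f, g)] under
    the Hessian of [expK], so the inverse Hessian need not be written out. *)
Hypothesis curvature : forall f g : 'I_q -> R,
  let w1 i := \sum_j x i j * (f i + g j) in
  let w2 j := \sum_i x i j * (f i + g j) in
  \sum_i w1 i = 0 -> (exists i, w1 i != 0) \/ (exists j, w2 j != 0) ->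
  n.+1%:R * (\sum_i w1 i ^+ 2 / alpha ord0 i + \sum_j w2 j ^+ 2 / beta ord0 j) <
  n.+2%:R * (\sum_i f i * w1 i + \sum_j g j * w2 j).
Hypothesis dominant : dominant_phase q n.+2 B alpha beta.

Local Notation pw := (@pweight R q B).
Local Notation pd := (@pdir R q).
Let pw0 := @pweight_ge0 R q B B0.
Let pco := @pdir_coercive R q B B0 q3.
Let q0 : (0 < q)%N. Proof. exact: leq_trans q3. Qed.

(** Added to [ln rho] and subtracted from [ln gam], it makes the gauge vanish and preserves each
    [rho_i gam_j]. *)
Let shift_ : R := (\sum_j ln (gam j) - \sum_i ln (rho i)) / (q%:R + q%:R).
Let th0 : 'rV[R]_(q + q) :=
  row_mx (\row_i (ln (rho i) + shift_)) (\row_j (ln (gam j) - shift_)).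

Let gauge0 : gauge th0 = 0.
Proof.
rewrite /gauge /th0.
rewrite (eq_bigr (fun i => ln (rho i) + shift_)) => [|i _]; last by rewrite row_mxEl mxE.
rewrite [X in _ - X](eq_bigr (fun i => ln (gam i) - shift_)) => [|i _]; last by rewrite row_mxEr mxE.
rewrite big_split sumrB /= !sumr_const card_ord -!(mulr_natr shift_).
have qn : q%:R + q%:R != 0 :> R by rewrite -natrD pnatr_eq0 -lt0n addn_gt0 q0.
have := divfK qn (\sum_j ln (gam j) - \sum_i ln (rho i)); rewrite -/shift_ mulrDr.
by move: (shift_ * _) => *; lra.
Qed.

Let th0E i j : expR (dot (pd (inl (i, j))) th0) = rho i * gam j.
Proof.
rewrite dot_pdir_inl /th0 row_mxEl row_mxEr !mxE addrACA subrr addr0 expRD.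
by rewrite !lnK// posrE.
Qed.

Local Notation tau0 := (gradK pw pd th0).

Let tau0E : tau0 = row_mx alpha beta.
Proof.
rewrite gradK_pvec; apply/rowP => k; case: (split_ordP k) => i ->.
  rewrite pvec_l row_mxEl !dot_pdir_inr gauge0 !mulr0 subrr addr0 -row_eq.
  by apply: eq_bigr => j _; rewrite th0E mulrA.
rewrite pvec_r row_mxEr !dot_pdir_inr gauge0 !mulr0 subrr subr0 -col_eq.
by apply: eq_bigr => j _; rewrite th0E mulrA.
Qed.

Let tau0_gt0 k : 0 < tau0 ord0 k.
Proof. by rewrite tau0E; case: (split_ordP k) => i ->; rewrite ?row_mxEl ?row_mxEr. Qed.

Let mu_ex : exists2 mu : R, 0 < mu & forall k, mu <= tau0 ord0 k.
Proof.
exists (\big[Num.min/1]_k tau0 ord0 k); first by apply/lt_bigmin.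
by move=> k; exact: bigmin_le.
Qed.

Local Notation V := ('rV[R]_q * 'rV[R]_q)%type.
Local Notation P := (@tangent_proj R q).
Local Notation F := (primal pw pd th0 3 n.+1%:R n.+2%:R).
Local Notation dF := (grad_primal pw pd th0 n.+1%:R n.+2%:R).
Local Notation theta := (local_inv pw pd th0).

Lemma phase_radius : exists2 r : R, 0 < r & forall w, `|P w| < r ->
  [/\ `|tau0 + P w - tau0| < inverse_radius pd th0,
      forall k, 0 < (tau0 + P w) ord0 k &
      Psi1 q n.+2 B (alpha + zsum_proj w.1) (beta + zsum_proj w.2) = (F (tau0 + P w))%:E].
Proof.
have [mu mu0 hmu] := mu_ex.
exists (Num.min mu (inverse_radius pd th0)); first by rewrite lt_min mu0 inverse_radius_gt0.
move=> w; rewrite lt_min => /andP[wmu wr].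
have h1 : `|tau0 + P w - tau0| < inverse_radius pd th0 by rewrite addrAC subrr add0r.
split => //.
  move=> k; rewrite mxE; have := le_lt_trans (coord_le_norm (P w) ord0 k) wmu.
  by rewrite ltr_norml => /andP[h _]; have := hmu k; lra.
have [_ gE] := local_invP pw0 pco h1.
have lE : alpha + zsum_proj w.1 = lsubmx (tau0 + P w).
  by rewrite tau0E /tangent_proj add_row_mx row_mxKl.
have rE : beta + zsum_proj w.2 = rsubmx (tau0 + P w).
  by rewrite tau0E /tangent_proj add_row_mx row_mxKr.
rewrite lE rE; apply: (Psi1_expK B0 q3 n gE).
  rewrite tau0E /tangent_proj add_row_mx; under eq_bigr do rewrite row_mxEl mxE.
  by rewrite big_split /= alpha1 zsum_proj_sum// addr0.
rewrite tau0E /tangent_proj add_row_mx; under eq_bigr do rewrite row_mxEr mxE.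
by rewrite big_split /= beta1 zsum_proj_sum// addr0.
Qed.

Lemma near0_proj (r : R) : 0 < r -> \forall w \near (0 : V), `|P w| < r.
Proof. by move=> r0; apply: (tangent_proj_near q0); rewrite raddf0 normr0. Qed.

Lemma restr_diff (r : R) w :
  (forall w, `|P w| < r ->
  [/\ `|tau0 + P w - tau0| < inverse_radius pd th0,
      forall k, 0 < (tau0 + P w) ord0 k &
      Psi1 q n.+2 B (alpha + zsum_proj w.1) (beta + zsum_proj w.2) = (F (tau0 + P w))%:E]) ->
  `|P w| < r ->
  differentiable (Psi1_restr n.+2 B alpha beta) w /\
  forall v, 'd (Psi1_restr n.+2 B alpha beta) w v = dF (P v) (tau0 + P w).
Proof.
move=> hr wr; have [h1 h2 _] := hr _ wr.
have [d1 d1E] := primal_diff pw0 pco 3 n.+1%:R n.+2%:R h1 h2.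
have [d2 d2E] := shift_tangent_diff q0 d1.
have [|d3 d3E] := near_eq_diff _ d2 (g := Psi1_restr n.+2 B alpha beta).
  apply: filterS (tangent_proj_near q0 wr) => w' hw'.
  by have [_ _] := hr _ hw'; rewrite /Psi1_restr => ->.
split; first exact: d3.
by move=> v; exact: etrans (congr1 (fun f => f v) d3E) (etrans (d2E v) (d1E _)).
Qed.

Lemma phase_hessian_dominant : hessian_dominant q n.+2 B alpha beta.
Proof.
have [r r0 hr] := phase_radius.
have nr := near0_proj r0.
have P0 : P 0 = 0 by rewrite raddf0.
have DG v : differentiable ('D_v (Psi1_restr n.+2 B alpha beta)) (0 : V) /\
    forall h, 'd ('D_v (Psi1_restr n.+2 B alpha beta)) (0 : V) h =
      n.+1%:R * (\sum_k P h ord0 k / tau0 ord0 k * P v ord0 k)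
      - n.+2%:R * dot ('d theta tau0 (P h)) (P v).
  have [d1 d1E] := grad_primal_diff pw0 pco n.+1%:R n.+2%:R (P v) tau0_gt0.
  rewrite -(addr0 tau0) -[X in tau0 + X]P0 in d1.
  have [d2 d2E] := shift_tangent_diff q0 d1.
  have [|d3 d3E] := near_eq_diff _ d2 (g := 'D_v (Psi1_restr n.+2 B alpha beta)).
    apply: filterS nr => w hw; have [d4 d4E] := restr_diff hr hw.
    exact: esym (etrans (deriveE v d4) (d4E v)).
  split; first exact: d3.
  move=> h; have e := d2E h; rewrite P0 addr0 in e.
  exact: etrans (congr1 (fun f => f h) d3E) (etrans e (d1E _)).
split => //.
- by apply: filterS nr => w /hr[_ _ ->].
- by apply: filterS nr => w hw; have [] := restr_diff hr hw.
- by move=> v; have [] := DG v.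
move=> w [w1 w2] wn0; have [d1 d1E] := DG w; rewrite (deriveE w d1) d1E.
(* The dual direction of [w]; its two blocks are the [f] and [g] of [curvature]. *)
set h := 'd theta tau0 (P w).
have hE : hessK pw pd th0 h = P w.
  by have [_] := local_inv_diff pw0 pco th0; exact.
have PE : P w = row_mx w.1 w.2 by rewrite /tangent_proj !zsum_proj_id.
pose f i := h ord0 (lshift q i); pose g j := h ord0 (rshift q j).
have gP : gauge (pvec (fun e => pw e * expR (dot (pd e) th0) * dot (pd e) h)) = 0.
  rewrite -hessK_pvec hE PE /gauge.
  under eq_bigr do rewrite row_mxEl; under [X in _ - X]eq_bigr do rewrite row_mxEr.
  by rewrite w1 w2 subrr.
have balanced := pvec_balanced q3 gP.
have w1E i : w.1 ord0 i = \sum_j x i j * (f i + g j).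
  have := pvec_l (fun e => pw e * expR (dot (pd e) th0) * dot (pd e) h) i.
  rewrite -hessK_pvec hE PE row_mxEl balanced subrr addr0 => ->.
  by apply: eq_bigr => j _; rewrite th0E dot_pdir_inl mulrA.
have w2E j : w.2 ord0 j = \sum_i x i j * (f i + g j).
  have := pvec_r (fun e => pw e * expR (dot (pd e) th0) * dot (pd e) h) j.
  rewrite -hessK_pvec hE PE row_mxEr balanced subrr subr0 => ->.
  by apply: eq_bigr => i _; rewrite th0E dot_pdir_inl mulrA.
have C := curvature (f := f) (g := g).
have {C}C : n.+1%:R * (\sum_i w.1 ord0 i ^+ 2 / alpha ord0 i + \sum_j w.2 ord0 j ^+ 2 / beta ord0 j) <
    n.+2%:R * (\sum_i f i * w.1 ord0 i + \sum_j g j * w.2 ord0 j).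
  under eq_bigr do rewrite w1E; under [X in _ + X]eq_bigr do rewrite w2E.
  under [X in _ < _ * (X + _)]eq_bigr do rewrite w1E.
  under [X in _ < _ * (_ + X)]eq_bigr do rewrite w2E.
  apply: C; first by under eq_bigr do rewrite -w1E.
  have [[i w1i]|w1z] := pselect (exists i, w.1 ord0 i != 0).
    by left; exists i; rewrite -w1E.
  right; apply: contrapT => w2z; move: wn0 => /eqP; apply.
  rewrite [LHS]surjective_pairing; congr pair; apply/rowP => i; rewrite mxE.
    by apply/eqP; apply: contraT => ai; case: w1z; exists i.
  by apply/eqP; apply: contraT => bi; case: w2z; exists i; rewrite -w2E.
rewrite PE subr_lt0; apply: le_lt_trans (lt_le_trans C _).
  rewrite big_split_ord tau0E le_eqVlt; apply/orP; left; apply/eqP.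
  congr (_ * (_ + _)); apply: eq_bigr => i _; rewrite ?row_mxEl ?row_mxEr; ring.
rewrite dot_split le_eqVlt; apply/orP; left; apply/eqP.
by congr (_ * (_ + _)); apply: eq_bigr => i _; rewrite ?row_mxEl ?row_mxEr.
Qed.
End PhaseHessian.

(** * Negative curvature *)

Section Curvature.
Variables (R : realType) (q n : nat) (x : 'I_q -> 'I_q -> R) (a b : 'I_q -> R).
Local Notation d := (n.+1%:R : R).
Hypotheses (a0 : forall i, 0 < a i) (b0 : forall j, 0 < b j).
Hypotheses (row : forall i, \sum_j x i j = a i) (col : forall j, \sum_i x i j = b j).
Hypotheses (a1 : \sum_i a i = 1) (b1 : \sum_j b j = 1).
Hypothesis contract_g : forall g, \sum_j b j * g j = 0 -> (exists j, g j != 0) ->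
  d ^+ 2 * \sum_i a i * ((\sum_j x i j * g j) / a i) ^+ 2 < \sum_j b j * g j ^+ 2.
Hypothesis contract_f : forall f, \sum_i a i * f i = 0 -> (exists i, f i != 0) ->
  d ^+ 2 * \sum_j b j * ((\sum_i x i j * f i) / b j) ^+ 2 < \sum_i a i * f i ^+ 2.

(** Read [x] as a joint law: [u] and [v] are the conditional expectations of [g] and [f], and [I] is
    the common pairing of [f] with [u] and of [g] with [v]. Then [2 d] times the difference of the
    sides is [(d+1) (N1 + N2 - d^2 (M1 + M2))], positive by contraction, plus [d-1] times the
    squared norms of [f - d u] and [g - d v]. *)
Lemma curvature_centered (f g : 'I_q -> R) :
  let w1 i := \sum_j x i j * (f i + g j) in
  let w2 j := \sum_i x i j * (f i + g j) in
  \sum_i a i * f i = 0 -> \sum_j b j * g j = 0 ->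
  (exists i, f i != 0) \/ (exists j, g j != 0) ->
  d * (\sum_i w1 i ^+ 2 / a i + \sum_j w2 j ^+ 2 / b j) <
  n.+2%:R * (\sum_i f i * w1 i + \sum_j g j * w2 j).
Proof.
move=> w1 w2 af bg fg0.
pose u i := (\sum_j x i j * g j) / a i; pose v j := (\sum_i x i j * f i) / b j.
have w1E i : w1 i = a i * (f i + u i).
  rewrite /w1; under eq_bigr do rewrite mulrDr.
  by rewrite big_split/= -mulr_suml row mulrDr [a i * u i]mulrC divfK// gt_eqF.
have w2E j : w2 j = b j * (g j + v j).
  rewrite /w2; under eq_bigr do rewrite mulrDr.
  by rewrite big_split/= -mulr_suml col mulrDr [b j * v j]mulrC divfK ?gt_eqF// addrC.
pose N1 := \sum_i a i * f i ^+ 2; pose N2 := \sum_j b j * g j ^+ 2.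
pose M1 := \sum_i a i * u i ^+ 2; pose M2 := \sum_j b j * v j ^+ 2.
pose I := \sum_i a i * (f i * u i).
have I2 : \sum_j b j * (g j * v j) = I.
  transitivity (\sum_j \sum_i x i j * f i * g j).
    apply: eq_bigr => j _; rewrite mulrCA [b j * v j]mulrC divfK ?gt_eqF// mulrC mulr_suml.
    by [].
  rewrite exchange_big; apply: eq_bigr => i _.
  rewrite mulrCA [a i * u i]mulrC divfK ?gt_eqF// mulr_sumr.
  by apply: eq_bigr => j _; ring.
have e1 : \sum_i w1 i ^+ 2 / a i = N1 + 2 * I + M1.
  rewrite mulr_sumr -!big_split; apply: eq_bigr => i _ /=; rewrite w1E.
  by field; rewrite gt_eqF.
have e2 : \sum_j w2 j ^+ 2 / b j = N2 + 2 * I + M2.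
  rewrite -I2 mulr_sumr -!big_split; apply: eq_bigr => j _ /=; rewrite w2E.
  by field; rewrite gt_eqF.
have e3 : \sum_i f i * w1 i = N1 + I.
  by rewrite -big_split; apply: eq_bigr => i _ /=; rewrite w1E; ring.
have e4 : \sum_j g j * w2 j = N2 + I.
  by rewrite -I2 -big_split; apply: eq_bigr => j _ /=; rewrite w2E; ring.
have s1 : 0 <= N1 - 2 * d * I + d ^+ 2 * M1.
  rewrite !mulr_sumr -sumrB -big_split; apply: sumr_ge0 => i _ /=.
  have : 0 <= a i * (f i - d * u i) ^+ 2 by rewrite mulr_ge0 ?sqr_ge0// ltW.
  by congr (0 <= _); ring.
have s2 : 0 <= N2 - 2 * d * I + d ^+ 2 * M2.
  rewrite -I2 !mulr_sumr -sumrB -big_split; apply: sumr_ge0 => i _ /=.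
  have : 0 <= b i * (g i - d * v i) ^+ 2 by rewrite mulr_ge0 ?sqr_ge0// ltW.
  by congr (0 <= _); ring.
have all0 (h : 'I_q -> R) : ~ (exists i, h i != 0) -> forall i, h i = 0.
  by move=> h0 i; apply/eqP; apply: contraT => hi; case: h0; exists i.
have c1 : d ^+ 2 * M1 <= N2.
  have [g0|g0] := pselect (exists j, g j != 0); first exact/ltW/contract_g.
  have gz := all0 _ g0; have -> : M1 = 0.
    apply: big1 => i _; rewrite /u big1 ?mul0r ?expr0n ?mulr0// => j _.
    by rewrite gz mulr0.
  by rewrite mulr0 sumr_ge0// => j _; rewrite mulr_ge0 ?sqr_ge0// ltW.
have c2 : d ^+ 2 * M2 <= N1.
  have [f0|f0] := pselect (exists j, f j != 0); first exact/ltW/contract_f.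
  have fz := all0 _ f0; have -> : M2 = 0.
    apply: big1 => i _; rewrite /v big1 ?mul0r ?expr0n ?mulr0// => j _.
    by rewrite fz mulr0.
  by rewrite mulr0 sumr_ge0// => j _; rewrite mulr_ge0 ?sqr_ge0// ltW.
have c : d ^+ 2 * (M1 + M2) < N1 + N2.
  rewrite mulrDr [N1 + N2]addrC; case: fg0 => [f0|g0].
    by rewrite ler_ltD//; exact: contract_f.
  by rewrite ltr_leD//; exact: contract_g.
rewrite e1 e2 e3 e4 -subr_gt0 -(pmulr_rgt0 _ (mulr_gt0 (ltr0Sn R 1) (ltr0Sn R n))).
have h1 : 0 < n.+2%:R * (N1 + N2 - d ^+ 2 * (M1 + M2)) by rewrite mulr_gt0// subr_gt0.
have h2 : 0 <= n%:R * ((N1 - 2 * d * I + d ^+ 2 * M1) + (N2 - 2 * d * I + d ^+ 2 * M2)).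
  by rewrite mulr_ge0// addr_ge0.
rewrite [X in 0 < X](_ : _ = n.+2%:R * (N1 + N2 - d ^+ 2 * (M1 + M2)) +
  n%:R * ((N1 - 2 * d * I + d ^+ 2 * M1) + (N2 - 2 * d * I + d ^+ 2 * M2))).
  exact: ltr_wpDr h2 h1.
ring.
Qed.

(** Only [f_i + g_j] enters [w1] and [w2], so [f] and [g] may be shifted by opposite constants. The
    choice of [t] centers [f], and the zero total of [w1] then centers [g]. *)
Lemma contraction_curvature (f g : 'I_q -> R) :
  let w1 i := \sum_j x i j * (f i + g j) in
  let w2 j := \sum_i x i j * (f i + g j) in
  \sum_i w1 i = 0 -> (exists i, w1 i != 0) \/ (exists j, w2 j != 0) ->
  d * (\sum_i w1 i ^+ 2 / a i + \sum_j w2 j ^+ 2 / b j) <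
  n.+2%:R * (\sum_i f i * w1 i + \sum_j g j * w2 j).
Proof.
move=> w1 w2 w10 wn0; pose t := - \sum_i a i * f i.
have w1s : \sum_i w1 i = \sum_i a i * f i + \sum_j b j * g j.
  transitivity (\sum_i (a i * f i + \sum_j x i j * g j)).
    apply: eq_bigr => i _; rewrite -row mulr_suml -big_split.
    by apply: eq_bigr => j _; rewrite mulrDr.
  rewrite big_split; congr (_ + _) => /=; rewrite exchange_big.
  by apply: eq_bigr => j _; rewrite -mulr_suml col.
have w20 : \sum_j w2 j = 0 by rewrite -[RHS]w10 /w1 /w2 exchange_big.
have xfg i j : x i j * (f i + t + (g j - t)) = x i j * (f i + g j) by ring.
have w1E i : \sum_j x i j * (f i + t + (g j - t)) = w1 i by apply: eq_bigr.
have w2E j : \sum_i x i j * (f i + t + (g j - t)) = w2 j by apply: eq_bigr.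
have h1 : \sum_i a i * (f i + t) = 0.
  by under eq_bigr do rewrite mulrDr; rewrite big_split -mulr_suml /= a1 /t mul1r subrr.
have h2 : \sum_j b j * (g j - t) = 0.
  under eq_bigr do rewrite mulrBr.
  by rewrite sumrB -mulr_suml b1 /t mul1r opprK addrC -w1s.
have h3 : (exists i, f i + t != 0) \/ (exists j, g j - t != 0).
  apply: contrapT => fg0.
  have fz i : f i + t = 0.
    by apply/eqP; apply: contraT => fi; case: fg0; left; exists i.
  have gz j : g j - t = 0.
    by apply/eqP; apply: contraT => fi; case: fg0; right; exists j.
  case: wn0 => [[i]|[j]]; rewrite -?w1E -?w2E big1 ?eqxx// => k _.
    by rewrite fz gz addr0 mulr0.
  by rewrite fz gz addr0 mulr0.
have := curvature_centered h1 h2 h3; rewrite /=.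
have -> : \sum_i (\sum_j x i j * (f i + t + (g j - t))) ^+ 2 / a i = \sum_i w1 i ^+ 2 / a i.
  by apply: eq_bigr => i _; rewrite w1E.
have -> : \sum_j (\sum_i x i j * (f i + t + (g j - t))) ^+ 2 / b j = \sum_j w2 j ^+ 2 / b j.
  by apply: eq_bigr => i _; rewrite w2E.
have -> : \sum_i (f i + t) * \sum_j x i j * (f i + t + (g j - t)) = \sum_i f i * w1 i.
  under eq_bigr do rewrite w1E mulrDl.
  by rewrite big_split -mulr_sumr /= w10 mulr0 addr0.
have -> : \sum_j (g j - t) * \sum_i x i j * (f i + t + (g j - t)) = \sum_j g j * w2 j.
  under eq_bigr do rewrite w2E mulrBl.
  by rewrite sumrB -mulr_sumr /= w20 mulr0 subr0.
by [].
Qed.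
End Curvature.

(** * Contraction of the linearized recursion at the half-half phases *)

Lemma sqr_sum_le (R : realType) (I : finType) (A : {pred I}) (u : I -> R) :
  (\sum_(i in A) u i) ^+ 2 <= #|A|%:R * \sum_(i in A) u i ^+ 2.
Proof.
have [A0|A0] := eqVneq #|A| 0%N.
  by rewrite A0 mul0r big1 ?expr0n// => i iA; move: A0 => /card0_eq/(_ i); rewrite iA.
have m0 : 0 < #|A|%:R :> R by rewrite ltr0n lt0n.
set S := \sum_(i in A) u i; set m : R := #|A|%:R in m0 *.
have : 0 <= \sum_(i in A) (m * u i - S) ^+ 2 by apply: sumr_ge0 => i _; exact: sqr_ge0.
have -> : \sum_(i in A) (m * u i - S) ^+ 2 = m * (m * (\sum_(i in A) u i ^+ 2) - S ^+ 2).
  transitivity (\sum_(i in A) (m ^+ 2 * u i ^+ 2 - 2 * m * S * u i + S ^+ 2)).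
    by apply: eq_bigr => i _; ring.
  rewrite big_split sumrB /= sumr_const -(mulr_natr (S ^+ 2)) -!mulr_sumr -/S -/m.
  ring.
by rewrite pmulr_rge0// subr_ge0.
Qed.

Section HalfContraction.
Variables (R : realType) (n : nat) (p r k s : R).
Local Notation d := n.+1.
Hypotheses (p0 : 0 < p) (pr : p < r) (k0 : 0 < k).
Hypotheses (fp : site n k p = r) (fr : site n k r = p).
Hypothesis kpr : k * (p ^+ d + r ^+ d) = 2 * s.
Hypothesis sd : 1 < d.+1%:R * s.
Hypothesis stable : (d%:R * k) ^+ 2 * (p * r) ^+ n < 1.

Let r0 : 0 < r. Proof. exact: lt_trans pr. Qed.
Let s0 : 0 < s. Proof. by rewrite -(pmulr_rgt0 _ (ltr0Sn R d)) (lt_trans _ sd). Qed.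
Let kp : k * p ^+ d = 1 - r. Proof. by rewrite -fp /site; ring. Qed.
Let kr : k * r ^+ d = 1 - p. Proof. by rewrite -fr /site; ring. Qed.
Let sE : 2 * s = 2 - p - r. Proof. by rewrite -kpr mulrDr kp kr; ring. Qed.

(** The factor, in squared norm, by which the sum over all spins changes the part of a balanced
    vector that is constant on [T] and on its complement. By [sd], [(1 - s) / s < d], so [stable]
    bounds it by 1. *)
Let lam : R := ((1 - s) / s * k) ^+ 2 * (p * r) ^+ n.

Let lam_lt1 : lam < 1.
Proof.
apply: le_lt_trans stable; rewrite ler_wpM2r//.
  by rewrite exprn_ge0// mulr_ge0// ltW.
have s1 : 0 <= 1 - s by move: sE p0 r0; lra.
rewrite lerXn2r// ?nnegrE ?mulr_ge0 ?invr_ge0 ?(ltW k0) ?(ltW s0)//.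
rewrite ler_pM2r// ler_pdivrMr// lerBlDr (_ : _ + s = d.+1%:R * s) ?ltW//.
by rewrite -(natr1 d); ring.
Qed.

(** [u, v] and [A, A'] stand for sums and sums of squares over [T] and its complement, [m] for
    [q/2]. For [c = 0] the bracket is [U], and [stable] alone suffices; the mean [c] adds
    [(lam - 1) W <= 0], [W] being the share of the block means in [U]. *)
Lemma contraction_core (m u v A A' c : R) : 0 < m ->
  u ^+ 2 <= m * A -> v ^+ 2 <= m * A' -> p * u + r * v = 0 -> 0 < A + A' ->
  c = (u + v) / (2 * m * s) ->
  (d%:R * k) ^+ 2 * (r ^+ n * (m * c ^+ 2 - 2 * c * u + A)
                   + p ^+ n * (m * c ^+ 2 - 2 * c * v + A'))
  < A / p ^+ n + A' / r ^+ n.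
Proof.
move=> m0 uA vA uv AA cdef.
have pn0 : 0 < p ^+ n by rewrite exprn_gt0.
have rn0 : 0 < r ^+ n by rewrite exprn_gt0.
have A0 : 0 <= A by rewrite -(pmulr_rge0 _ m0) (le_trans _ uA)// sqr_ge0.
have A'0 : 0 <= A' by rewrite -(pmulr_rge0 _ m0) (le_trans _ vA)// sqr_ge0.
set U := r ^+ n * A + p ^+ n * A'.
have U0 : 0 < U.
  rewrite lt_neqAle addr_ge0 ?mulr_ge0 ?(ltW rn0) ?(ltW pn0)// andbT eq_sym.
  apply: contraTneq AA => /eqP; rewrite paddr_eq0 ?mulr_ge0 ?(ltW rn0) ?(ltW pn0)//.
  rewrite !mulf_eq0 (gt_eqF rn0) (gt_eqF pn0) /= => /andP[/eqP-> /eqP->].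
  by rewrite addr0 ltxx.
pose w := u / r.
have uE : u = r * w by rewrite /w mulrC divfK// gt_eqF.
have vE : v = - (p * w).
  apply: (mulfI (lt0r_neq0 r0)); rewrite mulrN mulrCA -uE.
  by apply/eqP; rewrite -addr_eq0 addrC uv.
have cE : m * c = (r - p) * w / (2 * s).
  by rewrite cdef uE vE; field; rewrite !gt_eqF.
pose W := (r ^+ n.+2 + p ^+ n.+2) * w ^+ 2 / m.
(* From [p + r = 2 (1 - s)] and [1 - r = k p^d]; this is the origin of the factor [(1 - s) / s] in
   [lam]. *)
have hu : (m * c - u) = - (w * ((1 - s) / s * k) * p ^+ d).
  have -> : w * ((1 - s) / s * k) * p ^+ d = w * ((1 - s) / s) * (k * p ^+ d) by ring.
  have -> : s = (2 - p - r) / 2 by rewrite -sE; field.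
  rewrite cE sE kp uE; field.
  by rewrite -sE mulf_neq0 ?pnatr_eq0 ?gt_eqF.
have hv : (m * c - v) = w * ((1 - s) / s * k) * r ^+ d.
  have -> : w * ((1 - s) / s * k) * r ^+ d = w * ((1 - s) / s) * (k * r ^+ d) by ring.
  have -> : s = (2 - p - r) / 2 by rewrite -sE; field.
  rewrite cE sE kr vE; field.
  by rewrite -sE mulf_neq0 ?pnatr_eq0 ?gt_eqF.
have key : r ^+ n * (m * c ^+ 2 - 2 * c * u + A) + p ^+ n * (m * c ^+ 2 - 2 * c * v + A')
    = U + (lam - 1) * W.
  have e1 : m * c ^+ 2 - 2 * c * u = ((m * c - u) ^+ 2 - u ^+ 2) / m by field; rewrite gt_eqF.
  have e2 : m * c ^+ 2 - 2 * c * v = ((m * c - v) ^+ 2 - v ^+ 2) / m by field; rewrite gt_eqF.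
  rewrite e1 e2 hu hv uE vE /U /W /lam; move: ((1 - s) / s * k) => C.
  rewrite !(exprS _ n.+1) !(exprS _ n) [(p * r) ^+ n]exprMn.
  by field; rewrite !gt_eqF.
rewrite key; have W0 : 0 <= W.
  by rewrite divr_ge0 ?(ltW m0)// mulr_ge0 ?sqr_ge0// addr_ge0// exprn_ge0// ltW.
have prn0 : 0 < (p * r) ^+ n by rewrite exprn_gt0// mulr_gt0.
have -> : A / p ^+ n + A' / r ^+ n = U / (p * r) ^+ n.
  by rewrite /U exprMn; field; rewrite !gt_eqF.
rewrite ltr_pdivlMr// mulrAC.
apply: (@le_lt_trans _ _ ((d%:R * k) ^+ 2 * (p * r) ^+ n * U)).
  apply: ler_wpM2l; first by rewrite mulr_ge0 ?sqr_ge0// ltW.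
  by rewrite gerDl mulr_le0_ge0// subr_le0 ltW.
by rewrite gtr_pMl.
Qed.

Section Sites.
Variables (q : nat) (B : R).
Hypotheses (q4 : (4 <= q)%N) (q_even : ~~ odd q) (B1 : B < 1).
Hypothesis sB : s = (1 - B) / q%:R.

(** In the variable [ga = X^d g] the Potts matrix is a total sum minus [1 - B] times the identity,
    so the squared term becomes [(k / Y_i)^2 (c - ga_i)^2]. Summed over the two blocks this is
    [contraction_core]. *)
Lemma half_contraction (T : {set 'I_q}) (g : 'I_q -> R) : #|T| = (q %/ 2)%N ->
  \sum_j half_site p r T j ^+ n.+2 * g j = 0 -> (exists j, g j != 0) ->
  d%:R ^+ 2 * \sum_i half_site r p T i ^+ n.+2 *
    (k / (1 - B) / half_site r p T i *
     \sum_j potts_mx q B i j * (half_site p r T j ^+ d * g j)) ^+ 2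
  < \sum_j half_site p r T j ^+ n.+2 * g j ^+ 2.
Proof.
move=> cT bal [j0 gj0].
pose ga j := half_site p r T j ^+ d * g j.
pose m : R := (q %/ 2)%:R.
have m0 : 0 < m by rewrite ltr0n divn_gt0// (leq_trans _ q4).
have cT' := card_half_setC q_even cT.
pose u := \sum_(i in T) ga i; pose v := \sum_(i in ~: T) ga i.
pose A := \sum_(i in T) ga i ^+ 2; pose A' := \sum_(i in ~: T) ga i ^+ 2.
have split (F : 'I_q -> R) : \sum_i F i = \sum_(i in T) F i + \sum_(i in ~: T) F i.
  by rewrite (bigID (mem T))/=; congr (_ + _); apply: eq_bigl => i; rewrite ?inE.
have uA : u ^+ 2 <= m * A by have := sqr_sum_le (mem T) ga; rewrite cT.
have vA : v ^+ 2 <= m * A' by have := sqr_sum_le (mem (~: T)) ga; rewrite cT'.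
have pT i : i \in T -> half_site p r T i = p by rewrite /half_site => ->.
have rT i : i \in ~: T -> half_site p r T i = r by rewrite /half_site inE => /negbTE ->.
have pT' i : i \in T -> half_site r p T i = r by rewrite /half_site => ->.
have rT' i : i \in ~: T -> half_site r p T i = p by rewrite /half_site inE => /negbTE ->.
have uv : p * u + r * v = 0.
  rewrite -bal split /u /v !mulr_sumr; congr (_ + _); apply: eq_bigr => i iT.
    by rewrite /ga pT// (exprS p d); ring.
  by rewrite /ga rT// (exprS r d); ring.
have x0 i : 0 < half_site p r T i by rewrite /half_site; case: ifP.
have AA : 0 < A + A'.
  rewrite -split (bigD1 j0)//= ltr_pwDl ?sumr_ge0// => [|i _]; last exact: sqr_ge0.
  by rewrite exprn_even_gt0//= mulf_neq0// expf_neq0// gt_eqF.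
have km : 1 - B = 2 * m * s.
  by rewrite -(half_s B q4 q_even) -sB mulrCA mulrA.
have := contraction_core m0 uA vA uv AA erefl; rewrite -km.
set c := (u + v) / (1 - B) => core.
have Bn : 1 - B != 0 by rewrite subr_eq0 eq_sym lt_eqF.
have Y0 i : half_site r p T i != 0 by rewrite /half_site; case: ifP; rewrite gt_eqF.
have term i : half_site r p T i ^+ n.+2 *
    (k / (1 - B) / half_site r p T i * \sum_j potts_mx q B i j * ga j) ^+ 2 =
    k ^+ 2 * (half_site r p T i ^+ n * (c ^+ 2 - 2 * c * ga i + ga i ^+ 2)).
  rewrite potts_sum split -/u -/v /c !(exprS _ n.+1) !(exprS _ n); field.
  by rewrite Y0 Bn.
have sumsq (D : {set 'I_q}) (y w w2 : R) : #|D| = (q %/ 2)%N ->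
    (forall i, i \in D -> half_site r p T i = y) ->
    \sum_(i in D) ga i = w -> \sum_(i in D) ga i ^+ 2 = w2 ->
    \sum_(i in D) half_site r p T i ^+ n.+2 *
      (k / (1 - B) / half_site r p T i * \sum_j potts_mx q B i j * ga j) ^+ 2 =
    k ^+ 2 * (y ^+ n * (m * c ^+ 2 - 2 * c * w + w2)).
  move=> cD yD <- <-.
  transitivity (\sum_(i in D) k ^+ 2 * (y ^+ n * (c ^+ 2 - 2 * c * ga i + ga i ^+ 2))).
    by apply: eq_bigr => i iD; rewrite term yD.
  rewrite -mulr_sumr -mulr_sumr big_split sumrB /= sumr_const cD -mulr_sumr.
  by rewrite -(mulr_natl (c ^+ 2)).
have gsq (D : {set 'I_q}) (y : R) : 0 < y ->
    (forall i, i \in D -> half_site p r T i = y) ->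
    \sum_(j in D) half_site p r T j ^+ n.+2 * g j ^+ 2 = (\sum_(j in D) ga j ^+ 2) / y ^+ n.
  move=> y0 yD; rewrite mulr_suml; apply: eq_bigr => i iD.
  rewrite /ga yD// !(exprS y n.+1) !(exprS y n); field.
  by rewrite expf_neq0// gt_eqF.
rewrite [X in _ < X]split (gsq T p)// (gsq (~: T) r)//.
rewrite [X in _ * X]split (sumsq T r u A)// (sumsq (~: T) p v A')//.
rewrite [X in X < _](_ : _ = (d%:R * k) ^+ 2 *
  (r ^+ n * (m * c ^+ 2 - 2 * c * u + A) + p ^+ n * (m * c ^+ 2 - 2 * c * v + A')))//.
ring.
Qed.
End Sites.
End HalfContraction.

Section HalfHessian.
Variables (R : realType) (q n : nat) (B p r k G : R).
Local Notation d := n.+1.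
Local Notation s := ((1 - B) / q%:R).
Hypotheses (q4 : (4 <= q)%N) (q_even : ~~ odd q) (n0 : (0 < n)%N).
Hypotheses (B0 : 0 <= B) (B1 : B < 1).
Hypotheses (p0 : 0 < p) (pr : p < r) (k0 : 0 < k).
Hypotheses (fp : site n k p = r) (fr : site n k r = p).
Hypothesis kpr : k * (p ^+ d + r ^+ d) = 2 * s.
Hypothesis sd : 1 < d.+1%:R * s.
Hypothesis stable : (d%:R * k) ^+ 2 * (p * r) ^+ n < 1.
Hypotheses (G0 : 0 < G) (GE : G ^+ d.+1 = half_G_pow q n p r).
Variable T : {set 'I_q}.
Hypothesis cT : #|T| = (q %/ 2)%N.
Local Notation X := (half_site p r T).
Local Notation Y := (half_site r p T).
Local Notation V := (opt_value n B k G).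

Let r0 : 0 < r. Proof. exact: lt_trans pr. Qed.
Let X0 i : 0 < X i. Proof. by rewrite /half_site; case: ifP. Qed.
Let Y0 i : 0 < Y i. Proof. by rewrite /half_site; case: ifP. Qed.
Let fX i : site n k (X i) = Y i. Proof. by rewrite (site_half fp fr). Qed.
Let fX0 i : 0 < site n k (X i). Proof. by rewrite fX. Qed.
Let ffX := site_site_half fp fr T.
Let sumX := sum_half_site q4 q_even kpr cT.
Let sumfX := sum_site_half q4 q_even fp fr kpr cT.
Let GX : G ^+ d.+1 = \sum_i X i ^+ d.+1. Proof. by rewrite GE (half_siteG _ _ _ q_even cT). Qed.

Local Notation alpha := (opt_alpha n k G X).
Local Notation beta := (opt_beta n G X).
Local Notation rho := (opt_rho n B k G X).
Local Notation gam := (opt_gam n G X).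
Local Notation x i j := (potts_mx q B i j * rho i * gam j).

Let alphaE i : alpha ord0 i = (Y i / G) ^+ d.+1. Proof. by rewrite mxE fX. Qed.
Let betaE j : beta ord0 j = (X j / G) ^+ d.+1. Proof. by rewrite mxE. Qed.
Let alpha0 i : 0 < alpha ord0 i. Proof. by rewrite alphaE exprn_gt0// divr_gt0. Qed.
Let beta0 j : 0 < beta ord0 j. Proof. by rewrite betaE exprn_gt0// divr_gt0. Qed.
Let Bn : 1 - B != 0. Proof. by rewrite subr_eq0 eq_sym lt_eqF. Qed.
Let Gn : G != 0. Proof. by rewrite gt_eqF. Qed.
Let kn : k != 0. Proof. by rewrite gt_eqF. Qed.
Let Xn i : X i != 0. Proof. by rewrite gt_eqF. Qed.
Let Yn i : Y i != 0. Proof. by rewrite gt_eqF. Qed.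
Let GD : 0 < (G ^+ d.+1)^-1. Proof. by rewrite invr_gt0 exprn_gt0. Qed.

Let contract_g (g : 'I_q -> R) : \sum_j beta ord0 j * g j = 0 -> (exists j, g j != 0) ->
  d%:R ^+ 2 * \sum_i alpha ord0 i * ((\sum_j x i j * g j) / alpha ord0 i) ^+ 2
  < \sum_j beta ord0 j * g j ^+ 2.
Proof.
move=> bg gn.
have bE (h : 'I_q -> R) : \sum_j beta ord0 j * h j = (G ^+ d.+1)^-1 * \sum_j X j ^+ n.+2 * h j.
  rewrite mulr_sumr; apply: eq_bigr => j _; rewrite betaE exprMn exprVn; ring.
have bal : \sum_j X j ^+ n.+2 * g j = 0.
  by apply/eqP; move/eqP: bg; rewrite bE mulf_eq0 gt_eqF.
have := half_contraction p0 pr k0 fp fr kpr sd stable q4 q_even B1 erefl cT bal gn.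
rewrite -(ltr_pM2l GD) -bE; congr (_ < _); rewrite mulrCA; congr (_ * _).
rewrite mulr_sumr; apply: eq_bigr => i _; rewrite alphaE.
have -> : (\sum_j x i j * g j) / (Y i / G) ^+ n.+2 =
    k / (1 - B) / Y i * \sum_j potts_mx q B i j * (X j ^+ n.+1 * g j).
  rewrite mulr_suml mulr_sumr; apply: eq_bigr => j _.
  rewrite /opt_rho /opt_gam fX /opt_value !exprMn !exprVn.
  rewrite !(exprS (Y i) n.+1) !(exprS G n.+1) !(exprS G n); field.
  by rewrite !expf_neq0// Gn Yn kn Bn.
by move: (k / _ / _ * _) => Z; rewrite exprMn exprVn; ring.
Qed.

(** Exchanging the sides of the graph replaces [T] by its complement, again a half-set. *)
Let contract_f (f : 'I_q -> R) : \sum_i alpha ord0 i * f i = 0 -> (exists i, f i != 0) ->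
  d%:R ^+ 2 * \sum_j beta ord0 j * ((\sum_i x i j * f i) / beta ord0 j) ^+ 2
  < \sum_i alpha ord0 i * f i ^+ 2.
Proof.
move=> af fn.
have aE (h : 'I_q -> R) : \sum_j alpha ord0 j * h j = (G ^+ d.+1)^-1 * \sum_j Y j ^+ n.+2 * h j.
  rewrite mulr_sumr; apply: eq_bigr => j _; rewrite alphaE exprMn exprVn; ring.
have bal : \sum_j Y j ^+ n.+2 * f j = 0.
  by apply/eqP; move/eqP: af; rewrite aE mulf_eq0 gt_eqF.
have cT' := card_half_setC q_even cT.
have XC : half_site p r (~: T) =1 Y.
  by move=> i; rewrite /half_site inE; case: (i \in T).
have YC : half_site r p (~: T) =1 X.
  by move=> i; rewrite /half_site inE; case: (i \in T).
have balC : \sum_j half_site p r (~: T) j ^+ n.+2 * f j = 0.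
  by rewrite -[RHS]bal; apply: eq_bigr => j _; rewrite XC.
have := half_contraction p0 pr k0 fp fr kpr sd stable q4 q_even B1 erefl cT' balC fn.
rewrite [X in _ < X](eq_bigr (fun j => Y j ^+ n.+2 * f j ^+ 2)) => [|j _]; last by rewrite XC.
rewrite -(ltr_pM2l GD) -aE; congr (_ < _); rewrite mulrCA; congr (_ * _).
rewrite mulr_sumr; apply: eq_bigr => j _; rewrite betaE YC.
have -> : (\sum_i x i j * f i) / (X j / G) ^+ n.+2 =
    k / (1 - B) / X j * \sum_i potts_mx q B j i * (half_site p r (~: T) i ^+ n.+1 * f i).
  rewrite mulr_suml mulr_sumr; apply: eq_bigr => i _.
  have -> : potts_mx q B j i = potts_mx q B i j by rewrite !mxE eq_sym.
  rewrite XC /opt_rho /opt_gam fX /opt_value !exprMn !exprVn.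
  rewrite !(exprS (X j) n.+1) !(exprS G n.+1) !(exprS G n); field.
  by rewrite !expf_neq0// Gn Xn kn Bn.
by move: (k / _ / _ * _) => Z; rewrite exprMn exprVn; ring.
Qed.

Lemma half_hessian_dominant : hessian_dominant q d.+1 B alpha beta.
Proof.
have row i : \sum_j x i j = alpha ord0 i by exact: (opt_row k0 B1 sumX G0 i).
have col j : \sum_i x i j = beta ord0 j by exact: (opt_col k0 B1 ffX sumfX G0 j).
have [_ a1] := opt_alpha_simplex k0 fX0 ffX sumX sumfX G0 GX.
have [_ b1] := opt_beta_simplex X0 G0 GX.
apply: (@phase_hessian_dominant R q n B alpha beta rho gam) => //.
- exact: leq_trans q4.
- by move=> i; exact: (opt_rho_gt0 k0 B1 fX0 G0 i).
- by move=> i; exact: (opt_gam_gt0 n X0 G0 i).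
- move=> f g w1 w2 w10 wn.
  exact: (contraction_curvature alpha0 beta0 row col a1 b1 contract_g contract_f w10 wn).
- exact: (opt_dominant n0 k0 B0 B1 X0 fX0 ffX sumX sumfX
    (half_site_min n0 p0 pr k0 fp fr stable T) G0 GX).
Qed.
End HalfHessian.

Theorem theorem5 (R : realType) (q Delta : nat) (B : R) :
  (3 <= q)%N -> (3 <= Delta)%N -> 0 <= B -> B < 1 ->
  ((Delta%:R - q%:R) / Delta%:R <= B ->
     exists alpha beta : 'rV[R]_q,
       [/\ dominant_phase q Delta B alpha beta,
           (forall alpha' beta', dominant_phase q Delta B alpha' beta' ->
              alpha' = alpha /\ beta' = beta) &
           alpha = beta])
  /\
  (~~ odd q -> (4 <= q)%N -> B < (Delta%:R - q%:R) / Delta%:R ->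
     exists a b : R, a != b /\
       (forall alpha beta : 'rV[R]_q,
          dominant_phase q Delta B alpha beta <->
          exists T : {set 'I_q}, #|T| = (q %/ 2)%N /\
            forall i, alpha ord0 i = (if i \in T then a else b) /\
                      beta ord0 i = (if i \in T then b else a))
       /\
       (forall T : {set 'I_q}, #|T| = (q %/ 2)%N ->
          hessian_dominant q Delta B
            (\row_i (if i \in T then a else b))
            (\row_i (if i \in T then b else a)))).
Proof.
move=> q3; case: Delta => [//|[//|n]] n0 B0 B1.
have {}n0 : (0 < n)%N by [].
have q0 : 0 < q%:R :> R by rewrite ltr0n (leq_trans _ q3).
have q1 : (1 < q)%N by exact: leq_trans q3.
split=> [hB|q_even q4 hB].
  apply: uniform_phase => //; rewrite mulrA ler_pdivrMr// mul1r.
  by move: hB; rewrite ler_pdivrMr ?ltr0n//; lra.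
(* The assumption on [B] is [Delta s > 1], and [q >= 4] gives [s <= 1/4]: the two inputs of the
   cycle construction. *)
pose s := (1 - B) / q%:R.
have sd : 1 < n.+2%:R * s.
  rewrite /s mulrA ltr_pdivlMr// mul1r.
  by move: hB; rewrite ltr_pdivlMr ?ltr0n//; lra.
have s2 : s < 1 / 2.
  rewrite /s ltr_pdivrMr//; have : 4 <= q%:R :> R by rewrite ler_nat.
  by move: B0; lra.
have [p [r [k [[p0 pr k0] fp fr kpr stable]]]] := two_cycle_exists n0 sd s2.
have r0 := lt_trans p0 pr.
have X0 : 0 < half_G_pow q n p r.
  by rewrite mulr_gt0 ?addr_gt0 ?exprn_gt0// ltr0n divn_gt0// (leq_trans _ q4).
have [G G0 GE] := pos_root_exists n.+1 X0.
exists ((r / G) ^+ n.+2), ((p / G) ^+ n.+2); split; [|split].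
- by rewrite gt_eqF// ltrXn2r ?divr_ge0 ?ltW// ltr_pM2r ?invr_gt0.
- exact: (half_phases q4 q_even n0 B0 B1 p0 pr k0 fp fr kpr stable G0 GE).
- move=> T cT.
  have := half_hessian_dominant q4 q_even n0 B0 B1 p0 pr k0 fp fr kpr sd stable G0 GE cT.
  congr hessian_dominant; apply/rowP => i; rewrite !mxE.
    by rewrite (site_half fp fr); case: ifP.
  by rewrite /half_site; case: ifP.
Qed.
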